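(* Assume that $\gamma>1$, and let $\mu$ be a nonnegative bounded Radon measure on $\Omega$, concentrated on a set $E\subset\Omega$ of zero harmonic capacity. Then there is no solution to $$-\operatorname{div}\bigg(\frac{a(x,\nabla u)}{(1+u)^\gamma}\bigg)+u=\mu\ \text{ in }\Omega,\qquad u=0\ \text{ on }\partial\Omega.$$ More precisely, if $\{f_n\}$ is a sequence of nonnegative $L^\infty(\Omega)$ functions which converges to $\mu$ in the tight sense of measures, and if $u_n\in H_0^1(\Omega)\cap L^\infty(\Omega)$ is, for each $n$, the weak solution of $$-\operatorname{div}\bigg(\frac{a(x,\nabla u_n)}{(1+|u_n|)^\gamma}\bigg)+u_n=f_n\ \text{ in }\Omega,\qquad u_n=0\ \text{ on }\partial\Omega,$$ then $u_n$ tends to zero almost everywhere in $\Omega$ as $n\to+\infty$, and $$\lim_{n\to+\infty}\int_\Omega u_n\,\varphi=\int_\Omega\varphi\,d\mu\qquad\text{for every }\varphi\in W_0^{1,\infty}(\Omega).$$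
   Context: $\Omega$ is a bounded open subset of $\mathbb{R}^N$, $N>2$. $W_0^{1,\infty}(\Omega)=W^{1,\infty}(\Omega)\cap W_0^{1,1}(\Omega)$. The function $a:\Omega\times\mathbb{R}^N\to\mathbb{R}^N$ is a Carathéodory function (i.e. $a(\cdot,\xi)$ is measurable on $\Omega$ for every $\xi\in\mathbb{R}^N$, and $a(x,\cdot)$ is continuous on $\mathbb{R}^N$ for almost every $x\in\Omega$) such that, for some positive constants $\alpha,\beta$, for almost every $x\in\Omega$ and every $\xi,\eta\in\mathbb{R}^N$ with $\xi\neq\eta$: $$a(x,\xi)\cdot\xi\geq\alpha|\xi|^2,\qquad |a(x,\xi)|\leq\beta|\xi|,\qquad [a(x,\xi)-a(x,\eta)]\cdot(\xi-\eta)>0.$$ Harmonic capacity is the capacity in $\Omega$ associated with $H_0^1(\Omega)$: for compact $K\subset\Omega$ it is $\inf\{\int_\Omega|\nabla\psi|^2:\psi\in C_c^\infty(\Omega),\ \psi\geq1\text{ on }K\}$, extended to open sets by inner approximation and then to arbitrary sets by outer approximation. The measure $\mu$ is concentrated on a Borel set $E$ if $\mu(B)=\mu(B\cap E)$ for every Borel set $B\subset\Omega$. Tight convergence of $f_n$ to $\mu$ means $\lim_{n\to+\infty}\int_\Omega f_n\varphi=\int_\Omega\varphi\,d\mu$ for every $\varphi\in C^0(\overline\Omega)$. Weak solution means $\int_\Omega\frac{a(x,\nabla u_n)\cdot\nabla\varphi}{(1+|u_n|)^\gamma}+\int_\Omega u_n\varphi=\int_\Omega f_n\varphi$ for all $\varphi\in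 H_0^1(\Omega)$; such a $u_n\in H_0^1(\Omega)\cap L^\infty(\Omega)$ exists, is unique, and is nonnegative since $f_n\geq0$.
   Formalization: ''u_n tends to zero a.e.'' holds only up to subsequences (each subsequence has a further one tending to 0 a.e.); ''no solution'' needs μ(Ω)>0 and means no nonnegative distributional W_0^{1,1} solution that is an a.e. limit of the approximating u_n. *)

(* Defs.v *)
From HB Require Import structures.
From mathcomp Require Import all_boot all_order all_algebra.
From mathcomp Require Import all_classical all_reals all_analysis.
Set Implicit Arguments.
Unset Strict Implicit.
Unset Printing Implicit Defensive.
Import Order.TTheory GRing.Theory Num.Theory.
Import numFieldNormedType.Exports.
Local Open Scope classical_set_scope.
Local Open Scope ring_scope.

(* Borel sigma-algebra. *)
HB.instance Definition _ (R : realType) m n :=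
  @isMeasurable.Build (sigma_display (@open 'M[R]_(m, n))) 'M[R]_(m, n)
    <<s @open 'M[R]_(m, n) >> (@sigma_algebra0 _ _ _) (@sigma_algebraC _ _)
    (@sigma_algebra_bigcup _ _ _).

Section lebesgue_rV.
Context {R : realType}.

Lemma open_measurable_mx m n (U : set 'M[R]_(m, n)) : open U -> measurable U.
Proof. by move=> oU; exact: sub_sigma_algebra. Qed.

Lemma measurable_coord n (i : 'I_n) :
  measurable_fun [set: 'rV[R]_n] (fun v => v 0 i).
Proof.
move=> mD; apply: (measurability _ (measurable_realfun.RGenOpens.measurableE R)) => //.
move=> _ [_ [a [b ->] <-]]; rewrite setTI; apply: open_measurable_mx.
by apply: open_comp; [move=> + _; exact: coord_continuous|exact: interval_open].
Qed.

Let box n (q : {ffun 'I_n -> rat * rat}) : set 'rV[R]_n :=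
  [set v | forall i, v 0 i \in `](ratr (q i).1), (ratr (q i).2)[].

Lemma open_rV_boxes n (U : set 'rV[R]_n) : open U ->
  U = \bigcup_(q in [set q | box q `<=` U]) box q.
Proof.
move=> oU; apply/seteqP; split=> [v Uv|v [q qU]]; last exact: qU.
have /nbhs_ballP[e /= e0 eU] : nbhs v U by exact: open_nbhs_nbhs.
have lo i : exists q, (ratr q : R) \in `](v 0 i - e), (v 0 i)[.
  by apply: rat_in_itvoo; rewrite ltrBlDr ltrDl.
have hi i : exists q, (ratr q : R) \in `](v 0 i), (v 0 i + e)[.
  by apply: rat_in_itvoo; rewrite ltrDl.
pose q := [ffun i : 'I_n => (xchoose (lo i), xchoose (hi i))].
exists q => /=.
  move=> w bw; apply: eU; split => // i j; rewrite ord1.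
  have := bw j; have := xchooseP (lo j); have := xchooseP (hi j).
  rewrite !ffunE /= !in_itv/= => /andP[a1 a2] /andP[b1 b2] /andP[c1 c2].
  rewrite /ball/= ltr_norml; apply/andP; split.
    by rewrite ltrBrDl -ltrBrDr opprK addrC (lt_trans c2)// addrC.
  by rewrite ltrBlDl -ltrBlDr (lt_trans b1).
move=> i; have := xchooseP (lo i); have := xchooseP (hi i).
by rewrite !ffunE /= !in_itv/= => /andP[-> _] /andP[_ ->].
Qed.

Definition cons_rV n (p : measurableTypeR R * 'rV[R]_n) : 'rV[R]_n.+1 :=
  row_mx (p.1 : R)%:M p.2.

Lemma cons_rV0 n (p : measurableTypeR R * 'rV[R]_n) :
  cons_rV p 0 ord0 = p.1.
Proof.
transitivity (row_mx ((p.1 : R)%:M : 'M[R]_1) p.2 0 (lshift n ord0)).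
  by rewrite /cons_rV; congr (fun_of_matrix _ _ _); exact/val_inj.
by rewrite row_mxEl mxE eqxx mulr1n.
Qed.

Lemma cons_rVS n (p : measurableTypeR R * 'rV[R]_n) i :
  cons_rV p 0 (lift ord0 i) = p.2 0 i.
Proof.
transitivity (row_mx ((p.1 : R)%:M : 'M[R]_1) p.2 0 (rshift 1 i)).
  by rewrite /cons_rV; congr (fun_of_matrix _ _ _); exact/val_inj.
by rewrite row_mxEr.
Qed.

Lemma measurable_box n (A : 'I_n -> set (measurableTypeR R)) :
  (forall i, measurable (A i)) ->
  measurable [set v : 'rV[R]_n | forall i, A i (v 0 i)].
Proof.
move=> mA.
rewrite (_ : [set _ | _] =
    \bigcap_(i in [set: 'I_n]) ((fun v : 'rV[R]_n => v 0 i) @^-1` A i)).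
  apply: fin_bigcap_measurable => // i _.
  have := @measurable_coord n i measurableT _ (mA i).
  by rewrite setTI.
by apply/seteqP; split=> v /= h i; [move=> _; exact: h|exact: h].
Qed.

Lemma preimage_cons_box n (A : 'I_n.+1 -> set (measurableTypeR R)) :
  @cons_rV n @^-1` [set v | forall i, A i (v 0 i)] =
  A ord0 `*` [set v : 'rV[R]_n | forall i, A (lift ord0 i) (v 0 i)].
Proof.
apply/seteqP; split=> p /=.
  move=> h; split; first by rewrite -cons_rV0.
  by move=> i; rewrite -cons_rVS.
move=> [h0 h1] i; case: (unliftP ord0 i) => [j ->|->].
  by rewrite cons_rVS.
by rewrite cons_rV0.
Qed.

Lemma measurable_cons_rV n :
  measurable_fun [set: measurableTypeR R * 'rV[R]_n] (@cons_rV n).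
Proof.
apply: (measurability (@open 'rV[R]_n.+1)) => // _ [U oU <-].
rewrite setTI (open_rV_boxes oU) preimage_bigcup bigcup_mkcond.
apply: countable_bigcupT_measurable; first exact: countableP.
move=> q; case: ifPn => // _; 
rewrite (preimage_cons_box
  (fun i => [set` `](ratr (q i).1), (ratr (q i).2)[] : set R)).
apply: measurableX; first exact: measurable_itv.
apply: (measurable_box (A := fun i => [set`
  `](ratr (q (lift ord0 i)).1), (ratr (q (lift ord0 i)).2)[] : set R)) => i.
exact: measurable_itv.
Qed.

Definition uncons_rV n (v : 'rV[R]_n.+1) : measurableTypeR R * 'rV[R]_n :=
  (v 0 ord0, \row_i v 0 (lift ord0 i)).

Lemma cons_rVK n : cancel (@cons_rV n) (@uncons_rV n).
Proof.
move=> p; rewrite [RHS]surjective_pairing /uncons_rV cons_rV0; congr pair.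
by apply/rowP => i; rewrite mxE cons_rVS.
Qed.

Lemma measurable_uncons_rV n : measurable_fun [set: 'rV[R]_n.+1] (@uncons_rV n).
Proof.
apply/measurable_fun_pairP; split; first exact: measurable_coord.
apply: (measurability (@open 'rV[R]_n)) => // _ [U oU <-].
rewrite setTI (open_rV_boxes oU) preimage_bigcup bigcup_mkcond.
apply: countable_bigcupT_measurable; first exact: countableP.
move=> q; case: ifPn => // _.
rewrite (_ : _ @^-1` _ =
    \bigcap_(i in [set: 'I_n]) ((fun v : 'rV[R]_n.+1 => v 0 (lift ord0 i)) @^-1`
      `](ratr (q i).1), (ratr (q i).2)[)).
  apply: fin_bigcap_measurable => // i _.
  rewrite -[X in measurable X]setTI.
  by apply: (@measurable_coord n.+1 (lift ord0 i)) => //; exact: measurable_itv.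
by apply/seteqP; split=> v /= h i; have := h i; rewrite mxE //; apply.
Qed.

Section step.
Variables (n : nat) (m : {sigma_finite_measure set 'rV[R]_n -> \bar R}).

Definition lebesgue_rV_step : set 'rV[R]_n.+1 -> \bar R :=
  pushforward (@lebesgue_measure R \x m)%E (@cons_rV n).

Let step0 : lebesgue_rV_step set0 = 0%E.
Proof. by rewrite /lebesgue_rV_step /pushforward preimage_set0 measure0. Qed.

Let step_ge0 A : (0 <= lebesgue_rV_step A)%E.
Proof. by rewrite /lebesgue_rV_step /pushforward measure_ge0. Qed.

Let step_sigma_additive : semi_sigma_additive lebesgue_rV_step.
Proof.
move=> F mF tF mUF; rewrite /lebesgue_rV_step /pushforward preimage_bigcup.
have mc A : measurable A -> measurable (@cons_rV n @^-1` A).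
  by move=> mA; rewrite -[X in measurable X]setTI; exact: measurable_cons_rV.
apply: measure_semi_sigma_additive.
- by move=> k; exact: mc.
- apply/trivIsetP => /= i j _ _ ij; rewrite -preimage_setI.
  by move/trivIsetP : tF => /(_ _ _ _ _ ij) ->//; rewrite preimage_set0.
- by rewrite -preimage_bigcup; exact: mc.
Qed.

HB.instance Definition _ := isMeasure.Build _ _ _ lebesgue_rV_step
  step0 step_ge0 step_sigma_additive.

Let step_sigma_finite : sigma_finite setT lebesgue_rV_step.
Proof.
have /sigma_finiteP[F [TF ndF Foo]] := sigma_finiteT (@lebesgue_measure R).
have /sigma_finiteP[G [TG ndG Goo]] := sigma_finiteT m.
exists (fun k => @uncons_rV n @^-1` (F k `*` G k)).
  rewrite -preimage_bigcup; apply/esym; rewrite -subTset => v _ /=.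
  have [k _ Fk] : (\bigcup_k F k) (uncons_rV v).1 by rewrite -TF.
  have [l _ Gl] : (\bigcup_k G k) (uncons_rV v).2 by rewrite -TG.
  exists (maxn k l) => //; split.
  - by move: Fk; exact/subsetPset/ndF/leq_maxl.
  - by move: Gl; exact/subsetPset/ndG/leq_maxr.
move=> k; have [mF ooF] := Foo k; have [mG ooG] := Goo k; split.
  rewrite -[X in measurable X]setTI.
  by apply: measurable_uncons_rV => //; exact: measurableX.
rewrite /lebesgue_rV_step /pushforward -comp_preimage.
rewrite (_ : _ \o _ = id); last by apply/funext => p /=; exact: cons_rVK.
by rewrite preimage_id product_measure1E// lte_mul_pinfty// ge0_fin_numE.
Qed.

HB.instance Definition _ := Measure_isSigmaFinite.Build _ _ _ lebesgue_rV_step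
  step_sigma_finite.

End step.

Fixpoint lebesgue_rV n : {sigma_finite_measure set 'rV[R]_n -> \bar R} :=
  match n with
  | 0%N => dirac (0 : 'rV[R]_0)
  | n'.+1 => lebesgue_rV_step (lebesgue_rV n')
  end.

Lemma lebesgue_rV_box n (A : 'I_n -> set (measurableTypeR R)) :
  (forall i, measurable (A i)) ->
  lebesgue_rV n [set v | forall i, A i (v 0 i)] =
  (\prod_(i < n) lebesgue_measure (A i))%E.
Proof.
elim: n A => [|n IH] A mA.
  by rewrite big_ord0 /= diracE mem_set//; case.
rewrite big_ord_recl /= /lebesgue_rV_step /pushforward preimage_cons_box.
rewrite product_measure1E//=; last first.
  exact: (measurable_box (A := fun i => A (lift ord0 i))).
by rewrite (IH (fun i => A (lift ord0 i))).
Qed.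

End lebesgue_rV.

Section sobolev.
Context {R : realType} {N : nat}.
Local Notation E := 'rV[R]_N.
Local Notation leb := (lebesgue_rV N : {measure set E -> \bar R}).
Implicit Types (Omega : set E) (u f phi : E -> R) (Du : E -> E).

Definition dot (x y : E) : R := \sum_i x 0 i * y 0 i.

(* The library's norm `|x| on row vectors is the sup norm. *)
Definition enorm (x : E) : R := Num.sqrt (dot x x).

Definition partial (i : 'I_N) f : E -> R := 'D_(delta_mx 0 i) f.

Definition grad f : E -> E := fun x => \row_i partial i f x.

Fixpoint Ck (k : nat) f : Prop :=
  match k with
  | 0%N => continuous f
  | k'.+1 => continuous f /\ forall i : 'I_N,
      (forall x, derivable f x (delta_mx 0 i)) /\ Ck k' (partial i f)
  end.

Definition smooth f := forall k, Ck k f.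

Definition Cc_infty Omega f :=
  [/\ smooth f, compact (closure [set x | f x != 0])
    & closure [set x | f x != 0] `<=` Omega].

(* Functions on Omega are total functions, whose values outside of Omega are
   irrelevant: u \_ Omega is the extension of u by zero. *)
Definition Lp Omega (p : \bar R) u := u \_ Omega \in Lfun leb p.

Definition weak_gradient Omega u Du := forall phi, Cc_infty Omega phi ->
  forall i, \int[leb]_(x in Omega) (u x * partial i phi x) =
            - \int[leb]_(x in Omega) (Du x 0 i * phi x).

Definition W1 Omega (p : \bar R) u Du :=
  [/\ Lp Omega p u, forall i, Lp Omega p (fun x => Du x 0 i)
    & weak_gradient Omega u Du].

Definition W1_cvg Omega (p : \bar R) (psi : nat -> E -> R) u Du :=
  ('N[leb]_p[EFin \o ((psi k \- u) \_ Omega)%R] @[k --> \oo] --> 0)%E /\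
  forall i, ('N[leb]_p[EFin \o ((fun x => partial i (psi k) x - Du x 0 i)
    \_ Omega)%R] @[k --> \oo] --> 0)%E.

(* The closure of Cc_infty Omega in W^{1,p}(Omega), for p < +oo. *)
Definition W10 Omega (p : \bar R) u Du :=
  W1 Omega p u Du /\ exists psi : nat -> E -> R,
    (forall k, Cc_infty Omega (psi k)) /\ W1_cvg Omega p psi u Du.

Definition H10 Omega := W10 Omega 2%:E.

Definition W10infty Omega u Du := W1 Omega +oo%E u Du /\ W10 Omega 1%E u Du.

Definition capacity_compact Omega (K : set E) : \bar R :=
  ereal_inf [set (\int[leb]_(x in Omega) (enorm (grad psi x) ^+ 2)%:E)%E |
    psi in [set psi | Cc_infty Omega psi /\ forall x, K x -> 1 <= psi x]].

Definition capacity_open Omega (U : set E) : \bar R :=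
  ereal_sup [set capacity_compact Omega K |
    K in [set K | compact K /\ K `<=` U]].

Definition capacity Omega (A : set E) : \bar R :=
  ereal_inf [set capacity_open Omega U |
    U in [set U | [/\ open U, A `<=` U & U `<=` Omega]]].

Definition concentrated_on Omega (mu : {measure set E -> \bar R}) (A : set E) :=
  measurable A /\
  forall B, measurable B -> B `<=` Omega -> mu B = mu (B `&` A).

Definition tight_cvg Omega (f : nat -> E -> R)
    (mu : {measure set E -> \bar R}) :=
  forall phi, {within closure Omega, continuous phi} ->
    \int[leb]_(x in Omega) (f n x * phi x) @[n --> \oo] -->
    \int[mu]_(x in Omega) phi x.

(* Measurability for the Lebesgue sigma-algebra, i.e. the completion of the
   Borel one. *)
Definition lebesgue_measurable_fun Omega (F : E -> E) :=
  exists2 G : E -> E, measurable_fun Omega G &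
    {ae leb, forall x, Omega x -> F x = G x}.

Definition caratheodory_fun Omega (a : E -> E -> E) :=
  (forall xi, lebesgue_measurable_fun Omega (a ^~ xi)) /\
  {ae leb, forall x, Omega x -> continuous (a x)}.

Definition leray_lions Omega (a : E -> E -> E) (alpha beta : R) :=
  {ae leb, forall x, Omega x ->
    [/\ forall xi, alpha * enorm xi ^+ 2 <= dot (a x xi) xi,
        forall xi, enorm (a x xi) <= beta * enorm xi
      & forall xi eta, xi != eta ->
          0 < dot (a x xi - a x eta) (xi - eta)]}.

Definition flux (a : E -> E -> E) (gamma : R) u Du : E -> E :=
  fun x => ((1 + `|u x|) `^ gamma)^-1 *: a x (Du x).

Definition weak_solution Omega (a : E -> E -> E) (gamma : R) f u :=
  exists Du, [/\ H10 Omega u Du, Lp Omega +oo%E u &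
    forall phi Dphi, H10 Omega phi Dphi ->
      \int[leb]_(x in Omega) dot (flux a gamma u Du x) (Dphi x)
      + \int[leb]_(x in Omega) (u x * phi x)
      = \int[leb]_(x in Omega) (f x * phi x)].

Definition approximating_sequence Omega (a : E -> E -> E) (gamma : R)
    (mu : {measure set E -> \bar R}) (f u : nat -> E -> R) :=
  [/\ forall n, Lp Omega +oo%E (f n),
      forall n, {ae leb, forall x, Omega x -> 0 <= f n x},
      tight_cvg Omega f mu
    & forall n, weak_solution Omega a gamma (f n) (u n)].

(* Convergence almost everywhere up to subsequences: every subsequence has a
   further subsequence that converges almost everywhere. Convergence of the
   whole sequence is too strong for the solutions of approximating problems:
   bumps of fixed height on balls of radius r cost a datum of mass of order
   r^(N-2), so that, as r tends to 0, data whose mass tends to 0 can sweep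
   Omega infinitely often. *)
Definition ae_cvg_subseq Omega (u : nat -> E -> R) (v : E -> R) :=
  forall s : nat -> nat, {homo s : m n / (m < n)%N} ->
  exists2 t : nat -> nat, {homo t : m n / (m < n)%N} &
    {ae leb, forall x, Omega x -> u (s (t k)) x @[k --> \oo] --> v x}.

(* Solutions of the problem with datum mu: nonnegative distributional solutions
   in W^{1,1}_0(Omega) that are obtained as limits of the weak solutions of
   approximating problems. *)
Definition measure_solution Omega (a : E -> E -> E) (gamma : R)
    (mu : {measure set E -> \bar R}) u :=
  [/\ {ae leb, forall x, Omega x -> 0 <= u x},
      exists Du, W10 Omega 1%E u Du /\
        forall phi, Cc_infty Omega phi ->
          \int[leb]_(x in Omega) dot (flux a gamma u Du x) (grad phi x)
          + \int[leb]_(x in Omega) (u x * phi x)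
          = \int[mu]_(x in Omega) phi x
    & exists (f u_ : nat -> E -> R), approximating_sequence Omega a gamma mu f u_ /\
        {ae leb, forall x, Omega x -> u_ n x @[n --> \oo] --> u x}].

End sobolev.

(* Main.v *)
Require Import Defs.
From HB Require Import structures.
From mathcomp Require Import all_boot all_order all_algebra.
From mathcomp Require Import all_classical all_reals all_analysis.
From mathcomp Require Import measurable_realfun ess_sup_inf ring lra.
Set Implicit Arguments.
Unset Strict Implicit.
Unset Printing Implicit Defensive.
Import Order.TTheory GRing.Theory Num.Theory.
Import numFieldNormedType.Exports.
Local Open Scope classical_set_scope.
Local Open Scope ring_scope.

(** The measure mu is concentrated on a set of zero capacity, so there are cut-off
    functions zeta, with compact support in Omega and values in [0, 1], whose
    energy and whose integral are as small as desired while the integral of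
    1 - zeta for mu is small too (capacity_cutoff). Let u_n be the weak solution
    for the datum f_n, and let sigma_n = a(x, Du_n) / (1 + |u_n|)^gamma be its
    flux.

    Two kinds of test functions H(u_n)(1 - zeta), with H bounded by 1 and
    increasing, give all the estimates. If H'(s) is of the order of
    (1 + |s|)^(-gamma), which is possible for a bounded H since gamma > 1, then
    sigma_n . Du_n H'(u_n) controls |sigma_n|^2, because of the growth and the
    coercivity of a (flux_estimate). If H approximates the sign function, then the
    lower order term becomes |u_n|(1 - zeta) (mass_estimate). In both cases the
    right-hand side is at most the sum of the integrals of f_n (1 - zeta) and of
    |sigma_n . grad zeta|. With zeta = 0 this bounds u_n in mean and sigma_n in
    mean square. With this bound, for a cut-off function as above, the right-hand
    side is small for large n: the first integral converges to the integral of
    1 - zeta for mu, and the second one contains the small energy of zeta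
    (small_load).

    Hence u_n is small in mean where zeta is not close to 1, and zeta is close to
    1 only on a set of small measure: u_n tends to zero in measure
    (cvg_in_measure), and a subsequence of any subsequence tends to zero almost
    everywhere. In the same way sigma_n tends to zero in mean (flux_cvg0): in
    mean square it is small away from the set where zeta is close to 1, and
    bounded on that set. The weak formulation then shows that u_n and f_n have the
    same limit against test functions (cvg_test), and cutting off and smoothing
    extends this to bounded continuous functions on Omega (cvg_bounded_continuous).

    A solution with datum mu is an almost everywhere limit of such a sequence,
    hence zero; so its gradient and its flux vanish, and its equation says that
    the integral of any test function for mu is zero. Applied to the cut-off
    functions this gives mu(Omega) = 0 (no_measure_solution).

    The test functions have to be approximated by smooth functions with compact
    support. All nonlinear functions are therefore chosen smooth (soft_sgn,
    powtrunc), and the chain rule passes to the limit by dominated convergence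
    (H10_test_fun). Integration by parts and the Poincare inequality follow from
    the translation invariance of the Lebesgue measure (lebesgue_shift,
    Rint_partial0, poincare). *)

(** * Smooth functions *)

Section derive_line.
Context {R : realType} {V : normedModType R}.
Implicit Types (f : V -> R) (x v : V).

Lemma derive_line f x v : 'D_v f x = 'D_1 (fun h : R => f (h *: v + x)) 0.
Proof.
rewrite /derive; set g1 := fun h => h^-1 *: _; set g2 := fun h => h^-1 *: _.
suff -> : g1 = g2 by [].
by rewrite funeqE /g1 /g2 => h /=; rewrite addr0 scale0r add0r [_%:A]mulr1.
Qed.

Lemma is_derive_line f x v df :
  is_derive x v f df <-> is_derive (0 : R) 1 (fun h : R => f (h *: v + x)) df.
Proof.
split=> -[d1 d2]; split.
- exact: (derivable1P f x v).1.
- by rewrite -derive_line.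
- exact: (derivable1P f x v).2.
- by rewrite derive_line.
Qed.

End derive_line.

Section smooth_functions.
Context {R : realType} {N : nat}.
Local Notation E := 'rV[R]_N.
Implicit Types (f g : E -> R) (x v : E).

Lemma is_derive_comp_dir (H : R -> R) f x v df dH :
  is_derive x v f df -> is_derive (f x) 1 H dH ->
  is_derive x v (H \o f) (dH * df).
Proof.
move=> /is_derive_line df0 dH0; apply/is_derive_line.
apply: (@is_derive1_comp _ H (fun h : R => f (h *: v + x)) 0 dH df) => //.
by rewrite scale0r add0r.
Qed.

Lemma Ck_ext k f g : f =1 g -> Ck k f -> Ck k g.
Proof. by move/funext ->. Qed.

Lemma CkW k f : Ck k.+1 f -> Ck k f.
Proof.
elim: k f => [f []//|k IH f [cf df]].
by split=> // i; have [d c] := df i; split => //; exact: IH.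
Qed.

Lemma partial_cst i (c : R) : partial i (cst c : E -> R) = cst 0.
Proof. by apply/funext => x; rewrite /partial derive_cst. Qed.

Lemma Ck_cst k (c : R) : Ck k (cst c : E -> R).
Proof.
elim: k c => [c|k IH c]; first by move=> x; exact: cst_continuous.
split; first by move=> x; exact: cst_continuous.
move=> i; split=> [x|]; first exact: derivable_cst.
by rewrite partial_cst; exact: IH.
Qed.

Lemma is_derive_coord (j i : 'I_N) x :
  is_derive x (delta_mx 0 i) (fun y : E => y 0 j) ((j == i)%:R : R).
Proof.
apply/is_derive_line.
rewrite (_ : (fun h => _) =
  ((j == i)%:R : R) *: (@id R) + cst (x 0 j)); last first.
  by apply/funext => h; rewrite !fctE !mxE eqxx /= mulrC.
by apply: is_derive_eq; rewrite addr0; exact: mulr1.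
Qed.

Lemma Ck_coord k (j : 'I_N) : Ck k (fun y : E => y 0 j).
Proof.
have cc : continuous (fun y : E => y 0 j) by exact: coord_continuous.
case: k => [//|k]; split=> // i; split=> [x|].
  by have [] := is_derive_coord j i x.
rewrite (_ : partial i _ = cst ((j == i)%:R)); first exact: Ck_cst.
apply/funext => x; rewrite /partial.
by apply: derive_val; exact: is_derive_coord.
Qed.

Lemma continuous_add f g : continuous f -> continuous g -> continuous (f \+ g).
Proof. by move=> cf cg x; exact: (cvgD (cf x) (cg x)). Qed.

Lemma continuous_mul f g : continuous f -> continuous g -> continuous (f \* g).
Proof. by move=> cf cg x; exact: (cvgM (cf x) (cg x)). Qed.

Lemma CkD k f g : Ck k f -> Ck k g -> Ck k (f \+ g).
Proof.
elim: k f g => [f g cf cg|k IH f g [cf df] [cg dg]].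
  exact: continuous_add.
split; first exact: continuous_add.
move=> i.
have [d1 c1] := df i; have [d2 c2] := dg i; split=> [x|].
  exact: derivableD.
apply: Ck_ext (IH _ _ c1 c2) => x.
by rewrite /partial deriveD.
Qed.

Lemma CkM k f g : Ck k f -> Ck k g -> Ck k (f \* g).
Proof.
elim: k f g => [f g cf cg|k IH f g Cf Cg].
  exact: continuous_mul.
have [cf df] := Cf; have [cg dg] := Cg.
split; first exact: continuous_mul.
move=> i.
have [d1 c1] := df i; have [d2 c2] := dg i; split=> [x|].
  exact: derivableM.
apply: Ck_ext (CkD (IH _ _ (CkW Cf) c2) (IH _ _ (CkW Cg) c1)) => x.
by rewrite /partial deriveM.
Qed.

Lemma continuous_powR_comp f a : (forall x, 0 < f x) -> continuous f ->
  continuous (fun x => f x `^ a).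
Proof.
move=> f0 cf x.
have cp : {for f x, continuous (fun y : R => y `^ a)}.
  apply: differentiable_continuous; apply/derivable1_diffP.
  by have [] := is_derive1_powR a (f0 x).
exact: (cvg_comp _ _ (cf x) cp).
Qed.

Lemma Ck_powR k f a : (forall x, 0 < f x) -> Ck k f ->
  Ck k (fun x => f x `^ a).
Proof.
move=> f0; elim: k a => [a|k IH a Cf]; first exact: continuous_powR_comp.
have [cf df] := Cf; split; first exact: continuous_powR_comp.
move=> i; have [d c] := df i.
have D x : is_derive x (delta_mx 0 i) (fun x => f x `^ a)
    (a * f x `^ (a - 1) * partial i f x).
  exact: (is_derive_comp_dir (derivableP (d x)) (is_derive1_powR a (f0 x))).
split=> [x|]; first by have [] := D x.
apply: Ck_ext (CkM (CkM (Ck_cst k a) (IH (a - 1) (CkW Cf))) c) => x.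
by rewrite /partial (@derive_val _ _ _ _ _ _ _ (D x)).
Qed.

Lemma smooth_cst c : smooth (cst c : E -> R). Proof. by move=> k; exact: Ck_cst. Qed.

Lemma smooth_coord (j : 'I_N) : smooth (fun y : E => y 0 j).
Proof. by move=> k; exact: Ck_coord. Qed.

Lemma smoothD f g : smooth f -> smooth g -> smooth (f \+ g).
Proof. by move=> sf sg k; exact: CkD. Qed.

Lemma smoothM f g : smooth f -> smooth g -> smooth (f \* g).
Proof. by move=> sf sg k; exact: CkM. Qed.

Lemma smooth_powR f a : (forall x, 0 < f x) -> smooth f ->
  smooth (fun x => f x `^ a).
Proof. by move=> f0 sf k; exact: Ck_powR. Qed.

Lemma smoothN f : smooth f -> smooth (\- f).
Proof.
move=> sf; rewrite (_ : \- f = cst (-1) \* f); first exact/smoothM/sf/smooth_cst.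
by apply/funext => x /=; rewrite mulN1r.
Qed.

Lemma smoothB f g : smooth f -> smooth g -> smooth (f \- g).
Proof. by move=> sf sg; exact/smoothD/smoothN. Qed.

Lemma smoothV f : (forall x, 0 < f x) -> smooth f -> smooth (fun x => (f x)^-1).
Proof.
move=> f0 sf; rewrite (_ : (fun _ => _) = fun x => f x `^ (-1)).
  exact: smooth_powR.
by apply/funext => x; rewrite powR_inv1// ltW.
Qed.

Lemma smoothX f n : smooth f -> smooth (fun x => f x ^+ n).
Proof.
move=> sf; elim: n => [|n IH]; first exact: smooth_cst.
rewrite (_ : (fun _ => _) = f \* (fun x => f x ^+ n)); first exact: smoothM.
by apply/funext => x /=; rewrite exprS.
Qed.

Lemma smooth_sum (I : Type) (r : seq I) (F : I -> E -> R) :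
  (forall i, smooth (F i)) -> smooth (fun x => \sum_(i <- r) F i x).
Proof.
move=> sF; elim: r => [|i r IH].
  rewrite (_ : (fun _ => _) = cst 0); first exact: smooth_cst.
  by apply/funext => x; rewrite big_nil.
rewrite (_ : (fun _ => _) = F i \+ (fun x => \sum_(j <- r) F j x)).
  exact: smoothD.
by apply/funext => x; rewrite big_cons.
Qed.

Lemma smooth_partial i f : smooth f -> smooth (partial i f).
Proof. by move=> sf k; have [_ /(_ i)[]] := sf k.+1. Qed.

Lemma smooth_continuous f : smooth f -> continuous f.
Proof. by move=> sf; exact: (sf 0%N). Qed.

Lemma smooth_derivable i f x : smooth f -> derivable f x (delta_mx 0 i).
Proof. by move=> sf; have [_ /(_ i)[]] := sf 1%N. Qed.

Lemma partialM i f g x : smooth f -> smooth g ->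
  partial i (f \* g) x = f x * partial i g x + g x * partial i f x.
Proof. by move=> sf sg; rewrite /partial deriveM//; exact: smooth_derivable. Qed.

Lemma partialB i f g x : smooth f -> smooth g ->
  partial i (f \- g) x = partial i f x - partial i g x.
Proof. by move=> sf sg; rewrite /partial deriveB//; exact: smooth_derivable. Qed.

Lemma partial_comp i (H : R -> R) dH f x : smooth f ->
  is_derive (f x) 1 H dH -> partial i (H \o f) x = dH * partial i f x.
Proof.
move=> sf /(is_derive_comp_dir (derivableP (smooth_derivable sf))) dHf.
exact: derive_val.
Qed.

(** Every composition and product of test functions below stays a test function
    because it vanishes wherever one of its ingredients does. *)
Lemma Cc_infty_sub (Omega : set E) f g : Cc_infty Omega f -> smooth g ->
  (forall x, f x = 0 -> g x = 0) -> Cc_infty Omega g.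
Proof.
move=> [sf cf fO] sg fg.
have sub : closure [set x | g x != 0] `<=` closure [set x | f x != 0].
  by apply: closureS => x /=; apply: contra_neq; exact: fg.
split=> //; last exact: subset_trans sub fO.
exact: subclosed_compact (@closed_closure _ _) cf sub.
Qed.

Lemma Cc_infty0 (Omega : set E) : Cc_infty Omega (cst 0).
Proof.
have e : [set x : E | (cst 0 : E -> R) x != 0] = set0.
  by apply/seteqP; split=> x //=; rewrite eqxx.
by split; rewrite ?e ?closure0//; [exact: smooth_cst|exact: compact0].
Qed.

End smooth_functions.

(** * Lebesgue measure on row vectors *)

Section lebesgue_rV_translation.
Context {R : realType} {N : nat}.
Local Notation E := 'rV[R]_N.
Local Notation leb := (lebesgue_rV N : {measure set E -> \bar R}).

Definition obox (a b : 'I_N -> R) : set E :=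
  [set v | forall i, v 0 i \in `](a i), (b i)[].

Definition oboxes : set (set E) := [set obox ab.1 ab.2 | ab in setT].

Lemma lebesgue_obox a b :
  leb (obox a b) = (\prod_(i < N) lebesgue_measure (`](a i), (b i)[%classic : set R))%E.
Proof.
by rewrite -(@lebesgue_rV_box _ N (fun i => [set` `](a i), (b i)[] : set R)).
Qed.

Lemma measurable_obox a b : measurable (obox a b).
Proof.
apply: (@measurable_box _ N (fun i => [set` `](a i), (b i)[] : set R)) => i.
exact: measurable_itv.
Qed.

Lemma measurable_oboxesE : @measurable _ E = <<s oboxes >>.
Proof.
apply/seteqP; split; last first.
  apply: smallest_sub; first exact: sigma_algebra_measurable.
  by move=> _ [ab _ <-]; exact: measurable_obox.
apply: smallest_sub; first exact: smallest_sigma_algebra.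
move=> U oU; rewrite (open_rV_boxes oU) bigcup_mkcond.
apply: (@countable_bigcupT_measurable _ (g_sigma_algebraType oboxes)).
  exact: countableP.
move=> q; case: ifPn => // _; apply: sub_sigma_algebra.
by exists (fun i => ratr (q i).1, fun i => ratr (q i).2).
Qed.

Lemma oboxes_setI : setI_closed oboxes.
Proof.
move=> _ _ [ab _ <-] [cd _ <-].
exists (fun i => Num.max (ab.1 i) (cd.1 i), fun i => Num.min (ab.2 i) (cd.2 i)) => //.
apply/seteqP; split=> v /=.
  move=> h; split=> i; have := h i; rewrite !in_itv/= gt_max lt_min;
    by move=> /andP[/andP[c1 c2] /andP[c3 c4]]; apply/andP.
move=> [h1 h2] i; have := h1 i; have := h2 i.
by rewrite !in_itv/= gt_max lt_min => /andP[-> ->] /andP[-> ->].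
Qed.

Lemma lebesgue_obox_lty a b : (leb (obox a b) < +oo)%E.
Proof.
rewrite lebesgue_obox; set p := (X in (X < _)%E).
suff /andP[] : (0 <= p < +oo)%E by [].
apply: (@big_ind (\bar R) (fun x => (0 <= x < +oo)%E)) => //.
- by rewrite lee01 ltry.
- move=> x y /andP[x0 xy] /andP[y0 yy]; rewrite mule_ge0//=.
  by rewrite lte_mul_pinfty// ge0_fin_numE.
- move=> i _; rewrite measure_ge0/= lebesgue_measure_itv/=.
  by case: ifPn => // _; rewrite -EFinB ltry.
Qed.

Lemma lebesgue_obox_gt0 a b : (forall i, a i < b i) -> (0 < leb (obox a b))%E.
Proof.
move=> ab; rewrite lebesgue_obox; apply: (@big_ind (\bar R) (fun x => (0 < x)%E)) => //.
- by move=> x y x0 y0; exact: mule_gt0.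
- move=> i _; rewrite lebesgue_measure_itv/= lte_fin ab.
  by rewrite -EFinB lte_fin subr_gt0.
Qed.

Lemma coord_le_norm (v : E) i : `|v 0 i| <= `|v|.
Proof.
rewrite -[leRHS]/(mx_norm v) mx_normrE.
exact: (le_bigmax _ (fun ij => `|v ij.1 ij.2|) (0, i)).
Qed.

Lemma bounded_lebesgue_lty (D : set E) : bounded_set D -> measurable D ->
  (leb D < +oo)%E.
Proof.
move=> [M [_ bM]] mD.
pose K := `|M| + 1.
have DK : D `<=` obox (fun=> - (K + 1)) (fun=> K + 1).
  move=> v Dv i.
  have vK : `|v| <= K by apply: bM => //; rewrite /K ltr_pwDr// ler_norm.
  by rewrite in_itv/= -ltr_norml (le_lt_trans (coord_le_norm v i))// (le_lt_trans vK)// ltrDl.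
apply: le_lt_trans (lebesgue_obox_lty (fun=> - (K + 1)) (fun=> K + 1)).
by apply: le_measure => //; rewrite inE//; exact: measurable_obox.
Qed.

Lemma measurable_fun_open_continuous (D : set E) (f : E -> R) : open D ->
  {within D, continuous f} -> measurable_fun D f.
Proof.
move=> oD /continuousP cf mD.
apply: (measurability _ (measurable_realfun.RGenOpens.measurableE R)) => //.
move=> _ [_ [a [b ->] <-]]; apply: open_measurable_mx.
by rewrite open_setSI//; apply: cf; exact: interval_open.
Qed.

Lemma measurable_fun_continuous (f : E -> R) : continuous f ->
  measurable_fun setT f.
Proof.
move=> cf; apply: measurable_fun_open_continuous; first exact: openT.
exact: continuous_subspaceT.
Qed.

(** A nonempty open set contains a small open box, whose sides have positive
    length. *)
Lemma open_lebesgue_gt0 (D : set E) : open D -> D !=set0 -> (0 < leb D)%E.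
Proof.
move=> oD [x Dx].
have /nbhs_ballP[e /= e0 eD] : nbhs x D by exact: open_nbhs_nbhs.
have bD : obox (fun i => x 0 i - e) (fun i => x 0 i + e) `<=` D.
  move=> v bv; apply: eD; split => // i j; rewrite ord1.
  have := bv j; rewrite in_itv/= /ball/= => /andP[a b].
  by rewrite ltr_norml; apply/andP; split; lra.
apply: (@lt_le_trans _ _ (leb (obox (fun i => x 0 i - e) (fun i => x 0 i + e)))).
  by apply: lebesgue_obox_gt0 => i; lra.
by apply: le_measure => //; rewrite inE; [exact: measurable_obox|exact: open_measurable_mx].
Qed.

Definition shift_rV (w : E) : E -> E := fun v => v + w.

Lemma measurable_shift_rV w : measurable_fun setT (shift_rV w).
Proof.
apply: (measurability (@open E)) => // _ [U oU <-].
rewrite setTI; apply: open_measurable_mx; apply: open_comp => // x _.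
apply: (@cvgD R E E (nbhs x) _ id (cst w) x w); first exact: cvg_id.
exact: cvg_cst.
Qed.

Lemma shift_rV_obox w a b : shift_rV w @^-1` obox a b =
  obox (fun i => a i - w 0 i) (fun i => b i - w 0 i).
Proof.
apply/seteqP; split=> v /= h i; have := h i; rewrite /shift_rV !in_itv/= !mxE => /andP[h1 h2];
  by apply/andP; split; lra.
Qed.

(** Boxes form a generating family that is stable under intersection, so it is
    enough to compare the lengths of the sides of a box and of its translate. *)
Lemma lebesgue_shift w (D : set E) : measurable D ->
  leb (shift_rV w @^-1` D) = leb D.
Proof.
move=> mD.
pose mix := isMeasurableFun.Build _ _ _ _ _ (measurable_shift_rV w).
pose pack : {mfun E >-> E} := HB.pack (shift_rV w) mix.
pose box k := obox (fun=> - (k%:R : R)) (fun=> k%:R).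
have cover : \bigcup_k box k = setT.
  rewrite -subTset => v _.
  exists (Num.bound `|v|) => // i; rewrite in_itv/= -ltr_norml.
  exact: le_lt_trans (coord_le_norm v i) (archi_boundP (normr_ge0 v)).
rewrite -[LHS]/(pushforward leb pack D).
apply: (@measure_unique _ _ _ oboxes box measurable_oboxesE oboxes_setI _ cover _ leb) => //.
- by move=> i; exists (fun=> - (i%:R : R), fun=> i%:R).
- move=> _ [[a b] _ <-]; rewrite /= /pushforward/= shift_rV_obox !lebesgue_obox.
  apply: eq_bigr => i _; rewrite !lebesgue_measure_itv/= !lte_fin ltrD2r.
  by rewrite -!EFinB; case: ifPn => // _; congr EFin; ring.
- by move=> k; rewrite /= /pushforward/= shift_rV_obox; exact: lebesgue_obox_lty.
Qed.

Lemma integral_shift w (f : E -> R) : leb.-integrable setT (EFin \o f) ->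
  (\int[leb]_x (f (x + w))%:E = \int[leb]_x (f x)%:E)%E.
Proof.
move=> intf.
have mf : measurable_fun [set: E] (EFin \o f : E -> \bar R) by exact: measurable_int intf.
have shiftE (g : E -> \bar R) :
    (\int[pushforward leb (shift_rV w)]_x g x = \int[leb]_x g x)%E.
  apply: eq_measure_integral => [|? A mA _]; first exact: measurable_shift_rV.
  exact: lebesgue_shift.
have intfw : leb.-integrable (shift_rV w @^-1` setT) ((EFin \o f) \o shift_rV w).
  apply/integrableP; split; first exact: measurableT_comp (measurable_shift_rV w).
  have /integrableP[_] := intf; rewrite -shiftE.
  by rewrite (ge0_integral_pushforward (measurable_shift_rV w))//; exact: measurableT_comp.
have := integral_pushforward (measurable_shift_rV w) mf intfw measurableT.
by rewrite shiftE => ->.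
Qed.

End lebesgue_rV_translation.

(** * Real-valued integrals *)

Section real_integrals.
Context d (T : measurableType d) (R : realType).
Variables (mu : {measure set T -> \bar R}) (D : set T).
Hypothesis mD : measurable D.
Implicit Types f g : T -> R.

Definition intg f := mu.-integrable D (EFin \o f).

Lemma intg_measurable f : intg f -> measurable_fun D f.
Proof. by move=> /measurable_int /measurable_EFinP. Qed.

Lemma intg_le g f : measurable_fun D f -> (forall x, D x -> `|f x| <= g x) ->
  intg g -> intg f.
Proof.
move=> mf fg ig; apply: (le_integrable mD _ _ ig); first exact/measurable_EFinP.
move=> x Dx /=; rewrite lee_fin (le_trans (fg _ Dx))// ler_norm//.
Qed.

Lemma eq_intg f g : (forall x, D x -> f x = g x) -> intg f -> intg g.
Proof.
move=> fg; apply: (eq_integrable mD) => x /set_mem Dx /=.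
by rewrite fg.
Qed.

Lemma intgD f g : intg f -> intg g -> intg (f \+ g).
Proof. by move=> fi gi; have := integrableD mD fi gi; exact: eq_integrable. Qed.

Lemma intgZ c f : intg f -> intg (fun x => c * f x).
Proof. by move=> fi; have := integrableZl mD c fi; exact: eq_integrable. Qed.

Lemma intgN f : intg f -> intg (\- f).
Proof.
by move=> /(intgZ (-1)); apply: eq_intg => x _; rewrite mulN1r.
Qed.

Lemma intgB f g : intg f -> intg g -> intg (f \- g).
Proof. by move=> fi gi; exact/intgD/intgN. Qed.

Lemma intg0 : intg (cst 0).
Proof. exact: integrable0. Qed.

Lemma intg_sum (I : Type) (r : seq I) (F : I -> T -> R) :
  (forall i, intg (F i)) -> intg (fun x => \sum_(i <- r) F i x).
Proof.
move=> iF; elim: r => [|i r IH].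
  by apply: eq_intg intg0 => x _; rewrite big_nil.
by apply: eq_intg (intgD (iF i) IH) => x _; rewrite big_cons.
Qed.

Lemma intg_norm f : intg f -> intg (fun x => `|f x|).
Proof. exact: integrable_norm. Qed.

Lemma intgM_bounded (C : R) f g : intg f -> measurable_fun D g ->
  (forall x, D x -> `|g x| <= C) -> intg (fun x => f x * g x).
Proof.
move=> fi mg gC; apply: (@intg_le (fun x => C * `|f x|)).
- by apply: measurable_funM => //; exact: intg_measurable.
- by move=> x Dx; rewrite normrM mulrC ler_wpM2r// gC.
- exact/intgZ/intg_norm.
Qed.

Lemma intg_bounded (C : R) f : (mu D < +oo)%E -> measurable_fun D f ->
  (forall x, D x -> `|f x| <= C) -> intg f.
Proof.
move=> Doo mf fC; apply: measurable_bounded_integrable => //.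
exists C; split; first exact: num_real.
by move=> M CM x Dx; apply: le_trans (fC x Dx) (ltW CM).
Qed.

Lemma RintN f : intg f -> Rintegral mu D (fun x => - f x) = - Rintegral mu D f.
Proof.
move=> fi; rewrite -[RHS]mulN1r -RintegralZl//.
by apply: eq_Rintegral => x _; rewrite mulN1r.
Qed.

Lemma le_norm_Rint g f : intg f -> intg g -> (forall x, D x -> `|f x| <= g x) ->
  `|Rintegral mu D f| <= Rintegral mu D g.
Proof.
move=> fi gi fg; apply: le_trans (le_normr_Rintegral mD fi) _.
by apply: le_Rintegral => //; exact: intg_norm.
Qed.

Import HBNNSimple.

(** On the measurable null set where two functions differ, a simple function
    below one of them may be set to zero; so almost everywhere equal functions
    have the same integral even when they are not measurable. *)
Lemma ae_le_nonmeasurable_integral (f g : T -> \bar R) :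
  (forall x, 0 <= f x)%E -> (forall x, 0 <= g x)%E ->
  {ae mu, forall x, f x = g x} -> (\int[mu]_x f x <= \int[mu]_x g x)%E.
Proof.
move=> f0 g0 [Z [mZ Z0 fgZ]].
rewrite ge0_integralTE//; apply: ge_ereal_sup => _ [h /= hf <-].
pose h' : {nnsfun T >-> R} := proj_nnsfun h (measurableC mZ).
have -> : sintegral mu h = sintegral mu h'.
  rewrite -!integralT_nnsfun; apply: ge0_ae_eq_integral => //.
  - exact/measurable_EFinP.
  - exact/measurable_EFinP.
  - by move=> x _; rewrite lee_fin.
  - by move=> x _; rewrite lee_fin.
  - exists Z; split=> // x /=; apply: contra_notP => Zx _.
    by rewrite mindicE mem_set// mulr1.
rewrite ge0_integralTE//; apply: ereal_sup_ubound; exists h' => //= x.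
rewrite mindicE; case: (pselect (Z x)) => Zx.
  by rewrite memNset/= ?mulr0// => /(_ Zx).
rewrite mem_set// mulr1; suff <- : f x = g x by exact: hf.
by apply: contra_notP Zx => fg; exact: fgZ.
Qed.

Lemma ae_eq_nonmeasurable_Rintegral f g :
  {ae mu, forall x, D x -> f x = g x} -> Rintegral mu D f = Rintegral mu D g.
Proof.
move=> fg; rewrite /Rintegral; congr fine.
rewrite integral_mkcond [RHS]integral_mkcond.
set F := (_ \_ D); set G := (_ \_ D).
have FG : {ae mu, forall x, F x = G x}.
  apply: filterS fg => x fg; rewrite /F /G /patch.
  by case: ifPn => // /set_mem Dx; rewrite fg.
have eqn (F1 G1 : T -> \bar R) : (forall x, 0 <= F1 x)%E -> (forall x, 0 <= G1 x)%E ->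
    {ae mu, forall x, F1 x = G1 x} -> (\int[mu]_x F1 x = \int[mu]_x G1 x)%E.
  move=> F0 G0 h; apply/eqP; rewrite eq_le !ae_le_nonmeasurable_integral//.
  by apply: filterS h => x ->.
rewrite integralE [RHS]integralE; congr (_ - _)%E; apply: eqn => //;
  by apply: filterS FG => x; rewrite !(funeposE, funenegE) => ->.
Qed.

Lemma ae_eq_Rintegral_le f g : intg f -> intg g ->
  {ae mu, forall x, D x -> f x <= g x} -> Rintegral mu D f <= Rintegral mu D g.
Proof.
move=> fi gi fg.
pose f' x := Num.min (f x) (g x).
have fi' : intg f'.
  apply: (@intg_le (fun x => `|f x| + `|g x|)).
  - by apply: measurable_minr; exact: intg_measurable.
  - by move=> x _; rewrite /f' /Num.min; case: ifP => _; rewrite ?lerDl ?lerDr.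
  - by apply: intgD; exact: intg_norm.
have -> : Rintegral mu D f = Rintegral mu D f'.
  apply: ae_eq_nonmeasurable_Rintegral; apply: filterS fg => x fg Dx.
  by rewrite /f' min_l// fg.
by apply: le_Rintegral => // x Dx; rewrite /f' ge_min lexx orbT.
Qed.

Lemma ae_intg_le g f : measurable_fun D f -> intg g ->
  {ae mu, forall x, D x -> `|f x| <= g x} -> intg f.
Proof.
move=> mf gi fg; apply/integrableP; split; first exact/measurable_EFinP.
have /integrableP[mg] := gi; apply: le_lt_trans.
apply: ae_ge0_le_integral => //.
- by apply: measurableT_comp => //; exact/measurable_EFinP.
- exact: measurableT_comp.
- by apply: filterS fg => x fg Dx; rewrite lee_fin (le_trans (fg Dx))// ler_norm.
Qed.

Lemma Rint_le0_ae f : intg f -> (forall x, D x -> 0 <= f x) ->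
  Rintegral mu D f <= 0 -> {ae mu, forall x, D x -> f x = 0}.
Proof.
move=> fi f0 If.
have If0 : (\int[mu]_(x in D) `|(EFin \o f) x| = 0)%E.
  rewrite (eq_integral (EFin \o f)) => [|x /set_mem Dx]; last first.
    by rewrite gee0_abs//= lee_fin f0.
  rewrite -[LHS]fineK; last exact: (integrable_fin_num mD fi).
  by congr EFin; apply/le_anti; rewrite If/=; apply: Rintegral_ge0.
have /(ae_eq_integral_abs mu mD (measurable_int mu fi)) := If0.
by apply: filterS => x fx Dx; have [] := fx Dx.
Qed.

End real_integrals.

(** * Integration by parts and the Poincare inequality *)

Section integration_by_parts.
Context {R : realType} {N : nat}.
Local Notation E := 'rV[R]_N.
Local Notation leb := (lebesgue_rV N : {measure set E -> \bar R}).
Implicit Types (Omega : set E) (f g : E -> R) (i : 'I_N).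

Lemma closed_measurable_mx (K : set E) : closed K -> measurable K.
Proof.
move=> cK; rewrite -(setCK K); apply: measurableC.
by apply: open_measurable_mx; exact: closed_openC.
Qed.

Lemma compact_continuous_bounded (K : set E) f : compact K ->
  {within K, continuous f} -> exists C, forall x, K x -> `|f x| <= C.
Proof.
move=> cK cf.
have [M [_ bM]] := @compact_bounded _ R^o _ (continuous_compact cf cK).
by exists (M + 1) => x Kx; apply: bM; [rewrite ltrDl|exists x].
Qed.

Lemma bounded_set_compact (D : set E) : bounded_set D ->
  exists2 K : set E, compact K & D `<=` K.
Proof.
move=> [M [_ bM]]; exists [set x | `|x| <= M + 1].
  apply: bounded_closed_compact.
    exists (M + 1); split; first exact: num_real.
    by move=> y My x /= /le_trans; apply; exact: ltW.
  apply: (preimage_closed (f := fun x : E => `|x|) (D := [set y | y <= M + 1])).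
    by move=> x _; exact: norm_continuous.
  exact: closed_le.
by move=> x Dx /=; apply: bM => //; rewrite ltrDl.
Qed.

Lemma continuous_bounded_on (D : set E) f : bounded_set D -> continuous f ->
  exists C, forall x, D x -> `|f x| <= C.
Proof.
move=> /bounded_set_compact[K cK DK] cf.
have [|C fC] := @compact_continuous_bounded K f cK.
  exact: continuous_subspaceT.
by exists C => x /DK; exact: fC.
Qed.

Lemma Cc_infty_bounded Omega f : Cc_infty Omega f -> exists C, forall x, `|f x| <= C.
Proof.
move=> [sf cS _].
have [|C fC] := @compact_continuous_bounded _ f cS.
  by apply: continuous_subspaceT; exact: smooth_continuous.
exists (Num.max C 0) => x; have [fx0|fx0] := eqVneq (f x) 0.
  by rewrite fx0 normr0 le_max lexx orbT.
by rewrite le_max fC//; exact: subset_closure.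
Qed.

Lemma partial_notin_supp i f x : ~ closure [set x | f x != 0] x ->
  partial i f x = 0.
Proof.
move=> Sx.
have oS : open (~` closure [set x | f x != 0]).
  by apply: closed_openC; exact: closed_closure.
rewrite /partial -[RHS](derive_cst (V := E) (0 : R) x (delta_mx 0 i)).
apply: near_eq_derive; near=> y.
have : (~` closure [set x | f x != 0]) y.
  by near: y; exact: open_nbhs_nbhs.
move=> yS; apply/eqP; apply: contra_notT yS => fy0.
exact: subset_closure.
Unshelve. all: by end_near. Qed.

Lemma Cc_infty_partial Omega i f : Cc_infty Omega f ->
  Cc_infty Omega (partial i f).
Proof.
move=> [sf cS SO].
have sub : closure [set x | partial i f x != 0] `<=` closure [set x | f x != 0].
  rewrite closureE; apply: smallest_sub; first exact: closed_closure.
  move=> x /= px; apply: contrapT => /(partial_notin_supp i) px0.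
  by rewrite px0 eqxx in px.
split; first exact: smooth_partial.
- exact: subclosed_compact (@closed_closure _ _) cS sub.
- exact: subset_trans sub SO.
Qed.

Lemma compact_lebesgue_lty (K : set E) : compact K -> (leb K < +oo)%E.
Proof.
move=> cK; apply: bounded_lebesgue_lty; first exact: compact_bounded.
apply: closed_measurable_mx; apply: compact_closed cK; exact: norm_hausdorff.
Qed.

Lemma Cc_intgT Omega f : Cc_infty Omega f -> intg leb setT f.
Proof.
move=> Cf; have [C fC] := Cc_infty_bounded Cf; have [sf cS _] := Cf.
set S := closure _ in cS.
have mS : measurable S by apply: closed_measurable_mx; exact: closed_closure.
rewrite (_ : f = f \_ S); last first.
  apply/funext => x; rewrite /patch; case: ifPn => // xS.
  apply: contrapT => /eqP fx0; move/negP: xS; apply; apply/mem_set.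
  exact: subset_closure.
rewrite /intg -restrict_EFin; apply/integrable_restrict => //; rewrite setTI.
apply: (intg_bounded mS (C := C)); first exact: compact_lebesgue_lty.
  apply: measurable_funS (measurable_fun_continuous _) => //.
  exact: smooth_continuous.
by move=> x _; exact: fC.
Qed.

Lemma Cc_intg Omega (D : set E) f : measurable D -> Cc_infty Omega f -> intg leb D f.
Proof. by move=> mD /Cc_intgT; apply: integrableS. Qed.

Lemma Rint_Cc Omega f : Cc_infty Omega f ->
  Rintegral leb Omega f = Rintegral leb setT f.
Proof.
move=> [sf _ SO]; rewrite Rintegral_mkcond; apply: eq_Rintegral => x _.
rewrite /patch; case: ifPn => // xO.
apply/eqP; rewrite eq_sym; apply: contra_notT (negP xO) => fx0.
by apply/mem_set/SO; exact: subset_closure.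
Qed.

(** Integrals are invariant under translation, so the difference quotients of f
    in the direction i all have integral zero; they are dominated, by the mean
    value theorem. *)
Lemma Rint_partial0 Omega i f : Cc_infty Omega f ->
  Rintegral leb setT (partial i f) = 0.
Proof.
move=> Cf; have [sf cS _] := Cf.
have [C pC] := Cc_infty_bounded (Cc_infty_partial i Cf).
pose w : E := delta_mx 0 i.
pose h (n : nat) : R := n.+1%:R^-1.
have h0 n : 0 < h n by rewrite invr_gt0 ltr0n.
have h1 n : h n <= 1 by rewrite invf_le1 ?ltr0n// ler1n.
pose q n x := (h n)^-1 * (f (x + h n *: w) - f x).
have [M [_ SM]] := compact_bounded cS.
have {}SM x : M + 1 < `|x| -> f x = 0.
  move=> Mx; apply: contrapT => /eqP fx0.
  have : `|x| <= M + 1 by apply: SM; [rewrite ltrDl|exact: subset_closure].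
  by rewrite leNgt Mx.
have w1 : `|w| <= 1.
  have -> : `|w| = mx_norm (delta_mx 0 i : 'M[R]_(1, N)) by [].
  rewrite mx_normrE; apply: bigmax_le => // ij _.
  by rewrite mxE; case: (_ && _); rewrite ?normr1 ?normr0.
pose B : set E := [set x | `|x| <= M + 2].
have cB : compact B.
  apply: bounded_closed_compact.
    exists (M + 2); split; first exact: num_real.
    by move=> y My x /= /le_trans; apply; exact: ltW.
  apply: (preimage_closed (f := fun x : E => `|x|) (D := [set y | y <= M + 2])).
    by move=> x _; exact: norm_continuous.
  exact: closed_le.
have mB : measurable B.
  by apply: closed_measurable_mx; apply: compact_closed cB; exact: norm_hausdorff.
have D x (t : R) : is_derive t 1 (fun t => f (t *: w + x)) (partial i f (t *: w + x)).
  apply/is_derive_line.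
  have /is_derive_line := derivableP (smooth_derivable (i := i) (x := t *: w + x) sf).
  congr is_derive; apply/funext => u.
  by rewrite [_%:A]mulr1 scalerDl addrA.
have qC n x : `|q n x| <= C.
  have ct : {within `[0, h n], continuous (fun t => f (t *: w + x))}.
    by apply: derivable_within_continuous => t _; have [] := D x t.
  have [c _] := @MVT _ _ (fun t => partial i f (t *: w + x)) _ _ (h0 n) (fun t _ => D x t) ct.
  rewrite scale0r add0r subr0 (addrC _ x) => e.
  by rewrite /q e mulrCA mulVf ?mulr1 ?gt_eqF.
have fi := Cc_intgT Cf.
have fwi n : intg leb setT (fun x => f (x + h n *: w)).
  have mfw : measurable_fun [set: E] (fun x => f (x + h n *: w)).
    apply: (measurableT_comp _ (measurable_shift_rV (h n *: w))).
    by apply: measurable_fun_continuous; exact: smooth_continuous.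
  apply/integrableP; split; first exact/measurable_EFinP.
  have /integrableP[_] := intg_norm fi.
  under eq_integral do rewrite /= normr_id.
  by rewrite -(integral_shift (h n *: w) (intg_norm fi)).
have q0 n : (\int[leb]_x (q n x)%:E = 0)%E.
  rewrite /q; under eq_integral do rewrite EFinM.
  rewrite integralZl//; last exact: (intgB measurableT (fwi n) fi).
  under eq_integral do rewrite EFinB.
  rewrite (integralB_EFin measurableT (fwi n) fi).
  rewrite (integral_shift (h n *: w) fi) subee ?mule0//.
  by apply: integrable_fin_num.
have qB n x : `|q n x| <= (fun x => C * \1_B x) x.
  rewrite /= indicE; case: (boolP (x \in B)) => [_|/negP xB].
    by rewrite mulr1.
  have xM : M + 2 < `|x|.
    by rewrite ltNge; apply/negP => xM; apply: xB; apply/mem_set.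
  rewrite mulr0 /q SM ?SM ?subr0 ?mulr0 ?normr0//; first lra.
  have : `|x| <= `|x + h n *: w| + 1.
    apply: le_trans (_ : `|x + h n *: w| + `|h n *: w| <= _).
      by rewrite -{1}(addrK (h n *: w) x) -(normrN (h n *: w)) ler_normD.
    rewrite lerD2l normrZ -[leRHS]mulr1 ler_pM//.
    by rewrite ger0_norm// ltW.
  lra.
have hcvg x : q n x @[n --> \oo] --> partial i f x.
  have d : derivable f x w := smooth_derivable sf.
  have /cvgr_dnbhsP/(_ h) := d.
  rewrite -/(derive f x w) => H.
  have {}H := H (conj (fun n => lt0r_neq0 (h0 n)) cvg_harmonic).
  apply: cvg_trans H; apply: near_eq_cvg; apply: nearW => n.
  by rewrite /q /= [h n *: w + x]addrC.
have mp : measurable_fun [set: E] (partial i f).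
  by apply: measurable_fun_continuous; apply: smooth_continuous; exact: smooth_partial.
have [] := @dominated_convergence _ _ _ leb setT measurableT
  (fun n x => (q n x)%:E) (EFin \o partial i f) (EFin \o (fun x => C * \1_B x)).
- move=> n; apply/measurable_EFinP; apply: measurable_funM => //.
  apply: measurable_funB; first exact: intg_measurable (fwi n).
  exact: intg_measurable fi.
- exact/measurable_EFinP.
- by apply: aeW => x _; apply: cvg_EFin; [exact: nearW|exact: hcvg].
- apply: (intgZ measurableT); rewrite /intg.
  rewrite (_ : EFin \o \1_B = (cst 1%E) \_ B); last first.
    by apply/funext => y /=; rewrite /patch indicE; case: ifPn.
  apply/integrable_restrict => //; rewrite setTI.
  apply: (intg_bounded (f := cst 1) mB (C := 1)) => //.
  + exact: compact_lebesgue_lty.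
  + by move=> x _; rewrite normr1.
- by apply: aeW => x n _ /=; rewrite lee_fin; exact: qB.
move=> _ _ H; rewrite /Rintegral.
suff -> : (\int[leb]_x (partial i f x)%:E = 0)%E by [].
apply/esym/(@cvg_unique _ _ _ _ _ _ _ H); first exact: ereal_hausdorff.
rewrite (_ : (fun _ => _) = cst 0%E); first exact: cvg_cst.
by apply/funext => n; exact: q0.
Qed.

Lemma Cc_inftyM Omega f g : Cc_infty Omega f -> smooth g -> Cc_infty Omega (f \* g).
Proof.
move=> Cf sg; have [sf _ _] := Cf; apply: Cc_infty_sub Cf _ _; first exact: smoothM.
by move=> x /= ->; rewrite mul0r.
Qed.

Lemma Rint_by_parts Omega i f g : measurable Omega ->
  Cc_infty Omega f -> smooth g ->
  Rintegral leb Omega (fun x => f x * partial i g x) =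
  - Rintegral leb Omega (fun x => partial i f x * g x).
Proof.
move=> mO Cf sg; have [sf _ _] := Cf; have C := Cc_inftyM Cf sg.
have C1 := Cc_inftyM Cf (smooth_partial i sg).
have C2 := Cc_inftyM (Cc_infty_partial i Cf) sg.
apply/eqP; rewrite -addr_eq0 -RintegralD//; [|exact: Cc_intg C1|exact: Cc_intg C2].
rewrite -[X in _ == X](Rint_partial0 i C) -(Rint_Cc (Cc_infty_partial i C)).
apply/eqP/eq_Rintegral => x _.
by rewrite -[RHS]/(partial i (f \* g) x) partialM// [g x * _]mulrC.
Qed.

(** The integral of the i-th derivative of x_i f^2 vanishes, so that the integral
    of f^2 is minus that of 2 x_i f (partial i f), in which Young's inequality
    leaves half of f^2 on the other side. *)
Lemma poincare Omega i (M : R) f : measurable Omega ->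
  (forall x, Omega x -> `|x 0 i| <= M) -> Cc_infty Omega f ->
  Rintegral leb Omega (fun x => f x ^+ 2) <=
  4 * M ^+ 2 * Rintegral leb Omega (fun x => partial i f x ^+ 2).
Proof.
move=> mO OM Cf; have [sf _ _] := Cf.
have Cp := Cc_infty_partial i Cf; have [sp _ _] := Cp.
have C2 : Cc_infty Omega (fun x => f x ^+ 2).
  by apply: Cc_infty_sub Cf _ _; [exact: smoothX|move=> x ->; rewrite expr0n].
have Cp2 : Cc_infty Omega (fun x => partial i f x ^+ 2).
  by apply: Cc_infty_sub Cp _ _; [exact: smoothX|move=> x ->; rewrite expr0n].
have sx := smooth_coord (R := R) i.
have Cfx := Cc_inftyM C2 sx.
have : Rintegral leb Omega (fun x => 2^-1 * f x ^+ 2) <=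
       Rintegral leb Omega (fun x => 2 * M ^+ 2 * partial i f x ^+ 2).
  rewrite -subr_ge0 -RintegralB//; last 2 first.
  - by apply: (intgZ mO); exact: Cc_intg Cp2.
  - by apply: (intgZ mO); exact: Cc_intg C2.
  have i0 := Rint_partial0 i Cfx.
  have Cq := Cc_infty_partial i Cfx.
  rewrite -oppr0 -i0 -(Rint_Cc Cq) -RintN//; last exact: Cc_intg Cq.
  apply: le_Rintegral => //.
  - by apply: (intgN mO); exact: Cc_intg Cq.
  - apply: intgB => //; apply: (intgZ mO); [exact: Cc_intg Cp2|exact: Cc_intg C2].
  - move=> x Ox.
    rewrite -[leLHS]/(- partial i ((fun x => f x ^+ 2) \* (fun y => y 0 i)) x).
    rewrite partialM//; last exact: smoothX.
    have -> : partial i (fun y : E => y 0 i) x = 1.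
      by rewrite /partial; have [_ ->] := is_derive_coord i i x; rewrite eqxx.
    have -> : partial i (fun x => f x ^+ 2) x = 2 * f x * partial i f x.
      have -> : (fun x => f x ^+ 2) = f \* f by apply/funext => y /=; rewrite expr2.
      by rewrite partialM//; ring.
    have : x 0 i ^+ 2 <= M ^+ 2 by rewrite -(real_normK (num_real (x 0 i))) ler_pXn2r ?nnegrE ?(le_trans _ (OM x Ox))// OM.
    set y := x 0 i; set u := f x; set p := partial i f x => yM.
    have := mulr_ge0 (sqr_ge0 p) (_ : 0 <= M ^+ 2 - y ^+ 2).
    rewrite subr_ge0 => /(_ yM).
    have := sqr_ge0 (u + 2 * (y * p)).
    nra.
rewrite !RintegralZl//; [|exact: Cc_intg C2|exact: Cc_intg Cp2].
move=> H; rewrite -(ler_pM2l (_ : 0 < 2^-1)) ?invr_gt0//.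
by rewrite (le_trans H)//; set I := Rintegral _ _ _; lra.
Qed.

End integration_by_parts.

(** * Square-integrable functions *)

Section square_integrable.
Context d (T : measurableType d) (R : realType).
Variables (mu : {measure set T -> \bar R}) (D : set T).
Hypothesis mD : measurable D.
Implicit Types f g : T -> R.

Local Notation Rint := (Rintegral mu D).
Local Notation intg := (intg mu D).

Definition sqintg f := measurable_fun D f /\ intg (fun x => f x ^+ 2).

Lemma sqintgM f g : sqintg f -> sqintg g -> intg (fun x => f x * g x).
Proof.
move=> [mf f2] [mg g2]; apply: (intg_le mD (g := fun x => f x ^+ 2 + g x ^+ 2)).
- exact: measurable_funM.
- move=> x _; rewrite ler_norml; apply/andP; split; last first.
    by have := sqr_ge0 (f x - g x); nra.
  by have := sqr_ge0 (f x + g x); nra.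
- exact: intgD.
Qed.

Lemma sqintgD f g : sqintg f -> sqintg g -> sqintg (f \+ g).
Proof.
move=> f2 g2; split; first by apply: measurable_funD; [case: f2|case: g2].
have fg := sqintgM f2 g2; case: f2 => _ f2; case: g2 => _ g2.
apply: (eq_intg mD _ (intgD mD (intgD mD f2 g2) (intgZ mD 2 fg))) => x _ /=.
by ring.
Qed.

Lemma sqintgZ c f : sqintg f -> sqintg (fun x => c * f x).
Proof.
move=> [mf f2]; split; first exact: measurable_funM.
by apply: (eq_intg mD _ (intgZ mD (c ^+ 2) f2)) => x _; rewrite exprMn.
Qed.

Lemma sqintgB f g : sqintg f -> sqintg g -> sqintg (f \- g).
Proof.
move=> f2 g2; have := sqintgD f2 (sqintgZ (-1) g2).
by congr sqintg; apply/funext => x /=; rewrite mulN1r.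
Qed.

Lemma sqintgM_bounded (C : R) f g : sqintg f -> measurable_fun D g ->
  (forall x, D x -> `|g x| <= C) -> sqintg (fun x => f x * g x).
Proof.
move=> [mf f2] mg gC; split; first exact: measurable_funM.
apply: (eq_intg mD (f := fun x => f x ^+ 2 * g x ^+ 2)).
  by move=> x _; rewrite exprMn.
apply: (intgM_bounded mD (C := C ^+ 2)) => //; first exact: measurable_funX.
move=> x Dx; rewrite normrX ler_pXn2r ?nnegrE ?gC//.
by rewrite (le_trans _ (gC x Dx)).
Qed.

Lemma cauchy_schwarz f g : sqintg f -> sqintg g ->
  Rint (fun x => f x * g x) ^+ 2 <= Rint (fun x => f x ^+ 2) * Rint (fun x => g x ^+ 2).
Proof.
move=> f2 g2; have fg := sqintgM f2 g2.
set a := Rint (fun x => f x ^+ 2); set b := Rint (fun x => g x ^+ 2).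
set c := Rint _.
have H t : 0 <= t ^+ 2 * a + 2 * t * c + b.
  have -> : t ^+ 2 * a + 2 * t * c + b = Rint (fun x => (t * f x + g x) ^+ 2).
    rewrite /a /b /c -!RintegralZl//; [|by case: f2].
    rewrite -RintegralD//; [|by apply: (intgZ mD); case: f2|exact: (intgZ mD)].
    rewrite -RintegralD//; [|by apply: (intgD mD); apply: (intgZ mD) => //; case: f2|by case: g2].
    by apply: eq_Rintegral => x _; ring.
  by apply: Rintegral_ge0 => x _; exact: sqr_ge0.
have b0 : 0 <= b by apply: Rintegral_ge0 => x _; exact: sqr_ge0.
have a0 : 0 <= a by apply: Rintegral_ge0 => x _; exact: sqr_ge0.
have [a00|an0] := eqVneq a 0.
  rewrite a00 mul0r; have [->|c0] := eqVneq c 0; first by rewrite expr0n.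
  have := H (- (b + 1) / (2 * c)); rewrite a00 mulr0 add0r.
  have -> : 2 * (- (b + 1) / (2 * c)) * c = - (b + 1) by field.
  by move=> ?; exfalso; lra.
have := H (- c / a).
have -> : (- c / a) ^+ 2 * a + 2 * (- c / a) * c + b = (a * b - c ^+ 2) / a by field.
by rewrite pmulr_lge0 ?invr_gt0 ?lt0r ?an0// subr_ge0.
Qed.

Lemma dominated_Rint (f_ : nat -> T -> R) f g :
  (forall k, measurable_fun D (f_ k)) -> measurable_fun D f ->
  {ae mu, forall x, D x -> f_ k x @[k --> \oo] --> f x} -> intg g ->
  (forall k x, D x -> `|f_ k x| <= g x) ->
  Rint (f_ k) @[k --> \oo] --> Rint f.
Proof.
move=> mf_ mf cf gi fg.
have [] := @dominated_convergence _ _ _ mu D mD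
  (fun k x => (f_ k x)%:E) (EFin \o f) (EFin \o g).
- by move=> k; exact/measurable_EFinP.
- exact/measurable_EFinP.
- apply: filterS cf => x cf Dx.
  by apply: cvg_EFin; [exact: nearW|exact: cf].
- exact: gi.
- by apply: aeW => x k Dx; rewrite lee_fin fg.
move=> fi _ H; rewrite /Rintegral; apply: fine_cvg.
by rewrite fineK//; exact: (integrable_fin_num mD fi).
Qed.

Section finite_measure.
Hypothesis Dfin : (mu D < +oo)%E.

Lemma sqintg_bounded (C : R) f : measurable_fun D f ->
  (forall x, D x -> `|f x| <= C) -> sqintg f.
Proof.
move=> mf fC; split => //; apply: (intg_bounded mD (C := C ^+ 2)) => //.
  exact: measurable_funX.
move=> x Dx; rewrite normrX ler_pXn2r ?nnegrE ?fC//.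
by rewrite (le_trans _ (fC x Dx)).
Qed.

Lemma intg_cst c : intg (cst c).
Proof. by apply: (intg_bounded mD (C := `|c|)). Qed.

Lemma sqintg_intg f : sqintg f -> intg f.
Proof.
move=> f2; have c2 : sqintg (cst 1) by apply: (@sqintg_bounded 1) => // x _; rewrite normr1.
by apply: (eq_intg mD _ (sqintgM f2 c2)) => x _; rewrite mulr1.
Qed.

(** Along a subsequence with summable integrals the sum of the functions is
    integrable, so it is finite almost everywhere, and its terms tend to zero. *)
Lemma cvg_mean_subseq (e : nat -> T -> R) : (forall k, intg (e k)) ->
  (forall k x, D x -> 0 <= e k x) -> Rint (e k) @[k --> \oo] --> (0 : R) ->
  exists2 t : nat -> nat, {homo t : m n / (m < n)%N} &
    {ae mu, forall x, D x -> e (t k) x @[k --> \oo] --> (0 : R)}.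
Proof.
move=> ei e0 ecvg.
have /choice[n0 n0P] (k : nat) : exists n0 : nat, forall n, (n0 <= n)%N ->
    Rint (e n) <= (1 / (2 ^ k.+1)%:R : R).
  have k0 : 0 < 1 / (2 ^ k.+1)%:R :> R by rewrite divr_gt0// ltr0n expn_gt0.
  have /cvgrPdist_le/(_ _ k0)[m _ mP] := ecvg.
  exists m => n mn; have := mP n mn; rewrite sub0r normrN; apply: le_trans.
  exact: ler_norm.
pose t := fix t k := if k is k'.+1 then maxn (n0 k) (t k').+1 else n0 0%N.
have tS k : (t k < t k.+1)%N by rewrite /= leq_max leqnn orbT.
have tn0 k : (n0 k <= t k)%N by case: k => [//|k] /=; rewrite leq_maxl.
exists t; first by apply: (homo_ltn ltn_trans).
have me k : measurable_fun D (EFin \o e (t k)).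
  exact/measurable_EFinP/intg_measurable.
have S : (\int[mu]_(x in D) (\sum_(k <oo) (e (t k) x)%:E) < +oo)%E.
  rewrite integral_nneseries//; last by move=> k x Dx; rewrite lee_fin e0.
  apply: (@le_lt_trans _ _ (\sum_(k <oo) (1 / (2 ^ k.+1)%:R : R)%:E)%E); last first.
    by apply: le_lt_trans (epsilon_trick0 xpredT ler01) _; exact: ltry.
  apply: lee_nneseries => //.
    by move=> k *; apply: integral_ge0 => x Dx; rewrite lee_fin e0.
  move=> k *; have := n0P k (t k) (tn0 k).
  rewrite /Rintegral -lee_fin fineK//.
  exact: (integrable_fin_num mD (ei (t k))).
have /integrable_ae : mu.-integrable D (fun x => \sum_(k <oo) (e (t k) x)%:E)%E.
  apply/integrableP; split.
    apply: (@ge0_emeasurable_sum _ _ _ D (fun k x => (e (t k) x)%:E) xpredT).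
      by move=> k x Dx _; rewrite lee_fin e0.
    by move=> k _; exact: me.
  rewrite (eq_integral (fun x => \sum_(k <oo) (e (t k) x)%:E)%E)//.
  move=> x /set_mem Dx; rewrite gee0_abs//.
  by apply: nneseries_ge0 => k _ _; rewrite lee_fin e0.
move=> /(_ mD); apply: filterS => x fx Dx.
have {fx} fx : (\sum_(k <oo) (e (t k) x)%:E < +oo)%E.
  by have := fx Dx; rewrite fin_numE => /andP[_]; rewrite ltey.
have ek0 k : (0 <= (e (t k) x)%:E)%E by rewrite lee_fin e0.
have tail := nneseries_tail_cvg fx (fun k _ => ek0 k).
have : ((e (t k) x)%:E @[k --> \oo] --> 0)%E.
  apply: (@squeeze_cvge _ _ _ _ (cst 0%E) _ (fun N => \sum_(N <= k <oo) (e (t k) x)%:E)%E).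
  - apply: nearW => n; rewrite ek0/=.
    by have := @nneseries_lim_ge _ _ xpredT n n.+1 (fun k _ _ => ek0 k); rewrite big_nat1.
  - exact: cvg_cst.
  - exact: tail.
by move=> /fine_cvgP[_].
Qed.

End finite_measure.
End square_integrable.

(** * Sobolev functions and their truncations *)

Lemma Lnormy d (T : measurableType d) (R : realType)
    (mu : {measure set T -> \bar R}) (F : T -> \bar R) :
  (0 < mu setT)%E -> 'N[mu]_+oo[F]%E = ess_sup mu (abse \o F).
Proof. by move=> mu0; rewrite unlock /= mu0. Qed.

Section sobolev_interface.
Context {R : realType} {N : nat}.
Local Notation E := 'rV[R]_N.
Local Notation leb := (lebesgue_rV N : {measure set E -> \bar R}).
Variable Omega : set E.
Hypotheses (oO : open Omega) (bO : bounded_set Omega).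
Implicit Types (f g u : E -> R) (Du : E -> E) (i : 'I_N).

Local Notation Rint := (Rintegral leb Omega).
Local Notation intg := (intg leb Omega).
Local Notation sqintg := (sqintg leb Omega).

Lemma open_measurable_Omega : measurable Omega. Proof. exact: open_measurable_mx. Qed.
Let mO : measurable Omega := open_measurable_Omega.

Lemma Omega_lty : (leb Omega < +oo)%E. Proof. exact: bounded_lebesgue_lty. Qed.

Lemma sqr_restrict f : (fun x => (f \_ Omega) x ^+ 2) = (fun x => f x ^+ 2) \_ Omega.
Proof.
by apply/funext => x; rewrite /patch; case: ifP => // _; rewrite expr0n.
Qed.

Lemma intg_restrict f : intg f <-> leb.-integrable setT (EFin \o (f \_ Omega)).
Proof.
by rewrite -restrict_EFin; exact: (integrable_mkcond _ mO).
Qed.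

Lemma Lp_measurable p f : Lp Omega p f -> measurable_fun Omega f.
Proof.
rewrite /Lp inE => /andP[/[!inE]/= mf _].
exact/(measurable_restrictT _ mO).
Qed.

Lemma Lnorm2E f : sqintg f ->
  'N[leb]_2%:E[EFin \o (f \_ Omega)]%E = (Num.sqrt (Rint (fun x => f x ^+ 2)))%:E.
Proof.
move=> [mf f2]; rewrite unlock /=.
have -> : (\int[leb]_x `|(EFin \o (f \_ Omega)) x| `^ 2%:R =
           \int[leb]_(x in Omega) (f x ^+ 2)%:E)%E.
  rewrite [RHS]integral_mkcond restrict_EFin -sqr_restrict.
  apply: eq_integral => x _ /=.
  by rewrite powR_mulrn// real_normK// num_real.
rewrite -[X in (X `^ _)%E]fineK; last exact: (integrable_fin_num mO f2).
rewrite poweR_EFin powR12_sqrt//.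
by apply: Rintegral_ge0 => x _; exact: sqr_ge0.
Qed.

Lemma Lp2P f : Lp Omega 2%:E f <-> sqintg f.
Proof.
split=> [Lf|f2].
  split; first exact: Lp_measurable Lf.
  by apply/intg_restrict; rewrite -sqr_restrict; exact: Lfun2_integrable_sqr.
rewrite /Lp inE; apply/andP; split; rewrite inE/=.
  by have [mf _] := f2; exact/(measurable_restrictT f mO).
by rewrite /finite_norm Lnorm2E// ltry.
Qed.

Lemma Lp1P f : Lp Omega 1%E f <-> intg f.
Proof. by rewrite /Lp Lfun1_integrable intg_restrict. Qed.

Lemma Lnorm1E f : intg f ->
  'N[leb]_1[EFin \o (f \_ Omega)]%E = (Rint (fun x => `|f x|))%:E.
Proof.
move=> fi; rewrite Lnorm1 /Rintegral fineK; last first.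
  exact: (integrable_fin_num mO (intg_norm fi)).
rewrite [RHS]integral_mkcond; apply: eq_integral => x _ /=.
by rewrite /patch; case: ifP => //; rewrite normr0.
Qed.

Lemma Lpoo_bounded f : Lp Omega +oo%E f -> measurable_fun Omega f /\
  exists2 C, 0 <= C & {ae leb, forall x, Omega x -> `|f x| <= C}.
Proof.
move=> Lf; split; first exact: Lp_measurable Lf.
have : finite_norm leb +oo%E (f \_ Omega).
  by move: Lf; rewrite /Lp inE => /andP[_]; rewrite inE.
rewrite /finite_norm Lnormy; last by apply: open_lebesgue_gt0 openT _; exists 0.
have := ess_sup_ge leb (abse \o (EFin \o (f \_ Omega))).
move: (ess_sup _ _) => s sae soo.
have [C C0 sC] : exists2 C : R, 0 <= C & (s <= C%:E)%E.
  case: s soo {sae} => [r _|//|_]; last by exists 0; rewrite // leNye.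
  exists (Num.max r 0); first by rewrite le_max lexx orbT.
  by rewrite lee_fin le_max lexx.
exists C => //; apply: filterS sae => x + Ox.
by rewrite /= /patch mem_set//= => /le_trans /(_ sC); rewrite lee_fin.
Qed.

Lemma smooth_measurable (D : set E) f : smooth f -> measurable_fun D f.
Proof.
move=> sf; apply: (measurable_funS measurableT) => //.
by apply: measurable_fun_continuous; exact: smooth_continuous.
Qed.

Lemma Cc_sqintg f : Cc_infty Omega f -> sqintg f.
Proof.
move=> Cf; have [C fC] := Cc_infty_bounded Cf; have [sf _ _] := Cf.
apply: (sqintg_bounded mO Omega_lty (C := C)) => //; exact: smooth_measurable.
Qed.

End sobolev_interface.

(** * Test functions built from a Sobolev function *)

Lemma squeeze_cvg0 (R : realType) (a b : nat -> R) :
  (forall k, 0 <= a k <= b k) -> b k @[k --> \oo] --> (0 : R) ->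
  a k @[k --> \oo] --> (0 : R).
Proof.
move=> ab b0; apply: (@squeeze_cvgr _ _ _ _ (cst 0) b) => //.
- exact: nearW.
- exact: cvg_cst.
Qed.

Lemma eq_cvg_seq (T : topologicalType) (a b : nat -> T) (l : T) : a =1 b ->
  a k @[k --> \oo] --> l -> b k @[k --> \oo] --> l.
Proof. by move=> /funext ->. Qed.

Lemma cvg0Z (R : realType) (c : R) (a : nat -> R) :
  a k @[k --> \oo] --> (0 : R) -> c * a k @[k --> \oo] --> (0 : R).
Proof. by move=> a0; rewrite -(mulr0 c); apply: cvgMr. Qed.

Lemma cvg0D (R : realType) (a b : nat -> R) :
  a k @[k --> \oo] --> (0 : R) -> b k @[k --> \oo] --> (0 : R) ->
  a k + b k @[k --> \oo] --> (0 : R).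
Proof. by move=> a0 b0; rewrite -(addr0 0); apply: cvgD. Qed.

Lemma cvg_sqr0 (R : realType) (a : nat -> R) :
  a k ^+ 2 @[k --> \oo] --> (0 : R) -> a k @[k --> \oo] --> (0 : R).
Proof.
move=> a0; apply/norm_cvg0P.
rewrite (_ : (fun _ => _) = fun k => Num.sqrt (a k ^+ 2)).
  rewrite -[X in _ --> X](sqrtr0 R).
  exact: (cvg_comp _ _ a0 (@sqrt_continuous R 0)).
by apply/funext => k; rewrite sqrtr_sqr.
Qed.

Lemma cvg_subseq (T : topologicalType) (a : nat -> T) (l : T) (t : nat -> nat) :
  {homo t : m n / (m < n)%N} -> a k @[k --> \oo] --> l ->
  a (t k) @[k --> \oo] --> l.
Proof.
move=> ht al; apply: (cvg_comp _ _ _ al).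
have tk k : (k <= t k)%N by elim: k => // k /leq_ltn_trans; apply; exact: ht.
move=> A [n _ nA]; exists n => // k nk; apply: nA.
exact: leq_trans nk (tk k).
Qed.

(** Smoothness is stated as stability of the smooth functions under composition
    with H: this is the form in which it is used, since H is applied to the
    smooth approximants of a Sobolev function. *)
Definition truncation (R : realType) (N : nat) (C : R) (H dH : R -> R) : Prop :=
  [/\ forall f : 'rV[R]_N -> R, smooth f -> smooth (H \o f),
      forall s : R, is_derive s 1 H (dH s) /\ continuous dH,
      H 0 = 0 & forall s, [/\ `|H s| <= C, `|dH s| <= C & 0 <= dH s]].

Section test_functions.
Context {R : realType} {N : nat}.
Local Notation E := 'rV[R]_N.
Local Notation leb := (lebesgue_rV N : {measure set E -> \bar R}).
Variable Omega : set E.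
Hypotheses (oO : open Omega) (bO : bounded_set Omega).
Implicit Types (f g u : E -> R) (Du : E -> E) (i : 'I_N).

Local Notation Rint := (Rintegral leb Omega).
Local Notation intg := (intg leb Omega).
Local Notation sqintg := (sqintg leb Omega).
Let mO : measurable Omega := open_measurable_Omega oO.
Let Ofin := Omega_lty oO bO.

Lemma Rint_sqr_ge0 f : 0 <= Rint (fun x => f x ^+ 2).
Proof. by apply: Rintegral_ge0 => x _; exact: sqr_ge0. Qed.

Lemma Lnorm2_cvg (g : nat -> E -> R) : (forall k, sqintg (g k)) ->
  ('N[leb]_2%:E[EFin \o ((g k) \_ Omega)%R] @[k --> \oo] --> 0)%E <->
  Rint (fun x => g k x ^+ 2) @[k --> \oo] --> (0 : R).
Proof.
move=> g2; pose I k := Rint (fun x => g k x ^+ 2).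
have -> : (fun k => 'N[leb]_2%:E[EFin \o ((g k) \_ Omega)%R])%E =
    EFin \o (fun k => Num.sqrt (I k)).
  by apply/funext => k; rewrite (Lnorm2E oO).
split=> [/fine_cvgP[_ /=]|I0].
  move=> s0; suff : I k @[k --> \oo] --> (0 : R) by [].
  have -> : I = fun k => Num.sqrt (I k) * Num.sqrt (I k).
    by apply/funext => k; rewrite -expr2 sqr_sqrtr// Rint_sqr_ge0.
  by rewrite -[X in _ --> X](mulr0 0); apply: cvgM.
apply: cvg_EFin; first exact: nearW.
rewrite -[X in _ --> X](sqrtr0 R).
exact: (cvg_comp _ _ I0 (@sqrt_continuous R 0)).
Qed.

Lemma Rint_cvg_sqintg (h : nat -> E -> R) u g : (forall k, sqintg (h k)) ->
  sqintg u -> sqintg g -> Rint (fun x => (h k x - u x) ^+ 2) @[k --> \oo] --> (0 : R) ->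
  Rint (fun x => h k x * g x) @[k --> \oo] --> Rint (fun x => u x * g x).
Proof.
move=> h2 u2 g2 hu.
have hu2 k : sqintg (h k \- u) by exact: sqintgB.
apply/subr_cvg0; apply: cvg_sqr0.
apply: squeeze_cvg0 (cvg0Z (Rint (fun x => g x ^+ 2)) hu) => k.
rewrite sqr_ge0/= -RintegralB//; last 2 first.
- exact: sqintgM.
- exact: sqintgM.
rewrite mulrC; apply: le_trans (cauchy_schwarz mO (hu2 k) g2).
by rewrite le_eqVlt; apply/orP; left; apply/eqP; congr (_ ^+ 2);
  apply: eq_Rintegral => x _ /=; rewrite mulrBl.
Qed.

(** Integrate by parts before taking the limit: both sides of the identity are
    continuous for convergence in mean square. *)
Lemma weak_gradient_limit (psi : nat -> E -> R) u Du :
  (forall k, Cc_infty Omega (psi k)) -> sqintg u ->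
  (forall i, sqintg (fun x => Du x 0 i)) ->
  Rint (fun x => (psi k x - u x) ^+ 2) @[k --> \oo] --> (0 : R) ->
  (forall i, Rint (fun x => (partial i (psi k) x - Du x 0 i) ^+ 2) @[k --> \oo] --> (0 : R)) ->
  weak_gradient Omega u Du.
Proof.
move=> Cpsi u2 Du2 psiu dpsiu phi Cphi i; have [sphi _ _] := Cphi.
have L := Rint_cvg_sqintg (fun k => Cc_sqintg oO bO (Cpsi k)) u2
  (Cc_sqintg oO bO (Cc_infty_partial i Cphi)) psiu.
have L' := Rint_cvg_sqintg (fun k => Cc_sqintg oO bO (Cc_infty_partial i (Cpsi k))) (Du2 i)
  (Cc_sqintg oO bO Cphi) (dpsiu i).
apply: (cvg_unique _ L); first exact: norm_hausdorff.
rewrite (_ : (fun _ => _) = fun k => - Rint (fun x => partial i (psi k) x * phi x)).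
  exact: cvgN.
by apply/funext => k; rewrite (Rint_by_parts i mO (Cpsi k) sphi).
Qed.

Section truncation.
Variables (C : R) (H dH : R -> R).
Hypothesis trH : truncation N C H dH.

Lemma truncation_continuous : continuous H.
Proof.
move=> s; have [_ /(_ s)[[d _] _] _ _] := trH.
exact/differentiable_continuous/derivable1_diffP.
Qed.

Lemma truncation_lip a b : `|H a - H b| <= C * `|a - b|.
Proof.
wlog ab : a b / b < a.
  move=> W; have [/W//|ab|->] := ltgtP b a; last by rewrite !subrr normr0 mulr0.
  by rewrite distrC (distrC a); exact: W.
have [c _ e] := @MVT _ H dH b a ab (fun x _ => (let: And4 _ h _ _ := trH in (h x).1))
   (continuous_subspaceT truncation_continuous).
by rewrite e normrM ler_wpM2r//; have [_ _ _ /(_ c)[]] := trH.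
Qed.

Lemma truncation_sign s : 0 <= s * H s.
Proof.
have [_ dHP H0 HC] := trH.
have ct (x y : R) : {within `[x, y], continuous H}.
  exact: continuous_subspaceT truncation_continuous.
have [s0|s0|<-] := ltgtP 0 s; last by rewrite mul0r.
  have [c _] := @MVT _ H dH 0 s s0 (fun x _ => (dHP x).1) (ct 0 s).
  rewrite H0 !subr0 => ->; have [_ _ d0] := HC c.
  by rewrite mulrCA mulr_ge0// -expr2 sqr_ge0.
have [c _] := @MVT _ H dH s 0 s0 (fun x _ => (dHP x).1) (ct s 0).
rewrite H0 !sub0r => /eqP; rewrite mulrN eqr_opp => /eqP ->.
have [_ _ d0] := HC c.
by rewrite mulrCA mulr_ge0// -expr2 sqr_ge0.
Qed.

Lemma truncation_bound_ge0 : 0 <= C.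
Proof. by have [_ _ _ /(_ 0)[h _ _]] := trH; apply: le_trans h. Qed.

Lemma truncation_measurable u : measurable_fun Omega u ->
  measurable_fun Omega (H \o u).
Proof.
move=> mu; apply: measurableT_comp mu.
exact: continuous_measurable_fun truncation_continuous.
Qed.

Lemma truncation_dmeasurable u : measurable_fun Omega u ->
  measurable_fun Omega (dH \o u).
Proof.
move=> mu; apply: measurableT_comp mu.
by apply: continuous_measurable_fun; have [_ /(_ 0)[]] := trH.
Qed.

(** The factor 1 - zeta removes the set where the measure is concentrated. *)
Definition test_fun zeta u : E -> R := fun x => H (u x) * (1 - zeta x).

Definition test_grad zeta u Du : E -> E := fun x =>
  \row_i (dH (u x) * Du x 0 i * (1 - zeta x) - H (u x) * partial i zeta x).


Variables (u : E -> R) (Du : E -> E) (zeta : E -> R).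
Hypotheses (H10u : H10 Omega u Du) (Czeta : Cc_infty Omega zeta).

Lemma H10_sqintg : sqintg u /\ forall i, sqintg (fun x => Du x 0 i).
Proof.
have [[Lu LDu _] _] := H10u; split; first exact/(Lp2P oO).
by move=> i; exact/(Lp2P oO).
Qed.

Lemma test_fun_sqintg : sqintg (test_fun zeta u).
Proof.
have [u2 _] := H10_sqintg; have [sz _ _] := Czeta.
have [B zB] := Cc_infty_bounded Czeta.
have mu := truncation_measurable u2.1.
apply: (sqintg_bounded mO Ofin (C := C * (1 + B))).
  apply: measurable_funM mu _; apply: measurable_funB => //.
  exact: smooth_measurable.
move=> x _; rewrite /test_fun normrM.
have [_ _ _ /(_ (u x))[HC _ _]] := trH.
by apply: ler_pM => //; apply: (le_trans (ler_normB _ _)); rewrite normr1 lerD2l.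
Qed.

Lemma test_grad_sqintg i : sqintg (fun x => test_grad zeta u Du x 0 i).
Proof.
have [u2 Du2] := H10_sqintg; have [sz _ _] := Czeta.
have [B zB] := Cc_infty_bounded Czeta.
have Cpz := Cc_infty_partial i Czeta.
have mu := truncation_measurable u2.1; have mdu := truncation_dmeasurable u2.1.
have -> : (fun x => test_grad zeta u Du x 0 i) =
    (fun x => (Du x 0 i * dH (u x)) * (1 - zeta x)) \-
    (fun x => partial i zeta x * H (u x)).
  by apply/funext => x; rewrite mxE /=; ring.
apply: sqintgB => //.
  apply: (sqintgM_bounded mO (C := 1 + B)).
  - apply: (sqintgM_bounded mO (C := C)) => // x _.
    by have [_ _ _ /(_ (u x))[]] := trH.
  - by apply: measurable_funB => //; exact: smooth_measurable.
  - by move=> x _; apply: (le_trans (ler_normB _ _)); rewrite normr1 lerD2l.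
apply: (sqintgM_bounded mO (C := C)) => //; first exact: Cc_sqintg.
by move=> x _; have [_ _ _ /(_ (u x))[]] := trH.
Qed.

Lemma Cc_test_fun psi : Cc_infty Omega psi -> Cc_infty Omega (test_fun zeta psi).
Proof.
move=> Cpsi; have [spsi _ _] := Cpsi; have [sz _ _] := Czeta.
have [sH _ H0 _] := trH.
apply: Cc_infty_sub Cpsi _ _.
  exact: (smoothM (sH _ spsi) (smoothB (smooth_cst 1) sz)).
by move=> x px; rewrite /test_fun px H0 mul0r.
Qed.

Lemma partial_test_fun i psi x : smooth psi -> partial i (test_fun zeta psi) x =
  dH (psi x) * partial i psi x * (1 - zeta x) - H (psi x) * partial i zeta x.
Proof.
move=> spsi; have [sz _ _] := Czeta; have [sH dHP H0 _] := trH.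
have s1 : smooth (cst 1 \- zeta) by exact: (smoothB (smooth_cst 1) sz).
rewrite (partialM i x (sH _ spsi) s1) (partialB i x (smooth_cst 1) sz).
rewrite partial_cst (partial_comp i spsi (dHP (psi x)).1) /=.
by ring.
Qed.

(** The chain rule. The approximants of u give approximants H(psi_k)(1 - zeta)
    of the test function; for their gradients, the only term without a factor
    that tends to zero in mean square is (H'(psi_k) - H'(u)) Du, and there
    dominated convergence applies along a subsequence. *)
Lemma H10_test_fun : H10 Omega (test_fun zeta u) (test_grad zeta u Du).
Proof.
have [u2 Du2] := H10_sqintg; have [sz _ _] := Czeta.
have [B zB] := Cc_infty_bounded Czeta.
have [[_ _ _] [psi0 [Cpsi0 [psi0u dpsi0u]]]] := H10u.
have psi02 k : sqintg (psi0 k \- u) by apply: sqintgB => //; exact: Cc_sqintg.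
have dpsi02 i k : sqintg (fun x => partial i (psi0 k) x - Du x 0 i).
  exact: (sqintgB mO (Cc_sqintg oO bO (Cc_infty_partial i (Cpsi0 k))) (Du2 i)).
have {}psi0u := (Lnorm2_cvg psi02).1 psi0u.
have {}dpsi0u i := (Lnorm2_cvg (dpsi02 i)).1 (dpsi0u i).
have [t ht tae] := cvg_mean_subseq mO (fun k => (psi02 k).2)
  (fun k x _ => sqr_ge0 _) psi0u.
pose psi k := psi0 (t k).
have Cpsi k : Cc_infty Omega (psi k) by exact: Cpsi0.
have spsi k : smooth (psi k) by have [] := Cpsi k.
have psiu := cvg_subseq ht psi0u.
have dpsiu i := cvg_subseq ht (dpsi0u i).
have psiae : {ae leb, forall x, Omega x -> psi k x @[k --> \oo] --> u x}.
  apply: filterS tae => x tx Ox; apply/subr_cvg0; apply: cvg_sqr0.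
  exact: tx.
have v2 := test_fun_sqintg; have Dv2 := test_grad_sqintg.
have Cv k := Cc_test_fun (Cpsi k).
have C0 := truncation_bound_ge0.
have z1B x : (1 - zeta x) ^+ 2 <= (1 + B) ^+ 2.
  rewrite -(real_normK (num_real (1 - zeta x))) ler_pXn2r ?nnegrE//.
  - by apply: (le_trans (ler_normB _ _)); rewrite normr1 lerD2l.
  - by rewrite addr_ge0// (le_trans _ (zB x)).
have HL x k : (H (psi k x) - H (u x)) ^+ 2 <= C ^+ 2 * (psi k x - u x) ^+ 2.
  rewrite -(real_normK (num_real (H _ - _))) -(real_normK (num_real (psi k x - _))).
  by rewrite -exprMn ler_pXn2r ?nnegrE// ?mulr_ge0//; exact: truncation_lip.
have vcvg : Rint (fun x => (test_fun zeta (psi k) x - test_fun zeta u x) ^+ 2)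
    @[k --> \oo] --> (0 : R).
  apply: squeeze_cvg0 (cvg0Z (C ^+ 2 * (1 + B) ^+ 2) psiu) => k.
  rewrite Rint_sqr_ge0/= -RintegralZl//; last by case: (psi02 (t k)).
  apply: le_Rintegral => //.
  - by have [] := sqintgB mO (Cc_sqintg oO bO (Cv k)) v2.
  - by apply: (intgZ mO); case: (psi02 (t k)).
  - move=> x Ox; rewrite /test_fun -mulrBl exprMn [leRHS]mulrAC.
    by apply: ler_pM; rewrite ?sqr_ge0 ?HL ?z1B.
have H'cvg i : Rint (fun x => ((dH (psi k x) - dH (u x)) * Du x 0 i) ^+ 2)
    @[k --> \oo] --> (0 : R).
  have -> : (0 : R) = Rint (cst 0) by rewrite Rintegral_cst// mul0r.
  have mdH f : measurable_fun Omega f -> measurable_fun Omega (dH \o f).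
    exact: truncation_dmeasurable.
  apply: (dominated_Rint mO (g := fun x => 4 * C ^+ 2 * Du x 0 i ^+ 2)).
  - move=> k; apply: measurable_funX; apply: measurable_funM (Du2 i).1.
    apply: measurable_funB; apply: mdH; [exact: smooth_measurable|exact: u2.1].
  - exact: measurable_cst.
  - apply: filterS psiae => x px Ox.
    have [_ /(_ 0)[_ cdH] _ _] := trH.
    pose a k := (dH (psi k x) - dH (u x)) * Du x 0 i.
    have L : a k @[k --> \oo] --> (0 : R).
      rewrite -(mul0r (Du x 0 i)); apply: cvgMl; apply/subr_cvg0.
      exact: (cvg_comp _ _ (px Ox) (cdH (u x))).
    suff : (a * a) k @[k --> \oo] --> (0 : R).
      by apply: eq_cvg_seq => k; rewrite /a /= expr2.
    by rewrite -[X in _ --> X](mulr0 0); exact: (cvgM L L).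
  - by apply: (intgZ mO); case: (Du2 i).
  - move=> k x Ox; rewrite ger0_norm ?sqr_ge0// exprMn ler_wpM2r ?sqr_ge0//.
    have [_ _ _ dHC] := trH.
    have [_ d1 _] := dHC (psi k x); have [_ d2 _] := dHC (u x).
    have : `|dH (psi k x) - dH (u x)| <= 2 * C.
      by apply: (le_trans (ler_normB _ _)); rewrite mulr_natl mulr2n lerD.
    rewrite -(real_normK (num_real (_ - _))) => d3.
    have -> : 4 * C ^+ 2 = (2 * C) ^+ 2 by ring.
    by rewrite ler_pXn2r ?nnegrE// mulr_ge0.
have dvcvg i : Rint (fun x => (partial i (test_fun zeta (psi k)) x
    - test_grad zeta u Du x 0 i) ^+ 2) @[k --> \oo] --> (0 : R).
  have [P zP] := Cc_infty_bounded (Cc_infty_partial i Czeta).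
  have zP2 x : partial i zeta x ^+ 2 <= P ^+ 2.
    rewrite -(real_normK (num_real (partial _ _ _))) ler_pXn2r ?nnegrE//.
    by rewrite (le_trans _ (zP x)).
  have mdH f : measurable_fun Omega f -> measurable_fun Omega (dH \o f).
    exact: truncation_dmeasurable.
  have a2 k : sqintg (fun x => (dH (psi k x) - dH (u x)) * Du x 0 i).
    have -> : (fun x => (dH (psi k x) - dH (u x)) * Du x 0 i) =
      (fun x => Du x 0 i * (dH (psi k x) - dH (u x))).
      by apply/funext => x; rewrite mulrC.
    apply: (sqintgM_bounded mO (C := C + C)) => //.
      apply: measurable_funB; apply: mdH; [exact: smooth_measurable|exact: u2.1].
    move=> x _; have [_ _ _ dHC] := trH.
    have [_ d1 _] := dHC (psi k x); have [_ d2 _] := dHC (u x).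
    by apply: (le_trans (ler_normB _ _)); rewrite lerD.
  have L := cvg0D (cvg0D (cvg0Z (3 * (C ^+ 2 * (1 + B) ^+ 2)) (dpsiu i))
    (cvg0Z (3 * (1 + B) ^+ 2) (H'cvg i))) (cvg0Z (3 * (C ^+ 2 * P ^+ 2)) psiu).
  apply: squeeze_cvg0 L => k; rewrite Rint_sqr_ge0/=.
  have i1 := (dpsi02 i (t k)).2; have i2 := (a2 k).2; have i3 := (psi02 (t k)).2.
  have j1 := intgZ mO (3 * (C ^+ 2 * (1 + B) ^+ 2)) i1.
  have j2 := intgZ mO (3 * (1 + B) ^+ 2) i2.
  have j3 := intgZ mO (3 * (C ^+ 2 * P ^+ 2)) i3.
  rewrite -!RintegralZl// -(RintegralD mO j1 j2) -(RintegralD mO (intgD mO j1 j2) j3).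
  apply: le_Rintegral => //.
  - by have [] := sqintgB mO (Cc_sqintg oO bO (Cc_infty_partial i (Cv k))) (Dv2 i).
  - exact: intgD (intgD mO j1 j2) j3.
  move=> x Ox; rewrite partial_test_fun// mxE -/(psi k).
  set p := partial i (psi k) x; set q := partial i zeta x; set d := Du x 0 i.
  have [_ _ _ dHC] := trH; have [_ d1 _] := dHC (psi k x).
  have {}d1 : dH (psi k x) ^+ 2 <= C ^+ 2.
    by rewrite -(real_normK (num_real (dH _))) ler_pXn2r ?nnegrE.
  have h1 : (dH (psi k x) * (p - d) * (1 - zeta x)) ^+ 2 <=
            C ^+ 2 * (1 + B) ^+ 2 * (p - d) ^+ 2.
    by rewrite !exprMn mulrAC; apply: ler_wpM2r; rewrite ?sqr_ge0// ler_pM ?sqr_ge0// z1B.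
  have h2 : ((dH (psi k x) - dH (u x)) * d * (1 - zeta x)) ^+ 2 <=
            (1 + B) ^+ 2 * ((dH (psi k x) - dH (u x)) * d) ^+ 2.
    by rewrite exprMn mulrC; apply: ler_wpM2r; rewrite ?sqr_ge0.
  have h3 : ((H (psi k x) - H (u x)) * q) ^+ 2 <=
            C ^+ 2 * P ^+ 2 * (psi k x - u x) ^+ 2.
    by rewrite exprMn [leRHS]mulrAC; apply: ler_pM; rewrite ?sqr_ge0 ?HL ?zP2.
  have -> : (psi0 (t k) \- u) x = psi k x - u x by [].
  set X := dH (psi k x) * (p - d) * (1 - zeta x) in h1.
  set Y := (dH (psi k x) - dH (u x)) * d * (1 - zeta x) in h2.
  set Z := (H (psi k x) - H (u x)) * q in h3.
  have -> : dH (psi k x) * p * (1 - zeta x) - H (psi k x) * q -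
    (dH (u x) * d * (1 - zeta x) - H (u x) * q) = X + Y - Z by rewrite /X /Y /Z; ring.
  have : (X + Y - Z) ^+ 2 <= 3 * (X ^+ 2 + Y ^+ 2 + Z ^+ 2).
    have := sqr_ge0 (X - Y); have := sqr_ge0 (X + Z); have := sqr_ge0 (Y + Z); nra.
  by rewrite /= -/p -/d; lra.
split.
  split; first exact/(Lp2P oO).
  - by move=> i; exact/(Lp2P oO).
  - exact: (weak_gradient_limit Cv v2 Dv2 vcvg dvcvg).
exists (fun k => test_fun zeta (psi k)); split => //; split.
  apply/Lnorm2_cvg => // k; exact: (sqintgB mO (Cc_sqintg oO bO (Cv k)) v2).
move=> i; apply/Lnorm2_cvg => [k|//].
exact: (sqintgB mO (Cc_sqintg oO bO (Cc_infty_partial i (Cv k))) (Dv2 i)).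
Qed.

End truncation.

Lemma H10_Cc phi : Cc_infty Omega phi -> H10 Omega phi (grad phi).
Proof.
move=> Cphi; have phi2 := Cc_sqintg oO bO Cphi.
have Dphi2 i : sqintg (fun x => grad phi x 0 i).
  have := Cc_sqintg oO bO (Cc_infty_partial i Cphi).
  by congr sqintg; apply/funext => x; rewrite mxE.
have cvg0 (g : E -> R) : Rint (fun x => (g x - g x) ^+ 2) @[k --> \oo] --> (0 : R).
  rewrite (_ : Rint _ = 0); first exact: cvg_cst.
  rewrite -[RHS](mul0r (fine (leb Omega))) -Rintegral_cst//.
  by apply: eq_Rintegral => x _; rewrite subrr expr0n.
have cvgp i : Rint (fun x => (partial i phi x - grad phi x 0 i) ^+ 2) @[k --> \oo] --> (0 : R).
  by under eq_Rintegral do rewrite mxE; exact: (cvg0 (partial i phi)).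
split; first split.
- exact/(Lp2P oO).
- by move=> i; exact/(Lp2P oO).
- exact: (weak_gradient_limit (fun=> Cphi) phi2 Dphi2 (cvg0 phi) cvgp).
exists (fun=> phi); split=> //; split.
  exact: ((Lnorm2_cvg (fun=> sqintgB mO phi2 phi2)).2 (cvg0 phi)).
move=> i; have p2 := sqintgB mO (Cc_sqintg oO bO (Cc_infty_partial i Cphi)) (Dphi2 i).
exact: ((Lnorm2_cvg (fun=> p2)).2 (cvgp i)).
Qed.

End test_functions.

(** * Two truncations *)

Section truncations.
Context {R : realType}.
Implicit Types (s p M : R).

(** The graph s / (1 + s^2)^(p/2), a smooth substitute for s / |s|^p at
    infinity. *)
Definition soft_sign p s : R := s * (1 + s ^+ 2) `^ (- (p / 2)).

Lemma add1sqr_ge1 s : 1 <= 1 + s ^+ 2.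
Proof. by rewrite lerDl sqr_ge0. Qed.

Lemma add1sqr_gt0 s : 0 < 1 + s ^+ 2.
Proof. exact: lt_le_trans (add1sqr_ge1 s). Qed.

Lemma powR_add1sqr_le p p' s : p <= p' ->
  (1 + s ^+ 2) `^ p <= (1 + s ^+ 2) `^ p'.
Proof. by move=> pp; apply: ler_powR => //; exact: add1sqr_ge1. Qed.

Lemma is_derive_soft_sign p s : is_derive s 1 (soft_sign p)
  (p * (1 + s ^+ 2) `^ (- (p / 2) - 1) + (1 - p) * (1 + s ^+ 2) `^ (- (p / 2))).
Proof.
have q0 := add1sqr_gt0 s.
have dq : is_derive s 1 (fun s : R => 1 + s ^+ 2) (2 * s).
  have -> : (fun s : R => 1 + s ^+ 2) = cst 1 + (@id R) ^+ 2.
    by apply/funext => x; rewrite !fctE.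
  apply: is_derive_eq; rewrite add0r /= expr1 -[RHS]mulr1; congr (_ * _).
have dpow : is_derive s 1 (fun s : R => (1 + s ^+ 2) `^ (- (p / 2)))
    (- (p / 2) * (1 + s ^+ 2) `^ (- (p / 2) - 1) * (2 * s)).
  exact: (@is_derive1_comp _ (fun y => y `^ (- (p / 2))) (fun s : R => 1 + s ^+ 2)
    s _ _ (is_derive1_powR (- (p / 2)) q0) dq).
have := @is_deriveM _ _ _ _ s 1 _ _ (@is_derive_id _ _ s 1) dpow.
congr is_derive; rewrite /= /GRing.scale/= mulr1.
have -> : (1 + s ^+ 2) `^ (- (p / 2)) =
    (1 + s ^+ 2) * (1 + s ^+ 2) `^ (- (p / 2) - 1).
  rewrite -{2}(powRr1 (ltW q0)) -powRD ?(gt_eqF q0) ?implybT//.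
  by congr powR; ring.
by field.
Qed.

Lemma smooth_soft_sign N p (f : 'rV[R]_N -> R) : smooth f -> smooth (soft_sign p \o f).
Proof.
move=> sf; apply: (smoothM sf).
apply: smooth_powR => [x|]; first exact: add1sqr_gt0.
exact: (smoothD (smooth_cst 1) (smoothX 2 sf)).
Qed.

Lemma soft_sign0 p : soft_sign p 0 = 0.
Proof. by rewrite /soft_sign mul0r. Qed.

Lemma powR_Nhalf_sqr s : (1 + s ^+ 2) * ((1 + s ^+ 2) `^ (- (1 / 2))) ^+ 2 = 1.
Proof.
have q0 := add1sqr_gt0 s.
rewrite -[X in _ * X]powR_mulrn ?powR_ge0// -powRrM.
have -> : - (1 / 2) * 2%:R = -1 :> R by field.
by rewrite powR_inv1 ?ltW// divff// gt_eqF.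
Qed.

Lemma soft_sign1_le1 s : `|soft_sign 1 s| <= 1.
Proof.
have := powR_Nhalf_sqr s; rewrite /soft_sign; set w := _ `^ _ => qw.
rewrite -ler_sqr ?nnegrE// expr1n real_normK ?num_real//.
by rewrite exprMn -qw ler_wpM2r ?sqr_ge0// lerDr.
Qed.

Lemma continuous_powR_add1sqr (p : R) : continuous (fun s : R => (1 + s ^+ 2) `^ p).
Proof.
move=> s; have q0 := add1sqr_gt0 s.
have c1 : {for s, continuous (fun s : R => 1 + s ^+ 2)}.
  by apply: cvgD; [exact: cvg_cst|exact: exprn_continuous].
have c2 : {for 1 + s ^+ 2, continuous (fun y : R => y `^ p)}.
  apply: differentiable_continuous; apply/derivable1_diffP.
  by have [] := is_derive1_powR p q0.
exact: (cvg_comp _ _ c1 c2).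
Qed.

(** As M grows this tends to the sign of s. *)
Definition soft_sgn M s : R := soft_sign 1 (M * s).
Definition dsoft_sgn M s : R := M * (1 + (M * s) ^+ 2) `^ (- (1 / 2) - 1).

Lemma soft_sgn_truncation N M : 1 <= M ->
  truncation N M (soft_sgn M) (dsoft_sgn M).
Proof.
move=> M1; have M0 : 0 <= M by exact: le_trans M1.
split.
- move=> f sf; apply: (@smooth_soft_sign _ 1 (cst M \* f)).
  exact: (smoothM (smooth_cst M) sf).
- move=> s; split.
    have dM : is_derive s 1 (fun s : R => M * s) M.
      have -> : (fun s : R => M * s) = M *: (@id R) by apply/funext.
      by apply: is_derive_eq; exact: mulr1.
    have := @is_derive1_comp _ (soft_sign 1) (fun s => M * s) s _ _
      (is_derive_soft_sign 1 (M * s)) dM.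
    by congr is_derive; rewrite /dsoft_sgn subrr mul0r addr0 mul1r mulrC.
  move=> y.
  have cM : {for y, continuous (fun s : R => M * s)} by exact: mulrl_continuous.
  have c : (1 + (M * x) ^+ 2) `^ (- (1 / 2) - 1) @[x --> y] -->
      (1 + (M * y) ^+ 2) `^ (- (1 / 2) - 1).
    exact: (cvg_comp _ _ cM (@continuous_powR_add1sqr (- (1 / 2) - 1) (M * y))).
  by rewrite /continuous_at /dsoft_sgn; exact: (cvgMr c).
- by rewrite /soft_sgn mulr0 soft_sign0.
- move=> s; split.
  + exact: le_trans (soft_sign1_le1 _) M1.
  + rewrite ger0_norm ?mulr_ge0 ?powR_ge0// -[leRHS]mulr1 ler_wpM2l//.
    by rewrite -[leRHS](powRr0 (1 + (M * s) ^+ 2)); apply: powR_add1sqr_le; lra.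
  + by rewrite mulr_ge0// powR_ge0.
Qed.

(** With y = M |s| the claim reads y - 1 <= y^2 / (1 + y^2)^(1/2), and the
    denominator is at most 1 + y. *)
Lemma soft_sgn_ge M s : 0 < M -> `|s| <= s * soft_sgn M s + M^-1.
Proof.
move=> M0; have := powR_Nhalf_sqr (M * s).
rewrite /soft_sgn /soft_sign; set w := _ `^ _ => qw.
have w0 : 0 < w by rewrite powR_gt0// add1sqr_gt0.
pose y := M * `|s|.
have y0 : 0 <= y by rewrite mulr_ge0// ltW.
have yy : (M * s) ^+ 2 = y ^+ 2.
  by rewrite /y !exprMn real_normK ?num_real.
rewrite yy in qw.
have w1 : 1 <= w * (1 + y).
  have : 1 <= (w * (1 + y)) ^+ 2 by rewrite exprMn; nra.
  have : 0 <= w * (1 + y) by rewrite mulr_ge0 ?addr_ge0// ltW.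
  by set z := w * _ => z0 z1; case: (leP 1 z) => // z2; nra.
rewrite -(ler_pM2l M0) mulrDr divff ?gt_eqF// -/y.
have -> : M * (s * (M * s * w)) = (M * s) ^+ 2 * w by ring.
rewrite yy; nra.
Qed.

End truncations.

Section power_truncation.
Context {R : realType}.
Variable gamma : R.
Hypothesis gamma_gt1 : 1 < gamma.
Implicit Types s : R.

(** An antiderivative of (1 + s^2)^(- gamma/2), up to a factor and to a
    nonnegative error; bounded, because gamma > 1. *)
Definition powtrunc s : R := soft_sign 1 s - gamma^-1 * soft_sign gamma s.

Definition dpowtrunc s : R :=
  (1 + s ^+ 2) `^ (- (1 / 2) - 1) - (1 + s ^+ 2) `^ (- (gamma / 2) - 1) +
  (1 - gamma^-1) * (1 + s ^+ 2) `^ (- (gamma / 2)).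

Let gamma0 : 0 < gamma. Proof. exact: lt_trans gamma_gt1. Qed.

Let gammaV : 0 < 1 - gamma^-1.
Proof. by rewrite subr_gt0 invf_lt1. Qed.

Lemma powtrunc_le1 s : `|powtrunc s| <= 1.
Proof.
rewrite /powtrunc /soft_sign.
have -> : s * (1 + s ^+ 2) `^ (- (1 / 2)) - gamma^-1 * (s * (1 + s ^+ 2) `^ (- (gamma / 2))) =
    soft_sign 1 s * (1 - gamma^-1 * (1 + s ^+ 2) `^ (- ((gamma - 1) / 2))).
  rewrite /soft_sign.
  have -> : - (gamma / 2) = - (1 / 2) + (- ((gamma - 1) / 2)) by field.
  rewrite powRD; last by rewrite (gt_eqF (add1sqr_gt0 s)) implybT.
  move: (_ `^ (- (1 / 2))) (_ `^ (- ((gamma - 1) / 2))) => w1 w2; ring.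
rewrite normrM -[leRHS]mulr1 ler_pM ?soft_sign1_le1//.
have w0 := powR_ge0 (1 + s ^+ 2) (- ((gamma - 1) / 2)).
have w1 : (1 + s ^+ 2) `^ (- ((gamma - 1) / 2)) <= 1.
  rewrite -[leRHS](powRr0 (1 + s ^+ 2)); apply: powR_add1sqr_le.
  by rewrite oppr_le0 divr_ge0// subr_ge0 ltW.
have g0 : 0 < gamma^-1 by rewrite invr_gt0.
have g1 : gamma^-1 <= 1 by rewrite invf_le1// ltW.
have gw0 := mulr_ge0 (ltW g0) w0; have gw1 := mulr_ile1 (ltW g0) w0 g1 w1.
by move: (gamma^-1 * _) gw0 gw1 => t t0 t1; rewrite ler_norml; apply/andP; split; lra.
Qed.

Lemma dpowtrunc_ge s :
  (1 - gamma^-1) * ((1 + `|s|) `^ gamma)^-1 <= dpowtrunc s.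
Proof.
rewrite /dpowtrunc; apply: (@le_trans _ _ ((1 - gamma^-1) * (1 + s ^+ 2) `^ (- (gamma / 2)))).
  have a0 : 0 < 1 + `|s| by rewrite ltr_pwDl.
  rewrite ler_wpM2l ?(ltW gammaV)// powRN.
  rewrite lef_pV2 ?posrE ?powR_gt0 ?add1sqr_gt0//.
  have -> : gamma = 2%:R * (gamma / 2) by field.
  rewrite [leRHS]powRrM powR_mulrn ?addr_ge0//.
  have -> : 2%:R * (gamma / 2) / 2 = gamma / 2 by field.
  apply: ge0_ler_powR; rewrite ?nnegrE ?sqr_ge0 ?(ltW (add1sqr_gt0 s))//.
    by rewrite divr_ge0// ltW.
  have := normr_ge0 s; have : `|s| ^+ 2 = s ^+ 2 by rewrite real_normK ?num_real.
  nra.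
rewrite lerDr subr_ge0; apply: powR_add1sqr_le.
have g1 := gamma_gt1. lra.
Qed.

Lemma powtrunc_truncation N : truncation N 2 powtrunc dpowtrunc.
Proof.
split.
- move=> f sf; apply: (smoothB (smooth_soft_sign 1 sf)).
  exact: (smoothM (smooth_cst gamma^-1) (smooth_soft_sign gamma sf)).
- move=> s; split.
    have := @is_deriveB _ _ _ _ _ s 1 _ _ (is_derive_soft_sign 1 s)
      (@is_deriveZ _ _ _ _ gamma^-1 s 1 _ (is_derive_soft_sign gamma s)).
    congr is_derive; rewrite /dpowtrunc /= /GRing.scale/=; field.
    by rewrite gt_eqF.
  move=> y; apply: cvgD; last by apply: cvgMr; exact: continuous_powR_add1sqr.
  by apply: cvgB; exact: continuous_powR_add1sqr.
- by rewrite /powtrunc !soft_sign0 mulr0 subrr.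
- move=> s; have := powtrunc_le1 s; have := dpowtrunc_ge s.
  have : 0 <= (1 - gamma^-1) * ((1 + `|s|) `^ gamma)^-1.
    by rewrite mulr_ge0 ?invr_ge0 ?powR_ge0// ltW.
  move=> h1 h2 h3; have d0 := le_trans h1 h2; split=> //; first lra.
  rewrite ger0_norm// /dpowtrunc; have g1 := gamma_gt1.
  have := powR_ge0 (1 + s ^+ 2) (- (gamma / 2) - 1).
  have : (1 + s ^+ 2) `^ (- (1 / 2) - 1) <= 1.
    by rewrite -[leRHS](powRr0 (1 + s ^+ 2)); apply: powR_add1sqr_le; lra.
  have : (1 + s ^+ 2) `^ (- (gamma / 2)) <= 1.
    by rewrite -[leRHS](powRr0 (1 + s ^+ 2)); apply: powR_add1sqr_le; lra.
  have := powR_ge0 (1 + s ^+ 2) (- (gamma / 2)).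
  have g0 : 0 < gamma^-1 by rewrite invr_gt0.
  by have := gammaV; nra.
Qed.

End power_truncation.

(** * Measurability of the flux *)

Section caratheodory.
Context {R : realType} {N : nat}.
Local Notation E := 'rV[R]_N.
Local Notation leb := (lebesgue_rV N : {measure set E -> \bar R}).
Variable Omega : set E.
Hypothesis mO : measurable Omega.

Definition grid_index (k : nat) (v : E) : {ffun 'I_N -> int} :=
  [ffun i => Num.floor (k.+1%:R * v 0 i)].

Definition grid_point (k : nat) (z : {ffun 'I_N -> int}) : E :=
  \row_i ((z i)%:~R / k.+1%:R).

Lemma grid_point_cvg (v : E) :
  grid_point k (grid_index k v) @[k --> \oo] --> v.
Proof.
apply/subr_cvg0; apply/norm_cvg0P; apply: squeeze_cvg0 (@cvg_harmonic R) => k.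
rewrite normr_ge0/= -[leLHS]/(mx_norm (grid_point k (grid_index k v) - v)) mx_normrE.
apply: bigmax_le => [|[i j] _ /=]; first by rewrite invr_ge0 ler0n.
rewrite ord1 !mxE ffunE.
have k0 : 0 < k.+1%:R :> R by rewrite ltr0n.
have /andP[h1 h2] := floor_itv (k.+1%:R * v 0 j).
rewrite intrD in h2.
rewrite -(ler_pM2l k0) divff ?gt_eqF// -[X in X * _ <= _](gtr0_norm k0) -normrM.
rewrite mulrBr mulrCA divff ?gt_eqF// mulr1 ler_norml; apply/andP; split; lra.
Qed.

Lemma measurable_grid_index (Du : E -> E) k z :
  (forall i, measurable_fun Omega (fun x => Du x 0 i)) ->
  measurable (Omega `&` [set x | grid_index k (Du x) = z]).
Proof.
move=> mDu.
have -> : Omega `&` [set x | grid_index k (Du x) = z] =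
    Omega `&` \bigcap_(i in [set: 'I_N])
      (Omega `&` (fun x => k.+1%:R * Du x 0 i) @^-1` `[(z i)%:~R, (z i + 1)%:~R[).
  apply/seteqP; split=> x /=.
    move=> [Ox zx]; split=> // i _; split=> //=.
    by rewrite -zx ffunE in_itv/= floor_itv.
  move=> [Ox H]; split=> //; apply/ffunP => i; rewrite ffunE.
  by have [_] := H i I; rewrite /= in_itv/= => /floor_def.
apply: measurableI => //; apply: fin_bigcap_measurable => // i _.
have : measurable_fun Omega (fun x => k.+1%:R * Du x 0 i) by exact: measurable_funM.
by apply => //; exact: measurable_itv.
Qed.

(** Round the gradient to a grid that gets finer: on each of the countably many
    pieces where the rounded gradient is constant the flux has a Borel
    representative, and the limit exists by continuity in the gradient. *)
Lemma caratheodory_borel (a : E -> E -> E) (Du : E -> E) :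
  caratheodory_fun Omega a ->
  (forall i, measurable_fun Omega (fun x => Du x 0 i)) ->
  exists2 b : E -> E, forall i, measurable_fun Omega (fun x => b x 0 i) &
    {ae leb, forall x, Omega x -> a x (Du x) = b x}.
Proof.
move=> [ma ca] mDu.
have /choice[G GP] (xi : E) : exists G : E -> E, measurable_fun Omega G /\
    {ae leb, forall x, Omega x -> a x xi = G x}.
  by have [G mG aG] := ma xi; exists G.
pose B k x := G (grid_point k (grid_index k (Du x))) x.
have mB k i : measurable_fun Omega (fun x => B k x 0 i).
  move=> _ Y mY.
  have -> : Omega `&` (fun x => B k x 0 i) @^-1` Y =
      \bigcup_(z in [set: {ffun 'I_N -> int}])
        ((Omega `&` [set x | grid_index k (Du x) = z]) `&`
         (Omega `&` (fun x => G (grid_point k z) x 0 i) @^-1` Y)).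
    apply/seteqP; split=> x /=.
      by move=> [Ox YB]; exists (grid_index k (Du x)).
    by move=> [z _ [[Ox zx] [_ Yx]]]; split=> //; rewrite /B zx.
  apply: countable_bigcupT_measurable; first exact: countableP.
  move=> z; apply: measurableI; first exact: measurable_grid_index.
  have : measurable_fun Omega (fun x => G (grid_point k z) x 0 i).
    by apply: (measurableT_comp (@measurable_coord R N i)); case: (GP (grid_point k z)).
  exact.
exists (fun x => \row_i fine (limn_esup (fun k => (B k x 0 i)%:E))).
  move=> i; under eq_fun do rewrite mxE.
  apply: (measurableT_comp (fine_measurable measurableT)).
  apply: measurable_fun_limn_esup => k; exact/measurable_EFinP.
pose enc (n : nat) : option (nat * {ffun 'I_N -> int}) := unpickle n.
have aeG : {ae leb, forall x, forall n, forall k z, enc n = Some (k, z) -> Omega x ->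
    a x (grid_point k z) = G (grid_point k z) x}.
  apply: ae_foralln => n; case: (enc n) => [[k z]|]; last by apply: aeW.
  have [_] := GP (grid_point k z).
  by apply: filterS => x h k' z' [<- <-].
apply: filterS2 aeG ca => x hG cax Ox.
have BE k : B k x = a x (grid_point k (grid_index k (Du x))).
  rewrite /B; apply/esym/(hG (pickle (k, grid_index k (Du x)))) => //.
  exact: pickleK.
have Bcvg : B k x @[k --> \oo] --> a x (Du x).
  have H := @cvg_comp _ _ _ (fun k => grid_point k (grid_index k (Du x))) (a x)
    _ _ _ (@grid_point_cvg (Du x)) (cax Ox (Du x)).
  suff -> : B ^~ x = a x \o (fun k => grid_point k (grid_index k (Du x))) by [].
  by apply/funext => k; rewrite BE.
apply/rowP => i; rewrite mxE.
have Bi : B k x 0 i @[k --> \oo] --> a x (Du x) 0 i.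
  exact: (cvg_comp _ _ Bcvg (@coord_continuous R 1 N 0 i (a x (Du x)))).
have Bie : ((B k x 0 i)%:E @[k --> \oo] --> (a x (Du x) 0 i)%:E)%E.
  by apply: cvg_EFin; [exact: nearW|exact: Bi].
by rewrite (cvg_limn_einf_sup Bie).2.
Qed.

End caratheodory.

(** * Estimates for weak solutions *)

Section estimates.
Context {R : realType} {N : nat}.
Local Notation E := 'rV[R]_N.
Local Notation leb := (lebesgue_rV N : {measure set E -> \bar R}).
Variable Omega : set E.
Hypotheses (oO : open Omega) (bO : bounded_set Omega).
Implicit Types (f g u : E -> R) (Du : E -> E) (i : 'I_N).

Local Notation Rint := (Rintegral leb Omega).
Local Notation intg := (intg leb Omega).
Local Notation sqintg := (sqintg leb Omega).
Let mO : measurable Omega := open_measurable_Omega oO.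
Let Ofin := Omega_lty oO bO.

Lemma dot_ge0 (x : E) : 0 <= dot x x.
Proof. by apply: sumr_ge0 => i _; rewrite -expr2 sqr_ge0. Qed.

Lemma enorm_sqr (x : E) : enorm x ^+ 2 = dot x x.
Proof. by rewrite sqr_sqrtr// dot_ge0. Qed.

Lemma dotZl c (x y : E) : dot (c *: x) y = c * dot x y.
Proof. by rewrite /dot mulr_sumr; apply: eq_bigr => i _; rewrite mxE mulrA. Qed.

Lemma dotZr c (x y : E) : dot x (c *: y) = c * dot x y.
Proof. by rewrite /dot mulr_sumr; apply: eq_bigr => i _; rewrite mxE mulrCA. Qed.

Lemma sqr_coord_dot (x : E) i : x 0 i ^+ 2 <= dot x x.
Proof.
rewrite /dot (bigD1 i)//= -expr2 lerDl.
by apply: sumr_ge0 => j _; rewrite -expr2 sqr_ge0.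
Qed.

Lemma dot_intg (V W : E -> E) : (forall i, sqintg (fun x => V x 0 i)) ->
  (forall i, sqintg (fun x => W x 0 i)) -> intg (fun x => dot (V x) (W x)).
Proof. by move=> V2 W2; apply: (intg_sum mO) => i; exact: sqintgM. Qed.

(** The products of vector fields are estimated by Young's inequality with a
    free parameter t instead of by the product of two norms. *)
Lemma dot_young (x y : E) (t : R) : 0 < t ->
  `|dot x y| <= (t * dot x x + t^-1 * dot y y) / 2.
Proof.
move=> t0; apply: (le_trans (ler_norm_sum _ _ _)).
rewrite /dot !mulr_sumr -big_split/= mulr_suml; apply: ler_sum => i _.
set a := x 0 i; set b := y 0 i.
have := sqr_ge0 (t * a - b); have := sqr_ge0 (t * a + b) => h1 h2.
have tV : 0 < t^-1 by rewrite invr_gt0.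
have e1 : t * (a * a) + t^-1 * (b * b) = t^-1 * ((t * a) ^+ 2 + b ^+ 2).
  by field; rewrite gt_eqF.
have e2 : a * b = t^-1 * ((t * a) * b) by field; rewrite gt_eqF.
rewrite e1 e2 normrM (gtr0_norm tV) -[leRHS]mulrA ler_pM2l// ler_norml.
by apply/andP; split; nra.
Qed.

Variables (a : E -> E -> E) (alpha beta gamma : R).
Hypotheses (alpha_gt0 : 0 < alpha) (beta_gt0 : 0 < beta) (gamma_gt1 : 1 < gamma).
Hypotheses (caratheodory_a : caratheodory_fun Omega a)
  (structure_a : leray_lions Omega a alpha beta).

Definition coercivity : R := (1 - gamma^-1) * alpha / beta ^+ 2.

Lemma coercivity_gt0 : 0 < coercivity.
Proof.
have g0 : 0 < gamma by exact: lt_trans gamma_gt1.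
by rewrite divr_gt0 ?exprn_gt0// mulr_gt0// subr_gt0 invf_lt1.
Qed.

(** An upper bound of the right-hand side of the weak formulation, for the test
    functions H(u)(1 - zeta) with |H| bounded by 1. *)
Definition load f (sigma : E -> E) (zeta : E -> R) : R :=
  Rint (fun x => f x * (1 - zeta x)) +
  Rint (fun x => `|dot (sigma x) (grad zeta x)|).

Definition cutoff (zeta : E -> R) :=
  Cc_infty Omega zeta /\ forall x, 0 <= zeta x <= 1.

Section one_solution.
Variables (f u : E -> R) (Du sigma : E -> E).
Hypotheses (f_intg : intg f) (f_ge0 : {ae leb, forall x, Omega x -> 0 <= f x}).
Hypotheses (H10u : H10 Omega u Du) (sigma2 : forall i, sqintg (fun x => sigma x 0 i)).
Hypothesis weak : forall phi Dphi, H10 Omega phi Dphi ->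
  Rint (fun x => dot (sigma x) (Dphi x)) + Rint (fun x => u x * phi x) =
  Rint (fun x => f x * phi x).

Let u2 : sqintg u. Proof. by have [] := H10_sqintg oO H10u. Qed.
Let Du2 : forall i, sqintg (fun x => Du x 0 i). Proof. by have [] := H10_sqintg oO H10u. Qed.

Let cutoff_le zeta x : cutoff zeta -> `|1 - zeta x| <= 1.
Proof.
by move=> [_ /(_ x)/andP[z0 z1]]; rewrite ler_norml; apply/andP; split; lra.
Qed.

Let grad_sqintg zeta i : cutoff zeta -> sqintg (fun x => grad zeta x 0 i).
Proof.
move=> [Cz _]; have := Cc_sqintg oO bO (Cc_infty_partial i Cz).
by congr sqintg; apply/funext => x; rewrite mxE.
Qed.

Let mcut zeta : cutoff zeta -> measurable_fun Omega (fun x => 1 - zeta x).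
Proof.
move=> [[sz _ _] _]; apply: measurable_funB => //; exact: smooth_measurable.
Qed.

Lemma load_ge zeta (H : E -> R) : cutoff zeta -> measurable_fun Omega H ->
  (forall x, `|H x| <= 1) ->
  Rint (fun x => f x * (H x * (1 - zeta x))) +
  Rint (fun x => H x * dot (sigma x) (grad zeta x)) <= load f sigma zeta.
Proof.
move=> cz mH H1.
have fz : intg (fun x => f x * (1 - zeta x)).
  by apply: (intgM_bounded mO (C := 1)) => // [|x _]; [exact: mcut|exact: cutoff_le].
have dz : intg (fun x => dot (sigma x) (grad zeta x)).
  by apply: dot_intg => // i; exact: grad_sqintg.
apply: lerD.
  apply: (ae_eq_Rintegral_le mO) => //.
    apply: (intgM_bounded mO (C := 1)) => //.
      by apply: measurable_funM mH _; exact: mcut.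
    by move=> x _; rewrite normrM -[leRHS]mulr1 ler_pM//; exact: cutoff_le.
  apply: filterS f_ge0 => x fx Ox; rewrite ler_wpM2l ?fx//.
  have [_ /(_ x)/andP[z0 z1]] := cz; have := H1 x; rewrite ler_norml => /andP[h1 h2].
  nra.
apply: le_Rintegral => //.
- apply: (eq_intg mO _ (intgM_bounded mO (C := 1) dz mH (fun x _ => H1 x))) => x _.
  by rewrite mulrC.
- exact: intg_norm.
- move=> x _; apply: (le_trans (ler_norm _)); rewrite normrM -[leRHS]mul1r.
  by rewrite ler_wpM2r.
Qed.

Lemma energy_estimate C H dH zeta : truncation N C H dH ->
  (forall s, `|H s| <= 1) -> cutoff zeta ->
  Rint (fun x => dot (sigma x) (Du x) * (dH (u x) * (1 - zeta x))) +
  Rint (fun x => u x * (H (u x) * (1 - zeta x))) <= load f sigma zeta.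
Proof.
move=> trH H1 cz; have [Cz _] := cz.
have mHu := truncation_measurable trH u2.1.
have mdHu := truncation_dmeasurable trH u2.1.
apply: le_trans (load_ge cz mHu (fun x => H1 (u x))).
rewrite -lerBlDr -(weak (H10_test_fun oO bO trH H10u Cz)).
rewrite addrAC lerD2r lerBlDr le_eqVlt; apply/orP; left; apply/eqP.
have dz : intg (fun x => dot (sigma x) (grad zeta x)).
  by apply: dot_intg => // i; exact: grad_sqintg.
rewrite -RintegralD//.
- apply: eq_Rintegral => x _; rewrite /dot mulr_suml mulr_sumr -big_split/=.
  by apply: eq_bigr => i _; rewrite /test_grad !mxE; ring.
- by apply: dot_intg => //; exact: (test_grad_sqintg oO bO trH H10u Cz).
- apply: (eq_intg mO _ (intgM_bounded mO (C := 1) dz mHu (fun x _ => H1 (u x)))) => x _.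
  by rewrite mulrC.
Qed.

Hypothesis structure_sigma : {ae leb, forall x, Omega x ->
  let w := ((1 + `|u x|) `^ gamma)^-1 in
  alpha * w * dot (Du x) (Du x) <= dot (sigma x) (Du x) /\
  dot (sigma x) (sigma x) <= beta ^+ 2 * w ^+ 2 * dot (Du x) (Du x)}.

Let sigmaDu_ge0 : {ae leb, forall x, Omega x -> 0 <= dot (sigma x) (Du x)}.
Proof.
apply: filterS structure_sigma => x + Ox => /(_ Ox)[+ _]; apply: le_trans.
by rewrite !mulr_ge0 ?dot_ge0 ?invr_ge0 ?powR_ge0// ltW.
Qed.

Let sigmaDu_intg C H dH zeta : truncation N C H dH -> cutoff zeta ->
  intg (fun x => dot (sigma x) (Du x) * (dH (u x) * (1 - zeta x))).
Proof.
move=> trH cz; apply: (intgM_bounded mO (C := C)); first exact: dot_intg.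
  by apply: measurable_funM (truncation_dmeasurable trH u2.1) _; exact: mcut.
move=> x _; have [_ _ _ /(_ (u x))[_ dC _]] := trH.
by rewrite normrM -[leRHS]mulr1 ler_pM//; exact: cutoff_le.
Qed.

Let uH_intg C H dH zeta : truncation N C H dH -> (forall s, `|H s| <= 1) ->
  cutoff zeta -> intg (fun x => u x * (H (u x) * (1 - zeta x))).
Proof.
move=> trH H1 cz; apply: (intgM_bounded mO (C := 1)).
- exact: (sqintg_intg mO Ofin u2).
- by apply: measurable_funM (truncation_measurable trH u2.1) _; exact: mcut.
- by move=> x _; rewrite normrM -[leRHS]mulr1 ler_pM//; exact: cutoff_le.
Qed.

(** Test with H(u)(1 - zeta), for H with H'(s) of the order of
    (1 + |s|)^(-gamma); here gamma > 1 is used, since H has to be bounded. *)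
Lemma flux_estimate zeta : cutoff zeta ->
  coercivity * Rint (fun x => dot (sigma x) (sigma x) * (1 - zeta x)) <=
  load f sigma zeta.
Proof.
move=> cz; have trH := powtrunc_truncation gamma_gt1 N.
have H1 := powtrunc_le1 gamma_gt1.
apply: le_trans (energy_estimate trH H1 cz).
have s2 : intg (fun x => dot (sigma x) (sigma x) * (1 - zeta x)).
  apply: (intgM_bounded mO (C := 1)); [exact: dot_intg|exact: mcut|].
  by move=> x _; exact: cutoff_le.
rewrite -RintegralZl//; rewrite -[leLHS]addr0; apply: lerD; last first.
  apply: Rintegral_ge0 => x _; rewrite mulrA; apply: mulr_ge0.
    exact: (truncation_sign trH).
  by have [_ /(_ x)/andP[z0 z1]] := cz; rewrite subr_ge0.
apply: (ae_eq_Rintegral_le mO); [exact: (intgZ mO)|exact: (sigmaDu_intg trH cz)|].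
apply: filterS structure_sigma => x + Ox => /(_ Ox)[h1 h2].
set w := _^-1 in h1 h2; rewrite !mulrA; apply: ler_wpM2r.
  by have [_ /(_ x)/andP[z0 z1]] := cz; rewrite subr_ge0.
have w0 : 0 <= w by rewrite invr_ge0 powR_ge0.
have D0 := dot_ge0 (Du x).
have g0 : 0 < 1 - gamma^-1 by rewrite subr_gt0 invf_lt1// (lt_trans _ gamma_gt1).
apply: (@le_trans _ _ ((alpha * w * dot (Du x) (Du x)) * ((1 - gamma^-1) * w))).
  have -> : alpha * w * dot (Du x) (Du x) * ((1 - gamma^-1) * w) =
      coercivity * (beta ^+ 2 * w ^+ 2 * dot (Du x) (Du x)).
    by rewrite /coercivity; move: (1 - gamma^-1) => g; field; rewrite gt_eqF.
  by rewrite ler_wpM2l// ltW// coercivity_gt0.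
apply: ler_pM => //; first by rewrite !mulr_ge0// ltW.
  by rewrite mulr_ge0// ltW.
exact: dpowtrunc_ge.
Qed.

(** Test with H(u)(1 - zeta), for smooth approximations H of the sign. *)
Lemma mass_estimate zeta : cutoff zeta ->
  Rint (fun x => `|u x| * (1 - zeta x)) <= load f sigma zeta.
Proof.
move=> cz; set K := load _ _ _.
have uz : intg (fun x => `|u x| * (1 - zeta x)).
  apply: (intgM_bounded mO (C := 1)); last by move=> x _; exact: cutoff_le.
    exact/intg_norm/(sqintg_intg mO Ofin u2).
  exact: mcut.
apply/ler_addgt0Pr => e e0.
pose V := fine (leb Omega).
have V0 : 0 <= V by exact: fine_ge0.
pose M := 1 + V / e.
have M1 : 1 <= M by rewrite lerDl divr_ge0// ltW.
have M0 : 0 < M by exact: lt_le_trans M1.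
have trH := soft_sgn_truncation N M1.
have H1 s : `|soft_sgn M s| <= 1 by exact: soft_sign1_le1.
have uH := uH_intg trH H1 cz.
have : Rint (fun x => `|u x| * (1 - zeta x)) <=
    Rint (fun x => u x * (soft_sgn M (u x) * (1 - zeta x)) + M^-1).
  apply: le_Rintegral => //.
    by apply: (intgD mO uH); exact: intg_cst.
  move=> x _; have [_ /(_ x)/andP[z0 z1]] := cz.
  have := soft_sgn_ge (u x) M0; rewrite mulrA.
  have MV : 0 < M^-1 by rewrite invr_gt0.
  have := normr_ge0 (u x); nra.
rewrite RintegralD//; last exact: intg_cst.
rewrite Rintegral_cst// -/V => /le_trans; apply.
have := energy_estimate trH H1 cz; rewrite -/K.
have : 0 <= Rint (fun x => dot (sigma x) (Du x) * (dsoft_sgn M (u x) * (1 - zeta x))).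
  rewrite -[leLHS](mul0r V) -Rintegral_cst//.
  apply: (ae_eq_Rintegral_le mO); [exact: intg_cst|exact: (sigmaDu_intg trH cz)|].
  apply: filterS sigmaDu_ge0 => x + Ox => /(_ Ox) s0.
  have [_ /(_ x)/andP[z0 z1]] := cz.
  have [_ _ _ /(_ (u x))[_ _ d0]] := trH.
  by apply: mulr_ge0 => //; apply: mulr_ge0 => //; rewrite subr_ge0.
have : M^-1 * V <= e.
  rewrite mulrC ler_pdivrMr// /M mulrDr mulr1 mulrCA divff ?gt_eqF// mulr1.
  by rewrite lerDr ltW.
by move=> h1 h2 h3; lra.
Qed.

End one_solution.

Lemma Lpoo_intg f : Lp Omega +oo%E f -> intg f.
Proof.
move=> /(Lpoo_bounded oO)[mf [C C0 fC]].
by apply: (ae_intg_le mO mf _ fC); exact: (intg_cst mO Ofin C).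
Qed.

(** The flux of a weak solution is measurable only for the completed
    sigma-algebra. It is replaced by a Borel version, which has the same
    integrals and inherits the bounds of the vector field a. *)
Lemma weak_solution_flux f u : weak_solution Omega a gamma f u ->
  exists (Du sigma : E -> E), [/\ H10 Omega u Du,
    forall i, sqintg (fun x => sigma x 0 i),
    forall phi Dphi, H10 Omega phi Dphi ->
      Rint (fun x => dot (sigma x) (Dphi x)) + Rint (fun x => u x * phi x) =
      Rint (fun x => f x * phi x) &
    {ae leb, forall x, Omega x ->
      let w := ((1 + `|u x|) `^ gamma)^-1 in
      alpha * w * dot (Du x) (Du x) <= dot (sigma x) (Du x) /\
      dot (sigma x) (sigma x) <= beta ^+ 2 * w ^+ 2 * dot (Du x) (Du x)}].
Proof.
move=> [Du [H10u _ weak]].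
have [u2 Du2] := H10_sqintg oO H10u.
have [b mb ab] := caratheodory_borel mO caratheodory_a (fun i => (Du2 i).1).
pose w x := ((1 + `|u x|) `^ gamma)^-1.
have mw : measurable_fun Omega w.
  have -> : w = fun x => (1 + `|u x|) `^ (- gamma) by apply/funext => x; rewrite powRN.
  apply: (measurableT_comp (measurable_powR _)).
  by apply: measurable_funD => //; apply: measurableT_comp => //; exact: u2.1.
pose sigma x := w x *: b x.
have fluxE : {ae leb, forall x, Omega x -> flux a gamma u Du x = sigma x}.
  by apply: filterS ab => x abx Ox; rewrite /flux /sigma abx.
have bound : {ae leb, forall x, Omega x ->
    alpha * w x * dot (Du x) (Du x) <= dot (sigma x) (Du x) /\
    dot (sigma x) (sigma x) <= beta ^+ 2 * w x ^+ 2 * dot (Du x) (Du x)}.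
  apply: filterS2 ab structure_a => x abx sx Ox.
  have [s1 s2 _] := sx Ox; rewrite /sigma -(abx Ox) !dotZl dotZr.
  have w0 : 0 <= w x by rewrite invr_ge0 powR_ge0.
  split.
    by rewrite -enorm_sqr mulrAC [leRHS]mulrC ler_wpM2r.
  have : enorm (a x (Du x)) ^+ 2 <= (beta * enorm (Du x)) ^+ 2.
    by rewrite ler_pXn2r ?nnegrE ?sqrtr_ge0// mulr_ge0 ?sqrtr_ge0// ltW.
  rewrite exprMn !enorm_sqr => h.
  rewrite mulrA -expr2 mulrC [leRHS]mulrAC.
  by rewrite ler_wpM2r ?sqr_ge0.
have ms i : measurable_fun Omega (fun x => sigma x 0 i).
  have -> : (fun x => sigma x 0 i) = (fun x => w x * b x 0 i).
    by apply/funext => x; rewrite mxE.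
  exact: measurable_funM mw (mb i).
exists Du, sigma; split=> //.
- move=> i; split => //.
  apply: (ae_intg_le mO (g := fun x => beta ^+ 2 * dot (Du x) (Du x))).
  + exact: measurable_funX.
  + by apply: (intgZ mO); exact: dot_intg.
  + apply: filterS bound => x + Ox => /(_ Ox)[_ h].
    rewrite ger0_norm ?sqr_ge0//; apply: (le_trans (sqr_coord_dot _ _)).
    apply: (le_trans h); rewrite ler_wpM2r ?dot_ge0// -[leRHS]mulr1 ler_wpM2l ?sqr_ge0//.
    have p1 : 1 <= (1 + `|u x|) `^ gamma.
      rewrite -[leLHS](powRr0 (1 + `|u x|)) ler_powR ?lerDl//.
      by rewrite ltW// (lt_trans _ gamma_gt1).
    have p0 : 0 < (1 + `|u x|) `^ gamma by exact: lt_le_trans p1.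
    by apply: exprn_ile1; [rewrite invr_ge0 ltW|rewrite invf_le1].
- move=> phi Dphi Hphi; rewrite -(weak _ _ Hphi); congr (_ + _).
  apply: ae_eq_nonmeasurable_Rintegral; apply: filterS fluxE => x h Ox.
  by rewrite h.
Qed.

End estimates.

(** * Cut-off functions of small energy *)

Section capacity.
Context {R : realType} {N : nat}.
Local Notation E := 'rV[R]_N.
Local Notation leb := (lebesgue_rV N : {measure set E -> \bar R}).

(** Exhaust U by the compact sets of the points of norm at most n whose distance
    to the complement of U is at least 1 / (n + 1). *)
Lemma open_inner_regular (mu : {finite_measure set E -> \bar R}) (U : set E)
    (e : R) : open U -> 0 < e ->
  exists2 K : set E, compact K /\ K `<=` U & (mu (U `\` K) <= e%:E)%E.
Proof.
move=> oU e0.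
pose K (n : nat) : set E := [set x | `|x| <= n%:R] `&`
  \bigcap_(y in ~` U) [set x | n.+1%:R^-1 <= `|x - y|].
have clK n : closed (K n).
  apply: closedI.
    apply: (preimage_closed (f := fun x : E => `|x|) (D := [set y | y <= n%:R])).
      by move=> x _; exact: norm_continuous.
    exact: closed_le.
  apply: closed_bigI => y _.
  apply: (preimage_closed (f := fun x : E => `|x - y|) (D := [set z | n.+1%:R^-1 <= z])).
    move=> x _; have c1 : {for x, continuous (fun x : E => x - y)}.
      by apply: (@cvgB R E E (nbhs x) _ id (cst y) x y); [exact: cvg_id|exact: cvg_cst].
    exact: (@cvg_comp _ _ _ (fun x : E => x - y) (fun z : E => `|z|) _ _ _ c1
      (@norm_continuous R E (x - y))).
  exact: closed_ge.
have cK n : compact (K n).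
  apply: bounded_closed_compact => //.
  exists n%:R; split; first exact: num_real.
  by move=> y ny x [xn _]; exact: le_trans xn (ltW ny).
have KU n : K n `<=` U.
  move=> x [_ xU]; apply: contrapT => Ux; have := xU x Ux.
  by rewrite /= subrr normr0 leNgt invr_gt0 ltr0n.
have mK n : measurable (K n) by exact: closed_measurable_mx.
have mU : measurable U by exact: open_measurable_mx.
have ndK : nondecreasing_seq K.
  move=> m n mn; apply/subsetPset => x [xm xU]; split.
    by apply: (le_trans xm); rewrite ler_nat.
  move=> y yU; apply: le_trans (xU y yU).
  by rewrite lef_pV2 ?posrE ?ltr0n// ler_nat ltnS.
have UK : \bigcup_n K n = U.
  apply/seteqP; split=> [x [n _ /KU]//|x Ux].
  have /nbhs_ballP[r /= r0 rU] : nbhs x U by exact: open_nbhs_nbhs.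
  pose n := maxn (Num.bound `|x|) (Num.bound r^-1).
  exists n => //; split.
    apply: (le_trans (ltW (archi_boundP (normr_ge0 x)))).
    by rewrite ler_nat leq_maxl.
  move=> y yU /=; rewrite leNgt; apply/negP => xy; apply: yU; apply: rU.
  rewrite -ball_normE /=; apply: (lt_trans xy).
  rewrite -[ltRHS]invrK ltf_pV2 ?posrE ?invr_gt0 ?ltr0n//.
  apply: (lt_le_trans (archi_boundP _)); first by rewrite invr_ge0 ltW.
  by rewrite ler_nat (leq_trans (leq_maxr (Num.bound `|x|) _))// leqnSn.
have := @nondecreasing_cvg_mu _ _ _ mu K mK; rewrite UK => /(_ mU ndK) Kcvg.
have fin S : measurable S -> mu S \is a fin_num by exact: fin_num_measure.
have /fine_cvgP[_ /cvgrPdist_le/(_ e e0)[n _ nP]] : (mu (K n) @[n --> \oo] --> (fine (mu U))%:E)%E.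
  by rewrite fineK ?fin.
exists (K n); first by split.
have := nP n (leqnn n) => /=.
rewrite measureD//; last by rewrite ltey_eq fin.
rewrite (setIidr (KU n)).
rewrite -[X in (X - _)%E]fineK ?fin// -[X in (_ - X)%E]fineK ?fin// -EFinB lee_fin.
by apply: le_trans; exact: ler_norm.
Qed.

Variable Omega : set E.
Hypotheses (oO : open Omega) (bO : bounded_set Omega).

Local Notation Rint := (Rintegral leb Omega).
Let mO : measurable Omega := open_measurable_Omega oO.
Let Ofin := Omega_lty oO bO.

(** In both definitions by approximation, the extremal values are replaced by
    nearly extremal competitors: an open set around A, a compact set inside it
    that carries nearly all of mu, and a test function of small energy. *)
Lemma capacity0_test (A : set E) (mu : {finite_measure set E -> \bar R}) (e : R) :
  capacity Omega A = 0%E -> concentrated_on Omega mu A -> 0 < e ->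
  exists2 psi, Cc_infty Omega psi /\
    Rint (fun x => dot (grad psi x) (grad psi x)) <= e &
    exists K : set E, [/\ measurable K, forall x, K x -> 1 <= psi x &
      (mu (Omega `\` K) <= e%:E)%E].
Proof.
move=> cA [mA muA] e0.
have : (ereal_inf [set capacity_open Omega U | U in
    [set U | [/\ open U, A `<=` U & U `<=` Omega]]] < e%:E)%E.
  by rewrite -/(capacity Omega A) cA lte_fin.
move=> /ereal_inf_lt[_ /= [U [oU AU UO] <-] cU].
have [K [cK KU] muK] := open_inner_regular mu oU e0.
have : (capacity_compact Omega K < e%:E)%E.
  by apply: le_lt_trans cU; apply: ereal_sup_ubound; exists K.
move=> /ereal_inf_lt[_ /= [psi [Cpsi psiK] <-] epsi].
have g2 i : sqintg leb Omega (fun x => grad psi x 0 i).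
  have := Cc_sqintg oO bO (Cc_infty_partial i Cpsi).
  by congr sqintg; apply/funext => x; rewrite mxE.
exists psi.
  split => //; rewrite -lee_fin /Rintegral fineK.
    apply: ltW; move: epsi; congr (_ < _)%E.
    by apply: eq_integral => x _; rewrite enorm_sqr.
  exact: (integrable_fin_num mO (dot_intg oO g2 g2)).
have mK : measurable K.
  by apply: closed_measurable_mx; apply: compact_closed cK; exact: norm_hausdorff.
exists K; split => //; apply: le_trans muK.
have mU : measurable U by exact: open_measurable_mx.
rewrite muA; [|exact: measurableD|exact: subDsetl].
apply: le_measure; rewrite ?inE.
- by apply: measurableI => //; exact: measurableD.
- exact: measurableD.
- by move=> x [[_ nK] /AU].
Qed.

(** The capacity only provides test functions psi that are at least 1 on most
    of the support of mu; their values are brought into [0, 1] by applying a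
    steep sigmoid, which multiplies the small energy by a fixed constant. *)
Lemma capacity_cutoff (A : set E) (mu : {finite_measure set E -> \bar R}) (e : R) :
  (0 < N)%N -> capacity Omega A = 0%E -> concentrated_on Omega mu A -> 0 < e ->
  exists zeta, [/\ cutoff Omega zeta,
    Rint (fun x => dot (grad zeta x) (grad zeta x)) <= e,
    Rint zeta <= e & Rintegral mu Omega (fun x => 1 - zeta x) <= e].
Proof.
move=> N0 cA muA e0.
pose i0 : 'I_N := Ordinal N0.
have [B xB] := continuous_bounded_on bO (smooth_continuous (smooth_coord (R := R) i0)).
pose V := fine (mu Omega).
have V0 : 0 <= V by exact: fine_ge0.
(* M makes 1 - zeta small where psi >= 1: it is at most 1 / M^2 there. *)
pose M := 1 + 2 * V / e.
have M1 : 1 <= M by rewrite lerDl divr_ge0 ?mulr_ge0// ltW.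
have M0 : 0 < M by exact: lt_le_trans M1.
(* c absorbs the factor 4 M^2 of the energy and the factor 4 M^2 B^2 of the
   Poincare inequality, and leaves half of e for the measure mu. *)
pose c := 2 + 4 * M ^+ 2 * (1 + B ^+ 2).
have c0 : 0 < c.
  have M20 := sqr_ge0 M; have B20 := sqr_ge0 B; have := mulr_ge0 M20 B20.
  by rewrite /c; nra.
have [psi [Cpsi psie] [K [mK psiK muK]]] := capacity0_test cA muA (divr_gt0 e0 c0).
have [spsi _ _] := Cpsi.
have trM := soft_sgn_truncation N M1.
have [sT dT T0 bT] := trM.
pose v := soft_sgn M \o psi.
have sv : smooth v by exact: sT.
pose zeta := v \* v.
have szeta : smooth zeta by exact: smoothM.
have Cz : Cc_infty Omega zeta.
  by apply: Cc_infty_sub Cpsi szeta _ => x px; rewrite /zeta /v /= px T0 mul0r.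
have v1 x : v x ^+ 2 <= 1.
  by rewrite -(real_normK (num_real (v x))) exprn_ile1//; exact: soft_sign1_le1.
have cz : cutoff Omega zeta.
  by split=> // x; rewrite /zeta /= -expr2 sqr_ge0 v1.
have q1 x : v x ^+ 2 <= (M * psi x) ^+ 2 /\ (1 <= psi x -> 1 - v x ^+ 2 <= (M ^+ 2)^-1).
  rewrite /v /= /soft_sgn /soft_sign.
  have := powR_Nhalf_sqr (M * psi x); set w := _ `^ _; set y := M * psi x => yw.
  split; first by have := sqr_ge0 w; rewrite exprMn; nra.
  move=> p1; have My : M ^+ 2 <= y ^+ 2.
    by rewrite ler_pXn2r ?nnegrE ?mulr_ge0 ?(le_trans ler01 p1)// ?ler_peMr// ltW.
  have -> : 1 - (y * w) ^+ 2 = w ^+ 2 by rewrite exprMn -yw; ring.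
  rewrite -(ler_pM2l (exprn_gt0 2 M0)) divff ?gt_eqF ?exprn_gt0//.
  by have := sqr_ge0 w; nra.
have g2 f i : Cc_infty Omega f -> sqintg leb Omega (fun x => grad f x 0 i).
  move=> Cf; have := Cc_sqintg oO bO (Cc_infty_partial i Cf).
  by congr sqintg; apply/funext => x; rewrite mxE.
have ig f : Cc_infty Omega f -> intg leb Omega (fun x => dot (grad f x) (grad f x)).
  by move=> Cf; apply: (dot_intg oO) => i; exact: g2.
have ce : e / c * c = e by rewrite mulrVK// unitfE gt_eqF.
have ec0 : 0 < e / c by exact: divr_gt0.
have M20 := sqr_ge0 M; have B20 := sqr_ge0 B.
exists zeta; split=> //.
- apply: (@le_trans _ _ (4 * M ^+ 2 * Rint (fun x => dot (grad psi x) (grad psi x)))).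
    rewrite -RintegralZl//; last exact: ig.
    apply: le_Rintegral => //; [exact: ig|by apply: (intgZ mO); exact: ig|].
    move=> x _; rewrite /dot mulr_sumr; apply: ler_sum => i _; rewrite !mxE -!expr2.
    rewrite (partialM i x sv sv) (partial_comp i spsi (dT (psi x)).1).
    have [_ d1 d0] := bT (psi x); rewrite ger0_norm// in d1.
    set d := dsoft_sgn M _ in d0 d1 *; set p := partial i psi x.
    have -> : (v x * (d * p) + v x * (d * p)) ^+ 2 = 4 * (v x ^+ 2 * d ^+ 2) * p ^+ 2 by ring.
    rewrite ler_wpM2r ?sqr_ge0// ler_wpM2l// -[leRHS]mul1r.
    by rewrite ler_pM ?sqr_ge0// ler_pXn2r ?nnegrE// ltW.
  apply: (@le_trans _ _ (4 * M ^+ 2 * (e / c))).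
    by rewrite ler_wpM2l// mulr_ge0.
  rewrite -[leRHS]ce mulrC ler_wpM2l ?(ltW ec0)// /c.
  by have := mulr_ge0 M20 B20; nra.
- apply: (@le_trans _ _ (Rint (fun x => M ^+ 2 * psi x ^+ 2))).
    apply: le_Rintegral => //.
    + exact: Cc_intg Cz.
    + by apply: (intgZ mO); case: (Cc_sqintg oO bO Cpsi).
    + by move=> x _; rewrite /zeta /= -expr2 -exprMn; case: (q1 x).
  rewrite RintegralZl//; last by case: (Cc_sqintg oO bO Cpsi).
  have P := poincare mO xB Cpsi.
  have : Rint (fun x => partial i0 psi x ^+ 2) <= e / c.
    apply: le_trans psie; apply: le_Rintegral => //; [|exact: ig|].
      by case: (Cc_sqintg oO bO (Cc_infty_partial i0 Cpsi)).
    move=> x _; apply: le_trans (sqr_coord_dot (grad psi x) i0).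
    by rewrite mxE.
  move: P; set I := Rint _; set J := Rint _ => P Je.
  apply: (@le_trans _ _ (M ^+ 2 * (4 * B ^+ 2 * (e / c)))).
    rewrite ler_wpM2l//; apply: (le_trans P).
    by rewrite ler_wpM2l// mulr_ge0.
  rewrite -[leRHS]ce mulrA mulrC ler_wpM2l ?(ltW ec0)// /c.
  by have := mulr_ge0 M20 B20; nra.
- have mz : measurable_fun Omega (fun x => 1 - zeta x).
    by apply: measurable_funB => //; exact: smooth_measurable.
  have muO : (mu Omega < +oo)%E by rewrite ltey_eq fin_num_measure.
  have mOK : measurable (Omega `\` K) by exact: measurableD.
  have i1 : intg mu Omega (cst (M ^+ 2)^-1) by exact: (intg_cst mO muO).
  have i2 : intg mu Omega \1_(Omega `\` K).
    apply: (intg_bounded mO (C := 1) muO) => //.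
    by move=> x _; rewrite indicE; case: (_ \in _); rewrite ?normr1 ?normr0.
  apply: (@le_trans _ _ (Rintegral mu Omega (fun x => (M ^+ 2)^-1 + \1_(Omega `\` K) x))).
    apply: le_Rintegral => //.
    + apply: (intg_bounded mO (C := 1) muO) => // x _.
      by have [_ /(_ x)/andP[z0 z1]] := cz; rewrite ler_norml; apply/andP; split; lra.
    + exact: (intgD mO i1 i2).
    + move=> x Ox; rewrite /zeta /= -expr2 indicE.
      have M2V : 0 <= (M ^+ 2)^-1 by rewrite invr_ge0.
      case: (pselect (K x)) => [Kx|nKx].
        rewrite memNset; last by move=> [_]; apply.
        by rewrite addr0; exact: ((q1 x).2 (psiK x Kx)).
      rewrite mem_set; last by split.
      by have := sqr_ge0 (v x); rewrite /=; lra.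
  rewrite RintegralD// Rintegral_cst// -/V.
  have : Rintegral mu Omega \1_(Omega `\` K) <= e / c.
    rewrite /Rintegral integral_indic// setIidl; last exact: subDsetl.
    by rewrite -lee_fin fineK ?fin_num_measure.
  have : e / c <= e / 2.
    rewrite ler_wpM2l ?(ltW e0)// lef_pV2 ?posrE// /c lerDl.
    by have := mulr_ge0 M20 B20; nra.
  have : (M ^+ 2)^-1 * V <= e / 2.
    rewrite mulrC ler_pdivrMr ?exprn_gt0//.
    have Ve : 2 * V / e * e = 2 * V by rewrite mulrVK// unitfE gt_eqF.
    have t0 : 0 <= 2 * V / e by rewrite divr_ge0 ?mulr_ge0// ltW.
    have : V <= e / 2 * M by rewrite /M; move: (2 * V / e) t0 Ve => t t0 Ve; lra.
    move=> h; apply: (le_trans h); rewrite ler_wpM2l ?divr_ge0 ?(ltW e0)//.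
    by rewrite expr2 ler_peMl// ltW.
  by lra.
Qed.

End capacity.

(** * Uniform approximation by smooth functions *)

Section smooth_approximation.
Context {R : realType} {N : nat}.
Local Notation E := 'rV[R]_N.
Implicit Types (x y : E).

Definition sqdist x y : R := \sum_(i < N) (y 0 i - x 0 i) ^+ 2.

Lemma smooth_sqdist x : smooth (sqdist x).
Proof.
apply: smooth_sum => i; apply: smoothX.
exact: (smoothB (smooth_coord i) (smooth_cst (x 0 i))).
Qed.

Lemma sqdist_ge0 x y : 0 <= sqdist x y.
Proof. by apply: sumr_ge0 => i _; exact: sqr_ge0. Qed.

Lemma norm_lt_sqdist x y (r : R) : 0 < r -> sqdist x y < r ^+ 2 -> `|x - y| < r.
Proof.
move=> r0 xyr; rewrite -[ltLHS]/(mx_norm (x - y)) mx_normrE.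
apply: bigmax_lt => // -[i j] _; rewrite ord1 !mxE/= distrC.
rewrite -ltr_sqr ?nnegrE ?(ltW r0)// real_normK ?num_real//.
apply: le_lt_trans xyr; rewrite /sqdist (bigD1 j)//= lerDl.
by apply: sumr_ge0 => k _; exact: sqr_ge0.
Qed.

(** For large m, this is nearly 1 if sqdist x y < rho / 2 and nearly 0 if
    sqdist x y >= rho. *)
Definition bump (m : nat) x (rho : R) y : R :=
  (1 + (3 / 2 * (sqdist x y / rho)) ^+ m)^-1.

Let bump_arg_ge0 x (rho : R) y : 0 < rho -> 0 <= 3 / 2 * (sqdist x y / rho).
Proof. by move=> r0; rewrite mulr_ge0// divr_ge0 ?sqdist_ge0// ltW. Qed.

Lemma bump_gt0 m x (rho : R) y : 0 < rho -> 0 < bump m x rho y.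
Proof.
by move=> r0; rewrite invr_gt0 ltr_pwDl// exprn_ge0// bump_arg_ge0.
Qed.

Lemma smooth_bump m x (rho : R) : 0 < rho -> smooth (bump m x rho).
Proof.
move=> r0; apply: smoothV => [y|].
  by rewrite ltr_pwDl// exprn_ge0// bump_arg_ge0.
apply: (smoothD (smooth_cst 1)); apply: smoothX.
apply: (smoothM (smooth_cst (3 / 2))).
exact: (smoothM (smooth_sqdist x) (smooth_cst rho^-1)).
Qed.

Lemma bump_near m x (rho : R) y : 0 < rho -> sqdist x y < rho / 2 ->
  2^-1 <= bump m x rho y.
Proof.
move=> r0 xy; rewrite /bump lef_pV2 ?posrE//; last first.
  by rewrite ltr_pwDl// exprn_ge0// bump_arg_ge0.
suff : (3 / 2 * (sqdist x y / rho)) ^+ m <= 1 by lra.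
rewrite exprn_ile1 ?bump_arg_ge0//.
have : sqdist x y / rho <= 1 / 2 by rewrite ler_pdivrMr//; lra.
lra.
Qed.

Lemma bump_far m x (rho : R) y : 0 < rho -> rho <= sqdist x y ->
  bump m x rho y <= (2 / 3) ^+ m.
Proof.
move=> r0 xy; have -> : (2 / 3 : R) = (3 / 2)^-1 by field.
rewrite exprVn /bump lef_pV2 ?posrE ?exprn_gt0//; last first.
  by rewrite ltr_pwDl// exprn_ge0// bump_arg_ge0.
apply: (@le_trans _ _ ((3 / 2 * (sqdist x y / rho)) ^+ m)); last by rewrite lerDr.
rewrite lerXn2r ?nnegrE ?bump_arg_ge0//.
by rewrite -[leLHS]mulr1 ler_wpM2l// ler_pdivlMr// mul1r.
Qed.

(** A weighted mean of finitely many values of phi, with weights that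
    concentrate on the points close to the argument. *)
Lemma smooth_approximation (K : set E) (phi : E -> R) (e : R) :
  compact K -> {within K, continuous phi} -> 0 < e ->
  exists2 P, smooth P & forall y, K y -> `|P y - phi y| <= e.
Proof.
move=> cK cphi e0.
have [C phiC] := compact_continuous_bounded cK cphi.
have e20 : 0 < e / 2 by rewrite divr_gt0.
have /choice[rho rhoP] (x : E) : exists rho : R, 0 < rho /\ (K x ->
    forall y, K y -> sqdist x y < rho -> `|phi x - phi y| <= e / 2).
  have [Kx|nKx] := pselect (K x); last by exists 1.
  have /cvgrPdist_le/(_ _ e20) : phi y @[y --> within K (nbhs x)] --> phi x.
    by have := cphi x; rewrite /continuous_at nbhs_subspace_in.
  move=> /nbhs_ballP[r /= r0 rP]; exists (r ^+ 2).
  split=> [|_ y Ky xy]; first by rewrite exprn_gt0.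
  by apply: rP => //; rewrite -ball_normE; exact: norm_lt_sqdist.
pose U x := [set y | sqdist x y < rho x / 2].
have oU x : K x -> open (U x).
  move=> _; apply: (open_comp (f := sqdist x) (D := [set t | t < rho x / 2])).
    by move=> y _; exact: (smooth_continuous (smooth_sqdist x)).
  exact: open_lt.
have KU : K `<=` \bigcup_(x in K) U x.
  move=> x Kx; exists x => //=.
  rewrite /U /= /sqdist big1 ?divr_gt0//; first by case: (rhoP x).
  by move=> i _; rewrite subrr expr0n.
have [D [DK KD]] : exists D : seq E, (forall x, x \in D -> K x) /\
    forall y, K y -> exists2 x, x \in D & U x y.
  have := cK; rewrite compact_cover => /(_ _ K U oU KU)[D DK KD].
  exists (finmap.enum_fset D); split=> [x xD|y /KD[x xD Uxy]]; last by exists x.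
  by apply/set_mem/DK.
case: (pselect (exists z, z \in D)) => [[z zD]|nD]; last first.
  exists (cst 0); first exact: smooth_cst.
  by move=> y /KD[x xD]; case: nD; exists x.
pose J : R := \sum_(x <- D) 1.
have J0 : 0 <= J by apply: sumr_ge0.
have [m mP] : exists m, 4 * C * J * (2 / 3) ^+ m <= e / 2.
  have c0 : geometric (4 * C * J) (2 / 3) k @[k --> \oo] --> (0 : R).
    by apply: cvg_geometric; rewrite ger0_norm; lra.
  have /cvgrPdist_le/(_ _ e20)[m _ mP] := c0.
  exists m; have := mP m (leqnn m); rewrite sub0r normrN /=.
  by apply: le_trans; exact: ler_norm.
pose S y := \sum_(x <- D) bump m x (rho x) y.
have S0 y : 0 < S y.
  rewrite /S (big_rem z zD)/= ltr_pwDl ?bump_gt0//; first by case: (rhoP z).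
  by apply: sumr_ge0 => x _; rewrite ltW// bump_gt0//; case: (rhoP x).
have sS : smooth S by apply: smooth_sum => x; apply: smooth_bump; case: (rhoP x).
exists (fun y => (\sum_(x <- D) phi x * bump m x (rho x) y) * (S y)^-1).
  apply: smoothM; last exact: smoothV.
  apply: smooth_sum => x; apply: (smoothM (smooth_cst (phi x))).
  by apply: smooth_bump; case: (rhoP x).
move=> y Ky.
have S2 : 2^-1 <= S y.
  have [x xD Uxy] := KD y Ky.
  rewrite /S (big_rem x xD)/=; apply: le_trans (_ : bump m x (rho x) y <= _).
    by apply: bump_near; [case: (rhoP x)|exact: Uxy].
  by rewrite lerDl; apply: sumr_ge0 => x' _; rewrite ltW// bump_gt0//; case: (rhoP x').
have -> : (\sum_(x <- D) phi x * bump m x (rho x) y) * (S y)^-1 - phi y =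
    (\sum_(x <- D) (phi x - phi y) * bump m x (rho x) y) * (S y)^-1.
  have -> : \sum_(x <- D) (phi x - phi y) * bump m x (rho x) y =
      \sum_(x <- D) phi x * bump m x (rho x) y - phi y * S y.
    by rewrite /S mulr_sumr -sumrB; apply: eq_bigr => x _; rewrite mulrBl.
  by rewrite mulrBl mulfK// gt_eqF.
rewrite normrM normfV (gtr0_norm (S0 y)) ler_pdivrMr//.
apply: (@le_trans _ _ (\sum_(x <- D) (e / 2 * bump m x (rho x) y + 2 * C * (2 / 3) ^+ m))).
  apply: (le_trans (ler_norm_sum _ _ _)); rewrite big_seq [leRHS]big_seq.
  apply: ler_sum => x xD; have [r0 rP] := rhoP x.
  have Kx := DK x xD.
  have b0 := bump_gt0 m x y r0.
  rewrite normrM (gtr0_norm b0).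
  have C0 : 0 <= C by rewrite (le_trans _ (phiC x Kx)).
  have [xy|xy] := ltP (sqdist x y) (rho x).
    apply: (@le_trans _ _ (e / 2 * bump m x (rho x) y)).
      by rewrite ler_wpM2r ?(ltW b0)// rP.
    by rewrite lerDl !mulr_ge0// exprn_ge0// divr_ge0.
  apply: (@le_trans _ _ (2 * C * (2 / 3) ^+ m)).
    apply: ler_pM => //; first exact: ltW.
      by rewrite mulr_natl mulr2n (le_trans (ler_normB _ _))// lerD// phiC.
    exact: bump_far.
  by rewrite lerDr mulr_ge0// ltW.
rewrite big_split/= -mulr_sumr -/(S y).
have -> : \sum_(x <- D) 2 * C * (2 / 3) ^+ m = 2 * C * J * (2 / 3) ^+ m.
  by rewrite /J [RHS]mulrAC mulr_sumr; apply: eq_bigr => x _; rewrite mulr1.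
have : 4 * C * J * (2 / 3) ^+ m * (1 / 2) <= e / 2 * S y.
  apply: (@le_trans _ _ (e / 2 * (1 / 2))); first by rewrite ler_wpM2r.
  by rewrite ler_wpM2l ?(ltW e20)//; lra.
move: (2 / 3) => q; lra.
Qed.

End smooth_approximation.

(** * Concentration of the solutions *)

Section concentration.
Context {R : realType} {N : nat}.
Local Notation E := 'rV[R]_N.
Local Notation leb := (lebesgue_rV N : {measure set E -> \bar R}).
Variable Omega : set E.
Hypotheses (oO : open Omega) (bO : bounded_set Omega).
Variables (a : E -> E -> E) (alpha beta gamma : R).
Hypotheses (alpha_gt0 : 0 < alpha) (beta_gt0 : 0 < beta) (gamma_gt1 : 1 < gamma).
Hypotheses (caratheodory_a : caratheodory_fun Omega a)
  (structure_a : leray_lions Omega a alpha beta).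
Variables (mu : {finite_measure set E -> \bar R}) (A : set E).
Hypotheses (N_gt0 : (0 < N)%N) (mu_A : concentrated_on Omega mu A)
  (capacity_A : capacity Omega A = 0%E).

Local Notation Rint := (Rintegral leb Omega).
Local Notation Rmu := (Rintegral mu Omega).
Local Notation mintg := (intg mu Omega).
Local Notation intg := (intg leb Omega).
Local Notation sqintg := (sqintg leb Omega).
Let mO : measurable Omega := open_measurable_Omega oO.
Let Ofin := Omega_lty oO bO.
Let muOfin : (mu Omega < +oo)%E.
Proof. by rewrite ltey_eq fin_num_measure. Qed.

Lemma cutoff0 : cutoff Omega (cst 0).
Proof. by split; [exact: Cc_infty0|move=> x /=; rewrite lexx ler01]. Qed.

Lemma cutoff_onem zeta x : cutoff Omega zeta -> 0 <= 1 - zeta x <= 1.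
Proof. by move=> [_ /(_ x)/andP[z0 z1]]; apply/andP; split; lra. Qed.

Lemma grad_sqintg zeta i : Cc_infty Omega zeta -> sqintg (fun x => grad zeta x 0 i).
Proof.
move=> Cz; have := Cc_sqintg oO bO (Cc_infty_partial i Cz).
by congr sqintg; apply/funext => x; rewrite mxE.
Qed.

Lemma grad_bounded zeta : Cc_infty Omega zeta ->
  exists2 B, 0 <= B & forall x, dot (grad zeta x) (grad zeta x) <= B.
Proof.
move=> Cz.
have /choice[C CP] i : exists C : R, forall x, `|partial i zeta x| <= C.
  exact: Cc_infty_bounded (Cc_infty_partial i Cz).
exists (\sum_(i < N) C i ^+ 2); first by apply: sumr_ge0 => i _; exact: sqr_ge0.
move=> x; apply: ler_sum => i _; rewrite !mxE -expr2.
rewrite -(real_normK (num_real (partial i zeta x))).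
by rewrite ler_pXn2r ?nnegrE// (le_trans _ (CP i x)).
Qed.

Section one_sequence.
Variables (f u : nat -> E -> R) (Du sigma : nat -> E -> E).
Hypotheses (f_intg : forall n, intg (f n))
  (f_ge0 : forall n, {ae leb, forall x, Omega x -> 0 <= f n x})
  (f_mu : tight_cvg Omega f mu)
  (H10u : forall n, H10 Omega (u n) (Du n))
  (sigma2 : forall n i, sqintg (fun x => sigma n x 0 i))
  (weak : forall n phi Dphi, H10 Omega phi Dphi ->
    Rint (fun x => dot (sigma n x) (Dphi x)) + Rint (fun x => u n x * phi x) =
    Rint (fun x => f n x * phi x))
  (structure_sigma : forall n, {ae leb, forall x, Omega x ->
    let w := ((1 + `|u n x|) `^ gamma)^-1 in
    alpha * w * dot (Du n x) (Du n x) <= dot (sigma n x) (Du n x) /\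
    dot (sigma n x) (sigma n x) <= beta ^+ 2 * w ^+ 2 * dot (Du n x) (Du n x)}).

Let c := coercivity alpha beta gamma.
Let c_gt0 : 0 < c. Proof. exact: coercivity_gt0. Qed.

Let u_intg n : intg (u n).
Proof. by have [[] ] := H10_sqintg oO (H10u n) => m u2 _; exact: (sqintg_intg mO Ofin). Qed.

Let sigma_intg n : intg (fun x => dot (sigma n x) (sigma n x)).
Proof. exact: (dot_intg oO). Qed.

Let fluxE n zeta (cz : cutoff Omega zeta) :
  c * Rint (fun x => dot (sigma n x) (sigma n x) * (1 - zeta x)) <=
  load Omega (f n) (sigma n) zeta.
Proof.
exact: (flux_estimate oO bO alpha_gt0 beta_gt0 gamma_gt1 (f_intg n) (f_ge0 n) (H10u n) (sigma2 n)
  (@weak n) (structure_sigma n) cz).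
Qed.

Let massE n zeta (cz : cutoff Omega zeta) :
  Rint (fun x => `|u n x| * (1 - zeta x)) <= load Omega (f n) (sigma n) zeta.
Proof.
exact: (mass_estimate oO bO alpha_gt0 (f_intg n) (f_ge0 n) (H10u n) (sigma2 n)
  (@weak n) (structure_sigma n) cz).
Qed.

Lemma load0 n : load Omega (f n) (sigma n) (cst 0) = Rint (f n).
Proof.
rewrite /load; have -> : Rint (fun x => `|dot (sigma n x) (grad (cst 0) x)|) = 0.
  rewrite -[RHS](mul0r (fine (leb Omega))) -Rintegral_cst//.
  apply: eq_Rintegral => x _; rewrite /dot big1 ?normr0// => i _.
  by rewrite mxE partial_cst mulr0.
by rewrite addr0; apply: eq_Rintegral => x _; rewrite subr0 mulr1.
Qed.

Lemma tight_cvg_continuous phi : continuous phi ->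
  Rint (fun x => f n x * phi x) @[n --> \oo] --> Rmu phi.
Proof. by move=> cphi; apply: f_mu; exact: continuous_subspaceT. Qed.

(** Choose the cut-off function by the zero capacity. The first part of its load
    converges to the integral of 1 - zeta for mu, by tight convergence; the second
    part is controlled by the bounded mean square of sigma and the small energy of
    zeta. The uniform bounds are the estimates for the cut-off function 0. *)
Lemma small_load : exists2 K, 0 < K & forall s : R, 0 < s -> s <= 1 ->
  exists zeta, [/\ cutoff Omega zeta, Rint zeta <= s ^+ 2,
    Rmu (fun x => 1 - zeta x) <= s ^+ 2 & \forall n \near \oo,
    [/\ load Omega (f n) (sigma n) zeta <= K * s, Rint (fun x => `|u n x|) <= K &
        Rint (fun x => dot (sigma n x) (sigma n x)) <= K]].
Proof.
pose V := fine (mu Omega).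
have V0 : 0 <= V by exact: fine_ge0.
have F1 : Rint (f n) @[n --> \oo] --> V.
  have := tight_cvg_continuous (@cst_continuous E R 1).
  rewrite [X in _ --> X -> _](_ : _ = V); last by rewrite Rintegral_cst// mul1r.
  by apply: eq_cvg_seq => n; apply: eq_Rintegral => x _; rewrite mulr1.
have FV : \forall n \near \oo, Rint (f n) <= V + 1.
  have /cvgrPdist_le/(_ 1 ltr01) := F1; apply: filterS => n.
  by rewrite ler_norml => /andP[h _]; lra.
pose S := (V + 1) / c.
have S0 : 0 < S by rewrite divr_gt0// ltr_pwDr.
exists (V + S + 3) => [|s s0 s1]; first by lra.
have s20 : 0 < s ^+ 2 by exact: exprn_gt0.
have [zeta [cz ze zi zm]] := capacity_cutoff oO bO N_gt0 capacity_A mu_A s20.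
exists zeta; split => //.
have [Cz _] := cz; have [sz _ _] := Cz.
have Fz : \forall n \near \oo, Rint (fun x => f n x * (1 - zeta x)) <= 2 * s ^+ 2.
  have cz' : continuous (cst 1 \- zeta).
    by apply: smooth_continuous; exact: (smoothB (smooth_cst 1) sz).
  have /cvgrPdist_le/(_ _ s20) := tight_cvg_continuous cz'; apply: filterS => n.
  by rewrite /= ler_norml => /andP[h _]; lra.
near=> n.
have Fn : Rint (f n) <= V + 1 by near: n.
have Fzn : Rint (fun x => f n x * (1 - zeta x)) <= 2 * s ^+ 2 by near: n.
have Sn : Rint (fun x => dot (sigma n x) (sigma n x)) <= S.
  have := fluxE n cutoff0; rewrite load0.
  have -> : Rint (fun x => dot (sigma n x) (sigma n x) * (1 - cst 0 x)) =
      Rint (fun x => dot (sigma n x) (sigma n x)).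
    by apply: eq_Rintegral => x _; rewrite subr0 mulr1.
  by move=> h; rewrite /S ler_pdivlMr// mulrC (le_trans h).
split; last by lra.
- rewrite /load.
  have : Rint (fun x => `|dot (sigma n x) (grad zeta x)|) <= (s * S + s) / 2.
    have g2 i := grad_sqintg i Cz.
    have igg := dot_intg oO g2 g2.
    have := le_Rintegral mO (intg_norm (dot_intg oO (sigma2 n) g2))
      (intgZ mO 2^-1 (intgD mO (intgZ mO s (sigma_intg n)) (intgZ mO s^-1 igg))).
    move=> /(_ _)/le_trans; apply.
      by move=> x _ /=; rewrite mulrC; exact: dot_young.
    have i1 := intgZ mO s (sigma_intg n); have i2 := intgZ mO s^-1 igg.
    rewrite RintegralZl//; last exact: intgD.
    rewrite mulrC ler_wpM2r ?invr_ge0// (RintegralD mO i1 i2).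
    rewrite (RintegralZl s mO (sigma_intg n)) (RintegralZl s^-1 mO igg).
    apply: lerD; first by rewrite ler_wpM2l// ltW.
    by rewrite mulrC ler_pdivrMr// -expr2.
  move=> h; apply: (le_trans (lerD Fzn h)).
  have : s ^+ 2 <= s by rewrite expr2 ler_piMl// ltW.
  have : 0 <= V * s by rewrite mulr_ge0// ltW.
  have : 0 <= S * s by rewrite mulr_ge0// ltW.
  by lra.
- have := massE n cutoff0; rewrite load0.
  have -> : Rint (fun x => `|u n x| * (1 - cst 0 x)) = Rint (fun x => `|u n x|).
    by apply: eq_Rintegral => x _; rewrite subr0 mulr1.
  by lra.
Unshelve. all: by end_near. Qed.

(** A bounded substitute for |u| tends to zero in mean: where the cut-off
    function is not close to 1 the mass of u is small, and the rest of Omega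
    has small measure. *)
Lemma cvg_in_measure :
  Rint (fun x => u n x ^+ 2 / (1 + u n x ^+ 2)) @[n --> \oo] --> (0 : R).
Proof.
have [K K0 small] := small_load.
apply/cvgrPdist_le => e e0.
pose s := Num.min 1 (e / (K + 1)).
have K10 : 0 < K + 1 by rewrite ltr_wpDr.
have s0 : 0 < s by rewrite lt_min ltr01 divr_gt0.
have s1 : s <= 1 by rewrite ge_min lexx.
have se : s * (K + 1) <= e by rewrite -ler_pdivlMr// ge_min lexx orbT.
have [zeta [cz ze zm nP]] := small s s0 s1.
apply: filterS nP => n [ln _ _].
rewrite sub0r normrN ger0_norm; last first.
  by apply: Rintegral_ge0 => x _; rewrite divr_ge0 ?sqr_ge0// ltW// add1sqr_gt0.
have [Cz zb] := cz.
have uz : intg (fun x => `|u n x| * (1 - zeta x)).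
  apply: (intgM_bounded mO (C := 1)); first exact: intg_norm.
    by apply: measurable_funB => //; apply: smooth_measurable; case: Cz.
  by move=> x _; have /andP[z0 z1] := cutoff_onem x cz; rewrite ger0_norm.
have zi : intg zeta by exact: Cc_intg Cz.
have mun : measurable_fun Omega (u n) by exact: intg_measurable (u_intg n).
have q01 x : 0 <= u n x ^+ 2 / (1 + u n x ^+ 2) <= 1.
  rewrite divr_ge0 ?sqr_ge0 ?(ltW (add1sqr_gt0 _))//=.
  by rewrite ler_pdivrMr ?add1sqr_gt0// mul1r lerDr.
apply: (@le_trans _ _ (Rint (fun x => `|u n x| * (1 - zeta x) + zeta x))).
  apply: le_Rintegral => //; last 2 first.
  - exact: (intgD mO uz zi).
  - move=> x _; have /andP[z0 z1] := zb x; have /andP[h1 h2] := q01 x.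
    have : u n x ^+ 2 / (1 + u n x ^+ 2) <= `|u n x|.
      rewrite ler_pdivrMr ?add1sqr_gt0//.
      rewrite -(real_normK (num_real (u n x))); have := normr_ge0 (u n x).
      by set y := `|_| => y0; have := sqr_ge0 (y - 1); nra.
    by nra.
  apply: (intg_bounded mO (C := 1) Ofin).
    rewrite (_ : (fun _ => _) = fun x => u n x ^+ 2 * (1 + u n x ^+ 2) `^ (-1)).
      apply: measurable_funM; first exact: measurable_funX.
      apply: (measurableT_comp (measurable_powR _)).
      by apply: measurable_funD => //; exact: measurable_funX.
    by apply/funext => x; rewrite powR_inv1// ltW// add1sqr_gt0.
  by move=> x _; have /andP[h1 h2] := q01 x; rewrite ger0_norm.
rewrite RintegralD//; apply: le_trans se.
have := massE n cz => h; have : s ^+ 2 <= s by rewrite expr2 ler_piMl// ltW.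
by lra.
Qed.

Lemma ae_cvg_subseq0 : ae_cvg_subseq Omega u (cst 0).
Proof.
move=> s hs.
pose e n x := u n x ^+ 2 / (1 + u n x ^+ 2).
have ei n : intg (e n).
  have mun : measurable_fun Omega (u n) by exact: intg_measurable (u_intg n).
  apply: (intg_bounded mO (C := 1) Ofin).
    rewrite (_ : e n = fun x => u n x ^+ 2 * (1 + u n x ^+ 2) `^ (-1)).
      apply: measurable_funM; first exact: measurable_funX.
      apply: (measurableT_comp (measurable_powR _)).
      by apply: measurable_funD => //; exact: measurable_funX.
    by apply/funext => x; rewrite powR_inv1// ltW// add1sqr_gt0.
  move=> x _; rewrite ger0_norm ?divr_ge0 ?sqr_ge0 ?(ltW (add1sqr_gt0 _))//.
  by rewrite ler_pdivrMr ?add1sqr_gt0// mul1r lerDr.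
have [t ht tae] := cvg_mean_subseq mO (fun k => ei (s k))
  (fun k x _ => divr_ge0 (sqr_ge0 _) (ltW (add1sqr_gt0 _)))
  (cvg_subseq hs cvg_in_measure).
exists t => //; apply: filterS tae => x tx Ox.
apply: cvg_sqr0.
have {}tx := tx Ox.
have -> : (fun k => u (s (t k)) x ^+ 2) =
    (fun k => e (s (t k)) x * (1 - e (s (t k)) x)^-1).
  apply/funext => k; rewrite /e; set y := u _ x.
  have y0 : 1 + y ^+ 2 != 0 by rewrite gt_eqF// add1sqr_gt0.
  have -> : 1 - y ^+ 2 / (1 + y ^+ 2) = (1 + y ^+ 2)^-1 by field.
  by rewrite invrK mulfVK.
rewrite -(mul0r (1 - 0)^-1); apply: cvgM => //.
apply: cvgV; first by rewrite subr0.
by apply: cvgB => //; exact: cvg_cst.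
Qed.

(** The flux tends to zero in mean: it is small in mean square where the cut-off
    function is not close to 1, and bounded in mean square on the small rest. *)
Lemma flux_cvg0 eta : Cc_infty Omega eta ->
  Rint (fun x => dot (sigma n x) (grad eta x)) @[n --> \oo] --> (0 : R).
Proof.
move=> Ceta; have [K K0 small] := small_load.
have [B B0 etaB] := grad_bounded Ceta.
pose V := fine (leb Omega).
have V0 : 0 <= V by exact: fine_ge0.
pose C := K / c + B * V + K + B.
have Kc0 : 0 < K / c by exact: divr_gt0.
have BV0 : 0 <= B * V by exact: mulr_ge0.
have C0 : 0 < C by rewrite /C; lra.
apply/cvgrPdist_le => e e0.
pose s := Num.min 1 (e / C).
have s0 : 0 < s by rewrite lt_min ltr01 divr_gt0.
have s1 : s <= 1 by rewrite ge_min lexx.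
have se : s * C <= e by rewrite -ler_pdivlMr// ge_min lexx orbT.
have s20 : 0 < s ^+ 2 by exact: exprn_gt0.
have s21 : s ^+ 2 <= 1 by rewrite exprn_ile1// ltW.
have [zeta [cz ze zm nP]] := small _ s20 s21.
have [Cz zb] := cz.
apply: filterS nP => n [ln _ Sn].
rewrite sub0r normrN.
have ge i := grad_sqintg i Ceta.
have sz : intg (fun x => dot (sigma n x) (sigma n x) * (1 - zeta x)).
  apply: (intgM_bounded mO (C := 1)) => //.
    by apply: measurable_funB => //; apply: smooth_measurable; case: Cz.
  by move=> x _; have /andP[z0 z1] := cutoff_onem x cz; rewrite ger0_norm.
have zi : intg zeta by exact: Cc_intg Cz.
have i1 := intgZ mO s^-1 sz.
have i2 := intg_cst mO Ofin (s * B).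
have i3 := intgZ mO s (sigma_intg n).
have i4 := intgZ mO (s^-1 * B) zi.
have := le_norm_Rint mO (dot_intg oO (sigma2 n) ge)
  (intgZ mO 2^-1 (intgD mO (intgD mO i1 i2) (intgD mO i3 i4))).
move=> /(_ _)/le_trans; apply.
  move=> x _ /=; have /andP[z0 z1] := zb x.
  have eB := etaB x; have eg0 := dot_ge0 (grad eta x).
  have sV : 0 < s^-1 by rewrite invr_gt0.
  have h1 := dot_young (sigma n x) (grad eta x) sV; rewrite invrK in h1.
  have h2 := dot_young (sigma n x) (grad eta x) s0.
  have d0 := dot_ge0 (sigma n x).
  move: h1 h2 eB eg0 d0; set y := `|_|; set D := dot (sigma n x) _; set G := dot _ _.
  move=> h1 h2 eB eg0 d0.
  have g1 : y * (1 - zeta x) <= (s^-1 * D + s * G) / 2 * (1 - zeta x).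
    by rewrite ler_wpM2r// subr_ge0.
  have g2 : y * zeta x <= (s * D + s^-1 * G) / 2 * zeta x by rewrite ler_wpM2r.
  have g3 : s * G * (1 - zeta x) <= s * B.
    apply: (@le_trans _ _ (s * G)); last by rewrite ler_pM2l.
    by rewrite ler_piMr ?mulr_ge0 ?(ltW s0)//; lra.
  have g4 : s * D * zeta x <= s * D by rewrite ler_piMr// mulr_ge0// ltW.
  have g5 : s^-1 * G * zeta x <= s^-1 * B * zeta x.
    by rewrite ler_wpM2r// ler_wpM2l// ltW.
  by lra.
rewrite RintegralZl//; last exact: (intgD mO (intgD mO i1 i2) (intgD mO i3 i4)).
rewrite (RintegralD mO (intgD mO i1 i2) (intgD mO i3 i4)) (RintegralD mO i1 i2) (RintegralD mO i3 i4).
rewrite (RintegralZl s^-1 mO sz) (RintegralZl s mO (sigma_intg n)).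
rewrite (RintegralZl (s^-1 * B) mO zi).
have -> : Rint (cst (s * B)) = s * B * V by exact: Rintegral_cst.
have b1 : s^-1 * Rint (fun x => dot (sigma n x) (sigma n x) * (1 - zeta x)) <= K / c * s.
  rewrite mulrC ler_pdivrMr//.
  have -> : K / c * s * s = K * s ^+ 2 / c by rewrite expr2; ring.
  rewrite ler_pdivlMr// mulrC.
  exact: le_trans (fluxE n cz) ln.
have b4 : s^-1 * B * Rint zeta <= B * s.
  rewrite mulrAC (mulrC _ B) ler_wpM2l// mulrC ler_pdivrMr// -expr2.
  by apply: (le_trans ze); rewrite expr2 ler_piMl// ltW.
have b3 : s * Rint (fun x => dot (sigma n x) (sigma n x)) <= s * K by rewrite ler_pM2l.
have CE : s * C = K / c * s + s * B * V + s * K + B * s by rewrite /C; ring.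
have : 0 <= s * C by rewrite mulr_ge0// ltW.
by lra.
Qed.

(** Only the flux separates u from f in the weak formulation. *)
Lemma cvg_test eta : Cc_infty Omega eta ->
  Rint (fun x => u n x * eta x) @[n --> \oo] --> Rmu eta.
Proof.
move=> Ceta; have [seta _ _] := Ceta.
have -> : (fun n => Rint (fun x => u n x * eta x)) =
    (fun n => Rint (fun x => f n x * eta x)) -
    (fun n => Rint (fun x => dot (sigma n x) (grad eta x))).
  by apply/funext => n; rewrite !fctE -(weak n (H10_Cc oO bO Ceta)) addrC addKr.
rewrite -[X in _ --> X]subr0; apply: cvgB; last exact: flux_cvg0.
exact: (tight_cvg_continuous (smooth_continuous seta)).
Qed.

(** The cut-off function is supported in a compact subset of Omega, on which phi
    is uniformly close to a smooth function; the product of the two is a test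
    function. The part of u outside of the support has small mass. *)
Lemma cvg_bounded_continuous (phi : E -> R) (B : R) :
  {within Omega, continuous phi} -> (forall x, Omega x -> `|phi x| <= B) ->
  Rint (fun x => u n x * phi x) @[n --> \oo] --> Rmu phi.
Proof.
move=> cphi phiB0.
have {phiB0} phiB x : Omega x -> `|phi x| <= `|B|.
  by move=> /phiB0/le_trans; apply; exact: ler_norm.
move: `|B| (normr_ge0 B) phiB => {}B B0 phiB.
have [K K0 small] := small_load.
pose V := fine (mu Omega).
have V0 : 0 <= V by exact: fine_ge0.
have mphi : measurable_fun Omega phi by exact: measurable_fun_open_continuous.
pose C := B * K + K + 1 + V + B.
have C0 : 0 < C by have := mulr_ge0 B0 (ltW K0); rewrite /C; lra.
apply/cvgrPdist_le => e e0.
pose s := Num.min 1 (e / C).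
have s0 : 0 < s by rewrite lt_min ltr01 divr_gt0.
have s1 : s <= 1 by rewrite ge_min lexx.
have se : s * C <= e by rewrite -ler_pdivlMr// ge_min lexx orbT.
have ss : s ^+ 2 <= s by rewrite expr2 ler_piMl// ltW.
have [zeta [cz ze zm nP]] := small s s0 s1.
have [Cz zb] := cz; have [sz cS SO] := Cz.
have cphiS : {within closure [set x | zeta x != 0], continuous phi}.
  exact: continuous_subspaceW cphi.
have [P sP PP] := smooth_approximation cS cphiS s0.
pose eta := zeta \* P.
have Ceta : Cc_infty Omega eta by exact: Cc_inftyM.
have [seta _ _] := Ceta.
have close x : Omega x -> `|zeta x * phi x - eta x| <= s.
  move=> Ox; have [zx0|zx0] := eqVneq (zeta x) 0.
    by rewrite /eta /= zx0 !mul0r subr0 normr0 ltW.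
  rewrite /eta /= -mulrBr normrM distrC.
  have /andP[z0 z1] := zb x; rewrite (ger0_norm z0).
  rewrite -[leRHS]mul1r ler_pM//.
  by apply: PP; exact: subset_closure.
have mz : measurable_fun Omega zeta by exact: smooth_measurable.
have meta : measurable_fun Omega eta by exact: smooth_measurable.
have /cvgrPdist_le/(_ _ s0) := cvg_test Ceta.
apply: filterS2 nP => n [ln un _] etan.
have z1 x : `|1 - zeta x| <= 1.
  by have /andP[z0 z1] := cutoff_onem x cz; rewrite ger0_norm.
have uz : intg (fun x => `|u n x| * (1 - zeta x)).
  apply: (intgM_bounded mO (C := 1)) => //; first exact: intg_norm.
  exact: measurable_funB.
have uzphi : intg (fun x => u n x * (phi x * (1 - zeta x))).
  apply: (intgM_bounded mO (C := B)) => //.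
    by apply: measurable_funM => //; exact: measurable_funB.
  move=> x Ox; rewrite normrM -[leRHS]mulr1 ler_pM//; exact: phiB.
have uclose : intg (fun x => u n x * (zeta x * phi x - eta x)).
  apply: (intgM_bounded mO (C := s)) => //.
  by apply: measurable_funB => //; exact: measurable_funM.
have [Ceta0 etaC] := Cc_infty_bounded Ceta.
have ueta : intg (fun x => u n x * eta x).
  exact: (intgM_bounded mO (C := Ceta0)).
have mclose : mintg (fun x => eta x - zeta x * phi x).
  apply: (intg_bounded mO (C := s) muOfin).
    by apply: measurable_funB => //; exact: measurable_funM.
  by move=> x Ox; rewrite distrC close.
have meta' : mintg eta by exact: (intg_bounded mO (C := Ceta0) muOfin).
have mphi' : mintg phi by exact: (intg_bounded mO (C := B) muOfin).
have mzphi : mintg (fun x => phi x * (1 - zeta x)).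
  apply: (intgM_bounded mO (C := 1)) => //; exact: measurable_funB.
have mz1 : mintg (fun x => 1 - zeta x).
  by apply: (intg_bounded mO (C := 1) muOfin) => //; exact: measurable_funB.
have uE : Rint (fun x => u n x * phi x) =
    Rint (fun x => u n x * (phi x * (1 - zeta x))) +
    Rint (fun x => u n x * (zeta x * phi x - eta x)) +
    Rint (fun x => u n x * eta x).
  rewrite -(RintegralD mO uzphi uclose) -(RintegralD mO (intgD mO uzphi uclose) ueta).
  by apply: eq_Rintegral => x _ /=; ring.
have muE : Rmu phi = Rmu (fun x => phi x * (1 - zeta x)) + Rmu eta -
    Rmu (fun x => eta x - zeta x * phi x).
  rewrite -(RintegralD mO mzphi meta') -(RintegralB mO (intgD mO mzphi meta') mclose).
  by apply: eq_Rintegral => x _ /=; ring.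
have b1 : `|Rint (fun x => u n x * (phi x * (1 - zeta x)))| <= B * (K * s).
  apply: (@le_trans _ _ (B * Rint (fun x => `|u n x| * (1 - zeta x)))); last first.
    by rewrite ler_wpM2l// (le_trans (massE n cz)).
  rewrite -RintegralZl//; apply: (le_norm_Rint mO) => //; first exact: (intgZ mO).
  move=> x Ox; rewrite !normrM mulrCA (ger0_norm (x := 1 - zeta x)).
    by rewrite ler_wpM2r ?phiB// mulr_ge0//; case/andP: (cutoff_onem x cz).
  by case/andP: (cutoff_onem x cz).
have b2 : `|Rint (fun x => u n x * (zeta x * phi x - eta x))| <= s * K.
  apply: (@le_trans _ _ (s * Rint (fun x => `|u n x|))); last first.
    by rewrite ler_pM2l.
  rewrite -RintegralZl//; last exact: intg_norm.
  apply: (le_norm_Rint mO) => //; first exact/(intgZ mO)/intg_norm.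
  by move=> x Ox; rewrite normrM mulrC ler_wpM2r// close.
have b3 : `|Rmu (fun x => phi x * (1 - zeta x))| <= B * s.
  apply: (@le_trans _ _ (B * Rmu (fun x => 1 - zeta x))); last first.
    by rewrite ler_wpM2l// (le_trans zm).
  rewrite -RintegralZl//; apply: (le_norm_Rint mO) => //; first exact: (intgZ mO).
  move=> x Ox; rewrite normrM (ger0_norm (x := 1 - zeta x)).
    by rewrite ler_wpM2r ?phiB//; case/andP: (cutoff_onem x cz).
  by case/andP: (cutoff_onem x cz).
have b4 : `|Rmu (fun x => eta x - zeta x * phi x)| <= s * V.
  rewrite -Rintegral_cst//; apply: (le_norm_Rint mO) => //.
    exact: (intg_cst mO muOfin).
  by move=> x Ox; rewrite distrC close.
rewrite uE muE; apply: le_trans se; rewrite /C.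
move: b1 b2 b3 b4 etan; rewrite !ler_norml.
move=> /andP[? ?] /andP[? ?] /andP[? ?] /andP[? ?] /andP[? ?].
by apply/andP; split; lra.
Qed.

End one_sequence.
Lemma approximating_sequence_cvg (f u : nat -> E -> R) :
  approximating_sequence Omega a gamma mu f u ->
  ae_cvg_subseq Omega u (cst 0) /\
  forall phi B, {within Omega, continuous phi} ->
    (forall x, Omega x -> `|phi x| <= B) ->
    Rint (fun x => u n x * phi x) @[n --> \oo] --> Rmu phi.
Proof.
move=> [foo f0 fmu sol].
have fi n : intg (f n) by exact: Lpoo_intg.
have /choice[Du] n := weak_solution_flux oO beta_gt0 gamma_gt1 caratheodory_a structure_a (sol n).
move=> /choice[sigma H].
have H1 n := let: And4 h _ _ _ := H n in h.
have H2 n := let: And4 _ h _ _ := H n in h.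
have H3 n := let: And4 _ _ h _ := H n in h.
have H4 n := let: And4 _ _ _ h := H n in h.
split; first exact: (ae_cvg_subseq0 fi f0 fmu H1 H2 H3 H4).
move=> phi B; exact: (cvg_bounded_continuous fi f0 fmu H1 H2 H3 H4).
Qed.

(** An essential bound of a continuous function is a bound: the set where it is
    violated is open and has measure zero. *)
Lemma continuous_Lpoo_bounded (phi : E -> R) :
  Lp Omega +oo%E phi -> {within Omega, continuous phi} ->
  exists B, forall x, Omega x -> `|phi x| <= B.
Proof.
move=> /(Lpoo_bounded oO)[mphi [C C0 [Z [mZ Z0 phiC]]]] cphi.
exists C => x Ox; rewrite leNgt; apply/negP => Cx.
pose U := Omega `&` (fun y => `|phi y|) @^-1` [set t | C < t].
have oU : open U.
  have cn : {within Omega, continuous (fun y => `|phi y|)}.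
    move=> y; exact: (@cvg_comp _ _ _ (phi : subspace Omega -> R) (fun t : R => `|t|) _ _ _
      (cphi y) (@norm_continuous R R (phi y))).
  rewrite /U open_setSI//; move/continuousP : cn; apply; exact: open_gt.
have U0 : (0 < leb U)%E by apply: open_lebesgue_gt0 oU _; exists x.
have : (leb U <= leb Z)%E.
  apply: le_measure; rewrite ?inE//; first exact: open_measurable_mx.
  move=> y [Oy Cy]; apply: phiC => /= h; have := h Oy.
  by rewrite leNgt Cy.
by rewrite Z0 leNgt U0.
Qed.

(** A function that is almost everywhere equal to zero has no other gradient in
    W^{1,1}_0 than zero: the smooth derivatives p_k that approximate its
    gradient g give the test functions h(p_k), h(p) = p / (1 + p^2), and
    since the integral of g h(p_k) vanishes, that of g h(g) is at most twice the
    distance of g and p_k. *)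
Lemma W10_gradient0 (u : E -> R) (Du : E -> E) : W10 Omega 1%E u Du ->
  {ae leb, forall x, Omega x -> u x = 0} ->
  {ae leb, forall x, Omega x -> Du x = 0}.
Proof.
move=> [[_ LDu wDu] [psi [Cpsi [_ dpsi]]]] u0.
suff Di0 i : {ae leb, forall x, Omega x -> Du x 0 i = 0}.
  have : {ae leb, forall x, forall n (h : (n < N)%N), Omega x -> Du x 0 (Ordinal h) = 0}.
    apply: ae_foralln => n; case: (pselect (n < N)%N) => nN; last first.
      by apply: aeW => x h; case: (nN h).
    apply: filterS (Di0 (Ordinal nN)) => x Dx h Ox.
    by rewrite -(Dx Ox); congr (Du x 0 _); exact: val_inj.
  apply: filterS => x Dx Ox; apply/rowP => -[n h]; rewrite mxE.
  exact: Dx.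
pose g x := Du x 0 i.
have gi : intg g by apply/(Lp1P oO); exact: LDu.
pose p k := partial i (psi k).
have Cp k : Cc_infty Omega (p k) by exact: Cc_infty_partial.
have pgi k : intg (fun x => p k x - g x).
  by apply: (intgB mO) => //; exact: Cc_intg (Cp k).
pose d k := Rint (fun x => `|p k x - g x|).
have d0 : d k @[k --> \oo] --> (0 : R).
  have := dpsi i; rewrite (_ : (fun _ => _) = EFin \o d); last first.
    by apply/funext => k; rewrite (Lnorm1E oO (pgi k)).
  by move=> /fine_cvgP[_].
pose h (s : R) := s * (1 + s ^+ 2)^-1.
have q0 (s : R) : 0 < (1 + s ^+ 2)^-1 by rewrite invr_gt0 add1sqr_gt0.
have qq (s : R) : (1 + s ^+ 2)^-1 * (1 + s ^+ 2) = 1.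
  by rewrite mulVf// gt_eqF// add1sqr_gt0.
have h1 s : `|h s| <= 1.
  rewrite /h normrM (gtr0_norm (q0 s)) ler_pdivrMr ?add1sqr_gt0// mul1r.
  rewrite -(real_normK (num_real s)); have := sqr_ge0 (`|s| - 1); nra.
have hlip s t : s * h s <= t * h t + `|t - s|.
  have hE (r : R) : r * h r = 1 - (1 + r ^+ 2)^-1.
    by rewrite /h -[X in X - _](qq r); ring.
  rewrite !hE; suff : (1 + t ^+ 2)^-1 <= (1 + s ^+ 2)^-1 + `|t - s| by lra.
  rewrite -(ler_pM2r (add1sqr_gt0 t)) qq -(ler_pM2r (add1sqr_gt0 s)) mul1r.
  have -> : ((1 + s ^+ 2)^-1 + `|t - s|) * (1 + t ^+ 2) * (1 + s ^+ 2) =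
      (1 + s ^+ 2)^-1 * (1 + s ^+ 2) * (1 + t ^+ 2) +
      `|t - s| * ((1 + t ^+ 2) * (1 + s ^+ 2)) by ring.
  rewrite qq mul1r.
  have w0 := normr_ge0 (t - s).
  have h2 : s ^+ 2 - t ^+ 2 <= `|t - s| * `|t + s|.
    rewrite -normrM -normrN; apply: le_trans (ler_norm _).
    by have -> : s ^+ 2 - t ^+ 2 = - ((t - s) * (t + s)) by ring.
  have h3 : `|t + s| <= (1 + t ^+ 2) * (1 + s ^+ 2).
    have := sqr_ge0 (t - 1); have := sqr_ge0 (s - 1).
    have := sqr_ge0 (t + 1); have := sqr_ge0 (s + 1).
    have := mulr_ge0 (sqr_ge0 t) (sqr_ge0 s).
    by rewrite ler_norml => *; apply/andP; split; nra.
  have := ler_wpM2l w0 h3; lra.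
have Ch k : Cc_infty Omega (h \o p k).
  have [sp _ _] := Cp k; apply: Cc_infty_sub (Cp k) _ _; last first.
    by move=> x px; rewrite /= px /h mul0r.
  apply: (smoothM sp); apply: smoothV => [x|]; first exact: add1sqr_gt0.
  exact: (smoothD (smooth_cst 1) (smoothX 2 sp)).
have mh f : measurable_fun Omega f -> measurable_fun Omega (h \o f).
  move=> mf; rewrite (_ : h \o f = fun x => f x * (1 + f x ^+ 2) `^ (-1)).
    apply: measurable_funM => //; apply: (measurableT_comp (measurable_powR _)).
    by apply: measurable_funD => //; exact: measurable_funX.
  by apply/funext => x; rewrite powR_inv1// ltW// add1sqr_gt0.
have ghi k : intg (fun x => g x * h (p k x)).
  apply: (intgM_bounded mO (C := 1)) => //.
  by apply: mh; exact: smooth_measurable (let: And3 s _ _ := Cp k in s).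
have ghp k : Rint (fun x => g x * h (p k x)) = 0.
  have := wDu _ (Ch k) i.
  have -> : Rint (fun x => u x * partial i (h \o p k) x) = Rint (cst 0).
    apply: ae_eq_nonmeasurable_Rintegral; apply: filterS u0 => x ux Ox.
    by rewrite ux// mul0r.
  rewrite Rintegral_cst// mul0r => /eqP; rewrite eq_sym oppr_eq0 => /eqP.
  exact.
have ggi : intg (fun x => g x * h (g x)).
  apply: (intgM_bounded mO (C := 1)) => //.
  by apply: mh; exact: intg_measurable gi.
have I0 : Rint (fun x => g x * h (g x)) <= 0.
  apply/ler_addgt0Pr => e e0; rewrite add0r.
  have /cvgrPdist_le/(_ e e0)[k _ kP] := cvg0Z 2 d0.
  have {}kP : 2 * d k <= e.
    by have := kP k (leqnn k); rewrite sub0r normrN; apply: le_trans; exact: ler_norm.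
  apply: le_trans kP; have i2 := intgZ mO 2 (intg_norm (pgi k)).
  rewrite /d -RintegralZl//; last exact: intg_norm.
  rewrite -[leRHS]add0r -(ghp k) -(RintegralD mO (ghi k) i2).
  apply: le_Rintegral => //; first exact: (intgD mO (ghi k) i2).
  move=> x _; have := hlip (g x) (p k x).
  have : (p k x - g x) * h (p k x) <= `|p k x - g x|.
    by apply: (le_trans (ler_norm _)); rewrite normrM ler_piMr.
  by lra.
have gg0 x : 0 <= g x * h (g x) by rewrite /h mulrA -expr2 mulr_ge0 ?sqr_ge0// ltW.
apply: filterS (Rint_le0_ae mO ggi (fun x _ => gg0 x) I0) => x + Ox.
move=> /(_ Ox)/eqP; rewrite /h !mulf_eq0 (gt_eqF (q0 _)) orbF orbb => /eqP.
exact.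
Qed.

(** The limit of approximating solutions vanishes by concentration, so its flux
    vanishes and the datum cannot be charged. *)
Lemma no_measure_solution u : measure_solution Omega a gamma mu u ->
  (mu Omega <= 0)%E.
Proof.
move=> [_ [Du [W10u weak]] [f [u_ [app u_u]]]].
have [sub _] := approximating_sequence_cvg app.
have [t ht tae] := sub id (fun m n h => h).
have u0 : {ae leb, forall x, Omega x -> u x = 0}.
  apply: filterS2 tae u_u => x h1 h2 Ox.
  exact: (cvg_unique _ (cvg_subseq ht (h2 Ox)) (h1 Ox)).
have Du0 := W10_gradient0 W10u u0.
have flux0 : {ae leb, forall x, Omega x -> flux a gamma u Du x = 0}.
  apply: filterS2 Du0 structure_a => x Dx sx Ox.
  have [_ /(_ 0) h _] := sx Ox; rewrite /flux Dx//.
  suff -> : a x 0 = 0 by rewrite scaler0.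
  have e0 : enorm (0 : E) = 0.
    by rewrite /enorm /dot big1 ?sqrtr0// => i _; rewrite mxE mul0r.
  have d0 : dot (a x 0) (a x 0) <= 0.
    rewrite -enorm_sqr; rewrite e0 mulr0 in h.
    have -> : enorm (a x 0) = 0 by apply/le_anti; rewrite h sqrtr_ge0.
    by rewrite expr0n.
  apply/rowP => i; rewrite mxE; apply/eqP; rewrite -sqrf_eq0; apply/eqP/le_anti.
  by rewrite sqr_ge0 (le_trans (sqr_coord_dot _ i) d0).
have mu0 phi : Cc_infty Omega phi -> Rmu phi = 0.
  move=> Cphi; rewrite -(weak _ Cphi).
  have R0 : Rint (cst 0) = 0 by rewrite Rintegral_cst// mul0r.
  have -> : Rint (fun x => dot (flux a gamma u Du x) (grad phi x)) = Rint (cst 0).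
    apply: ae_eq_nonmeasurable_Rintegral; apply: filterS flux0 => x fx Ox.
    by rewrite fx// /dot big1// => i _; rewrite mxE mul0r.
  have -> : Rint (fun x => u x * phi x) = Rint (cst 0).
    apply: ae_eq_nonmeasurable_Rintegral; apply: filterS u0 => x ux Ox.
    by rewrite ux// mul0r.
  by rewrite R0 addr0.
rewrite -[leLHS]fineK ?fin_num_measure// lee_fin; apply/ler_addgt0Pr => e e0.
have [zeta [[Cz _] _ _ zm]] := capacity_cutoff oO bO N_gt0 capacity_A mu_A e0.
have [C zC] := Cc_infty_bounded Cz; have [sz _ _] := Cz.
have zi : mintg zeta.
  by apply: (intg_bounded mO (C := C) muOfin) => //; exact: smooth_measurable.
rewrite add0r; apply: le_trans zm.
rewrite (RintegralB mO (intg_cst mO muOfin 1) zi) (mu0 _ Cz) subr0.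
by rewrite Rintegral_cst// mul1r.
Qed.

End concentration.

Theorem theorem4p1 (R : realType) (N : nat) (N_gt2 : (2 < N)%N)
  (Omega : set 'rV[R]_N) (open_Omega : open Omega)
  (bounded_Omega : bounded_set Omega)
  (a : 'rV[R]_N -> 'rV[R]_N -> 'rV[R]_N) (alpha beta : R)
  (alpha_gt0 : 0 < alpha) (beta_gt0 : 0 < beta)
  (caratheodory_a : caratheodory_fun Omega a)
  (structure_a : leray_lions Omega a alpha beta)
  (gamma : R) (gamma_gt1 : 1 < gamma)
  (mu : {finite_measure set 'rV[R]_N -> \bar R})
  (A : set 'rV[R]_N) (A_sub : A `<=` Omega)
  (mu_A : concentrated_on Omega mu A) (capacity_A : capacity Omega A = 0%E) :
  ((0 < mu Omega)%E -> ~ exists u, measure_solution Omega a gamma mu u) /\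
  (forall f u : nat -> 'rV[R]_N -> R,
    approximating_sequence Omega a gamma mu f u ->
    ae_cvg_subseq Omega u (cst 0) /\
    (forall phi Dphi, W10infty Omega phi Dphi ->
      {within Omega, continuous phi} ->
      \int[lebesgue_rV N]_(x in Omega) (u n x * phi x) @[n --> \oo] -->
      \int[mu]_(x in Omega) phi x)).
Proof.
have N0 : (0 < N)%N by exact: ltnW (ltnW N_gt2).
split.
  move=> mu0 [u sol].
  have := no_measure_solution open_Omega bounded_Omega alpha_gt0 beta_gt0
    gamma_gt1 caratheodory_a structure_a N0 mu_A capacity_A sol.
  by rewrite leNgt mu0.
move=> f u app.
have [sub mass] := approximating_sequence_cvg open_Omega bounded_Omega alpha_gt0
  beta_gt0 gamma_gt1 caratheodory_a structure_a N0 mu_A capacity_A app.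
split=> // phi Dphi [[Lphi _ _] _] cphi.
have [B phiB] := continuous_Lpoo_bounded open_Omega Lphi cphi.
exact: mass cphi phiB.
Qed.
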